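(* Let $M\subset\mathbb{R}^n$ be a $d$-dimensional $C^2$ submanifold with $0\in M$. Write $T=T_0M$ and $S=S_y=T_yM$ for $y\in M$. If $\Pi$ is any element of $$\{\,2S^{\perp}\circ T^{\perp},\ S\circ T,\ -S^{\perp}\circ T\,\},$$ then $\lim_{\varepsilon\to 0}H_\varepsilon^{\Pi}(0,M)=H(0,M)$. Moreover, if $\Pi$ is any element of $$\{\,T,\ T\circ S,\ S\circ T^{\perp},\ T\circ S^{\perp}\,\},$$ then $\lim_{\varepsilon\to 0}H_\varepsilon^{\Pi}(0,M)=0$.
   Context: Let $\rho,\xi:\mathbb{R}^+\to\mathbb{R}$ be non-negative smooth functions supported in $[0,1]$, and set $C_\rho=d\,\omega_d\int_0^1\rho(t)t^{d-1}\,dt$, $C_\xi=d\,\omega_d\int_0^1\xi(t)t^{d-1}\,dt$ (assumed nonzero; $\omega_d$ is the volume of the unit ball of $\mathbb{R}^d$). The $d$-varifold associated with $M$ (multiplicity one) is again denoted $M$, and $\|M\|=\mathcal{H}^d\llcorner M$ is its mass measure. A linear subspace is identified with the orthogonal projection onto it, and for a subspace (projection) $P$, $P^\perp=\mathrm{Id}-P$. A symbol such as $S\circ T$ denotes the family of linear operators $\Pi_y=T_yM\circ T_0M$, $y\in M$ (so $T$ is constant in $y$ and $S$ depends on $y$). For a family $\Pi=(\Pi_y)_y$ of linear operators of $\mathbb{R}^n$ and $\varepsilon\in(0,1)$, the approximate mean curvature vector at $0$ is $$H_\varepsilon^{\Pi}(0,M)=-\frac{C_\xi}{C_\rho}\,\frac{\varepsilon^{-d-1}\int_{\mathbb{R}^n}\rho'\!\left(\frac{|y|}{\varepsilon}\right)\Pi_y\!\left(\frac{y}{|y|}\right)d\|M\|(y)}{\varepsilon^{-d}\int_{\mathbb{R}^n}\xi\!\left(\frac{|y|}{\varepsilon}\right)d\|M\|(y)}.$$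 $H(0,M)$ is the mean curvature vector of $M$ at $0$ (the trace of the second fundamental form, so that the first variation is $\delta M=-H\,\|M\|$ in the interior of $M$). *)

(* Defs.v *)
From HB Require Import structures.
From mathcomp Require Import all_boot all_order all_algebra.
From mathcomp Require Import all_classical all_reals all_analysis.
Import Order.TTheory GRing.Theory Num.Theory.
Import numFieldNormedType.Exports.

Set Implicit Arguments.
Unset Strict Implicit.
Unset Printing Implicit Defensive.

Local Open Scope classical_set_scope.
Local Open Scope ring_scope.

(* The library norm on 'rV[R]_n is the sup norm: it is used below only through
   its topology and the associated derivatives, which are the Euclidean ones. *)
Definition dotp (R : realType) n (u v : 'rV[R]_n) : R :=
  \sum_(i < n) u 0 i * v 0 i.

Definition enorm (R : realType) n (u : 'rV[R]_n) : R := Num.sqrt (dotp u u).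

(* Outer measure generated by a set function zeta through countable covers. *)
Definition cover_outer (R : realType) (X : Type) (zeta : set X -> \bar R)
    (A : set X) : \bar R :=
  ereal_inf [set (\sum_(0 <= k <oo) zeta (E k))%E
            | E in [set E : (set X)^nat | A `<=` \bigcup_k E k]].

Section cover_outer_theory.
Context (R : realType) (X : pointedType) (zeta : set X -> \bar R).
Hypotheses (zeta0 : zeta set0 = 0%E) (zeta_ge0 : forall E, (0 <= zeta E)%E).

Definition all_measurable : Type := X.
HB.instance Definition _ := Pointed.on all_measurable.
HB.instance Definition _ := @isMeasurable.Build default_measure_display
  all_measurable (@discrete_measurable X) (@discrete_measurable0 X)
  (@discrete_measurableC X) (@discrete_measurableU X).

Lemma cover_outerE : cover_outer zeta = mu_ext (zeta : set all_measurable -> _).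
Proof.
apply/funext => A; rewrite /cover_outer /mu_ext; congr ereal_inf.
by apply/seteqP; split => x [E AE <-]; exists E => //; case: AE.
Qed.

Lemma cover_outer0 : cover_outer zeta set0 = 0%E.
Proof. by rewrite cover_outerE; exact: mu_ext0. Qed.

Lemma cover_outer_ge0 A : (0 <= cover_outer zeta A)%E.
Proof. by rewrite cover_outerE; exact: mu_ext_ge0. Qed.

Lemma le_cover_outer :
  {homo cover_outer zeta : A B / A `<=` B >-> (A <= B)%E}.
Proof.
by rewrite cover_outerE; exact: (@le_mu_ext _ all_measurable R zeta).
Qed.

Lemma cover_outer_sigma_subadditive : sigma_subadditive (cover_outer zeta).
Proof.
rewrite cover_outerE.
exact: (@mu_ext_sigma_subadditive _ all_measurable R zeta).
Qed.

End cover_outer_theory.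

Definition box (R : realType) n (a b : 'rV[R]_n) : set 'rV[R]_n :=
  [set x | forall i, a 0 i <= x 0 i <= b 0 i].

(* A nonempty box determines its endpoints, so that the infimum is then over a
   singleton; it is over the empty set, hence +oo, if E is not a box. *)
Definition box_volume (R : realType) n (E : set 'rV[R]_n) : \bar R :=
  if E == set0 then 0%E
  else ereal_inf [set (\prod_(i < n) (ab.2 0 i - ab.1 0 i))%:E
                 | ab in [set ab : 'rV[R]_n * 'rV[R]_n | E = box ab.1 ab.2]].

Definition lebesgue_outer (R : realType) n : set 'rV[R]_n -> \bar R :=
  cover_outer (@box_volume R n).

Definition ball_volume (R : realType) n : R :=
  fine (lebesgue_outer [set x : 'rV[R]_n | enorm x <= 1]).

Definition ediam (R : realType) n (E : set 'rV[R]_n) : \bar R :=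
  ereal_sup [set (enorm (xy.1 - xy.2))%:E | xy in E `*` E].

Definition hausdorff_gauge (R : realType) n (d : nat) (delta : R)
    (E : set 'rV[R]_n) : \bar R :=
  if E == set0 then 0%E
  else if (ediam E <= delta%:E)%E
       then (ball_volume R d * (fine (ediam E) / 2) ^+ d)%:E
       else +oo%E.

Definition hausdorff (R : realType) n (d : nat) (A : set 'rV[R]_n) : \bar R :=
  ereal_sup [set cover_outer (hausdorff_gauge d delta) A
            | delta in [set delta : R | 0 < delta]].

Section hausdorff_theory.
Context (R : realType) (n d : nat).

Lemma dotpp_ge0 m (u : 'rV[R]_m) : 0 <= dotp u u.
Proof. by apply: sumr_ge0 => i _; rewrite -expr2 sqr_ge0. Qed.

Lemma ediam_ge0 (E : set 'rV[R]_n) : E !=set0 -> (0 <= ediam E)%E.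
Proof.
move=> [x Ex]; apply: ereal_sup_ubound; exists (x, x) => //=.
rewrite subrr /enorm; congr EFin; rewrite /dotp big1 ?sqrtr0// => i _.
by rewrite mxE mul0r.
Qed.

Lemma box_volume_ge0 m (E : set 'rV[R]_m) : (0 <= box_volume E)%E.
Proof.
rewrite /box_volume; case: eqP => // /eqP/set0P[x Ex].
apply: le_ereal_inf_tmp => _ [[a b] /= Eab <-]; rewrite lee_fin.
apply: prodr_ge0 => i _; rewrite subr_ge0.
by move: Ex; rewrite Eab => /(_ i)/andP[]; exact: le_trans.
Qed.

Lemma ball_volume_ge0 m : 0 <= ball_volume R m.
Proof.
by apply: fine_ge0; apply: cover_outer_ge0; exact: box_volume_ge0.
Qed.

Lemma hausdorff_gauge0 delta : @hausdorff_gauge R n d delta set0 = 0%E.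
Proof. by rewrite /hausdorff_gauge eqxx. Qed.

Lemma hausdorff_gauge_ge0 delta (E : set 'rV[R]_n) :
  (0 <= hausdorff_gauge d delta E)%E.
Proof.
rewrite /hausdorff_gauge; case: eqP => // /eqP/set0P E0.
case: ifP => // _; rewrite lee_fin mulr_ge0 ?ball_volume_ge0// exprn_ge0//.
by rewrite divr_ge0// fine_ge0// ediam_ge0.
Qed.

Let gauge0 := hausdorff_gauge0.
Let gauge_ge0 := hausdorff_gauge_ge0.

Lemma hausdorff0 : @hausdorff R n d set0 = 0%E.
Proof.
rewrite /hausdorff (_ : [set _ | _ in _] = [set 0%E]) ?ereal_sup1//.
apply/seteqP; split => [_ [e _ <-]|_ ->] /=; first by rewrite cover_outer0.
by exists 1 => //=; rewrite cover_outer0.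
Qed.

Lemma hausdorff_ge0 (A : set 'rV[R]_n) : (0 <= hausdorff d A)%E.
Proof.
apply: (@le_trans _ _ (cover_outer (hausdorff_gauge d 1) A)).
  exact: cover_outer_ge0.
by apply: ereal_sup_ubound; exists 1 => /=.
Qed.

Lemma le_hausdorff : {homo @hausdorff R n d : A B / A `<=` B >-> (A <= B)%E}.
Proof.
move=> A B AB; apply: ge_ereal_sup => _ [e e0 <-].
apply: (@le_trans _ _ (cover_outer (hausdorff_gauge d e) B)).
  exact: le_cover_outer.
by apply: ereal_sup_ubound; exists e.
Qed.

Lemma hausdorff_sigma_subadditive : sigma_subadditive (@hausdorff R n d).
Proof.
move=> F; apply: ge_ereal_sup => _ [e e0 <-].
apply: (@le_trans _ _
    (\sum_(0 <= i <oo) cover_outer (hausdorff_gauge d e) (F i))%E).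
  exact: cover_outer_sigma_subadditive.
apply: lee_nneseries => [i _ _|i _]; first exact: cover_outer_ge0.
by apply: ereal_sup_ubound; exists e.
Qed.

HB.instance Definition _ := isOuterMeasure.Build R 'rV[R]_n (@hausdorff R n d)
  hausdorff0 hausdorff_ge0 le_hausdorff hausdorff_sigma_subadditive.

End hausdorff_theory.

(* The mass of the multiplicity one d-varifold M as an outer measure. As a
   measure it lives on the Caratheodory sigma-algebra of this outer measure. *)
Definition mass (R : realType) n (d : nat) (M A : set 'rV[R]_n) : \bar R :=
  hausdorff d (A `&` M).

Section mass_theory.
Context (R : realType) (n d : nat) (M : set 'rV[R]_n).

Lemma mass0 : mass d M set0 = 0%E.
Proof. by rewrite /mass set0I hausdorff0. Qed.

Lemma mass_ge0 A : (0 <= mass d M A)%E.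
Proof. exact: hausdorff_ge0. Qed.

Lemma le_mass : {homo mass d M : A B / A `<=` B >-> (A <= B)%E}.
Proof. by move=> A B AB; apply: le_hausdorff; exact: setSI. Qed.

Lemma mass_sigma_subadditive : sigma_subadditive (mass d M).
Proof.
by move=> F; rewrite /mass setI_bigcupl; exact: hausdorff_sigma_subadditive.
Qed.

HB.instance Definition _ := isOuterMeasure.Build R 'rV[R]_n (mass d M)
  mass0 mass_ge0 le_mass mass_sigma_subadditive.

Let mu : {outer_measure set 'rV[R]_n -> \bar R} := mass d M.

HB.instance Definition _ := isMeasure.Build _ _ _
  (mass d M : set (caratheodory_type (mass d M)) -> \bar R)
  (@caratheodory_measure0 _ _ mu) (@caratheodory_measure_ge0 _ _ mu)
  (@caratheodory_measure_sigma_additive _ _ mu).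

End mass_theory.

Definition mass_integral (R : realType) n (d : nat) (M : set 'rV[R]_n)
    (f : 'rV[R]_n -> R) : R :=
  \int[mass d M : set (caratheodory_type (mass d M)) -> \bar R]_y f y.

Definition mass_vintegral (R : realType) n (d : nat) (M : set 'rV[R]_n)
    (f : 'rV[R]_n -> 'rV[R]_n) : 'rV[R]_n :=
  \row_(i < n) mass_integral d M (fun y => f y 0 i).

Definition C1_on (R : realType) m n (V : set 'rV[R]_m)
    (f : 'rV[R]_m -> 'rV[R]_n) : Prop :=
  forall x, V x ->
    differentiable f x /\ forall v, {for x, continuous ('D_v f)}.

Definition C2_on (R : realType) m n (V : set 'rV[R]_m)
    (f : 'rV[R]_m -> 'rV[R]_n) : Prop :=
  C1_on V f /\ forall v, C1_on V ('D_v f).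

(* Around each of its points M is the image of a C^2 immersion phi of an open
   set of R^d which is a homeomorphism (with inverse psi) onto its image. *)
Definition C2_submanifold (R : realType) n (d : nat) (M : set 'rV[R]_n) : Prop :=
  forall p, M p ->
  exists (U : set 'rV[R]_n) (V : set 'rV[R]_d)
         (phi : 'rV[R]_d -> 'rV[R]_n) (psi : 'rV[R]_n -> 'rV[R]_d),
    [/\ open U /\ U p, open V,
        C2_on V phi /\ (forall x v, V x -> 'D_v phi x = 0 -> v = 0),
        phi @` V = M `&` U &
        {within M `&` U, continuous psi} /\ (forall x, V x -> psi (phi x) = x)].

Definition tangent_space (R : realType) n (M : set 'rV[R]_n) (p : 'rV[R]_n) :
    set 'rV[R]_n :=
  [set u | exists gamma : R -> 'rV[R]_n,
    [/\ \forall t \near (0 : R), M (gamma t), gamma 0 = p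
      & is_derive (0 : R) 1 gamma u]].

Definition proj (R : realType) n (V : set 'rV[R]_n) (y : 'rV[R]_n) : 'rV[R]_n :=
  xget 0 [set v | V v /\ forall w, V w -> dotp (y - v) w = 0].

Definition tproj (R : realType) n (M : set 'rV[R]_n) (p : 'rV[R]_n) :
    'rV[R]_n -> 'rV[R]_n :=
  proj (tangent_space M p).

Definition perp (R : realType) n (P : 'rV[R]_n -> 'rV[R]_n) (y : 'rV[R]_n) :
  'rV[R]_n := y - P y.

(* II_p(u, v) is the normal component at p of the derivative, in the direction
   u, of a field X tangent to M with X(p) = v; here gamma is a curve of M with
   velocity u at p, and X is given along gamma. *)
Definition second_fundamental_form (R : realType) n (M : set 'rV[R]_n)
    (p u v : 'rV[R]_n) : 'rV[R]_n :=
  xget 0 [set w | exists (gamma X : R -> 'rV[R]_n) (dX : 'rV[R]_n),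
    [/\ \forall t \near (0 : R), M (gamma t) /\ tangent_space M (gamma t) (X t),
        gamma 0 = p /\ X 0 = v,
        is_derive (0 : R) 1 gamma u,
        is_derive (0 : R) 1 X dX &
        w = perp (tproj M p) dX]].

(* Any d orthonormal vectors of the d-dimensional tangent space form a basis. *)
Definition mean_curvature (R : realType) n (d : nat) (M : set 'rV[R]_n)
    (p : 'rV[R]_n) : 'rV[R]_n :=
  xget 0 [set h | exists e : 'I_d -> 'rV[R]_n,
    [/\ forall i, tangent_space M p (e i),
        forall i j, dotp (e i) (e j) = (i == j)%:R &
        h = \sum_(i < d) second_fundamental_form M p (e i) (e i)]].

(* Functions on [0, +oo[ are represented by functions on R whose values at
   negative arguments are irrelevant; derivatives at 0 are one-sided. *)
Definition smooth_halfline (R : realType) (f : R -> R) : Prop :=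
  exists g : nat -> R -> R,
    (forall t, 0 <= t -> g 0%N t = f t) /\
    (forall k t, 0 <= t ->
      (s - t)^-1 * (g k s - g k t) @[s --> within [set s | 0 <= s] t^']
        --> g k.+1 t).

Definition profile (R : realType) (f : R -> R) : Prop :=
  [/\ smooth_halfline f, forall t, 0 <= t -> 0 <= f t
    & forall t, 1 < t -> f t = 0].

(* The truncation in d.-1 is harmless: for d = 0 the constant is 0 anyway. *)
Definition profile_cst (R : realType) (d : nat) (f : R -> R) : R :=
  d%:R * ball_volume R d *
  \int[@lebesgue_measure R]_(t in `[0, 1]) (f t * t ^+ d.-1).

(* On ]0, +oo[ derive1 rho is the derivative of rho. Its value at 0 occurs only at
   y = 0, where y / |y| = 0 because 0^-1 = 0: it is irrelevant for linear Pi_y. *)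
Definition approx_mean_curvature (R : realType) n (d : nat) (rho xi : R -> R)
    (Pi : 'rV[R]_n -> 'rV[R]_n -> 'rV[R]_n) (M : set 'rV[R]_n) (eps : R) :
    'rV[R]_n :=
  - (profile_cst d xi / profile_cst d rho) *:
  ((eps ^- d * mass_integral d M (fun y => xi (enorm y / eps)))^-1 *:
   (eps ^- d.+1 *: mass_vintegral d M (fun y =>
      derive1 rho (enorm y / eps) *: Pi y ((enorm y)^-1 *: y)))).

(* Main.v *)
Require Import Defs.
From HB Require Import structures.
From mathcomp Require Import all_boot all_order all_algebra.
From mathcomp Require Import all_classical all_reals all_analysis.
From mathcomp Require Import perm measurable_realfun.
From mathcomp Require Import ring lra.
Import Order.TTheory GRing.Theory Num.Theory.
Import numFieldNormedType.Exports.
Local Open Scope classical_set_scope.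
Local Open Scope ring_scope.

Set Implicit Arguments.
Unset Strict Implicit.
Unset Printing Implicit Defensive.

(** Both limits follow from a second order expansion at the origin, in which the
    linear terms cancel by parity and the quadratic ones are averaged over balls.

    Let [E] be an orthonormal basis of the tangent space [T] at the origin. Near the
    origin [M] is the graph of a function over [T] ([normal_graph]): the point [G x]
    above [x] projects to [x *m E], and its height above [T] is [2^-1 *: B x] up to
    [o(|x|^2)] ([graph_height]), where [B] is the normal part of the second derivative
    of a chart, that is, the quadratic form of the second fundamental form
    ([graph_second_form]). The component of [G x] normal to the tangent space at [G x]
    itself is the opposite, [- 2^-1 *: B x] ([graph_position]), because a tangent line
    of a parabola has twice the slope of the chord. It follows that, for every family
    of operators, [Pi (G x) (G x)] is
      [alpha *: (x *m E) + beta *: B x] up to [o(|x|^2)],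
    where [beta] is 1 for the first three families and 0 for the last four
    ([approx_mean_curvature_limits]).

    The projection of the mass of [M] to [T] agrees on the disc of radius [s] with the
    Hausdorff measure of [T] up to a factor [1 + O(s^2)], since the projection is
    1-Lipschitz and its inverse has Lipschitz constant [1 + O(s^2)]
    ([graph_mass_haus]). After rescaling, the numerator of the approximate mean
    curvature therefore converges to the integral over the unit disc of
    [rho'(|x|) / |x| *: (beta *: B x)] ([rescaled_Rintegral_cvg],
    [sheet_integral_cvg]): the linear term would diverge, but it is odd. By symmetry
    ([kernel_second_moment]) this integral is the trace of [beta *: B], which is
    [beta] times the mean curvature, multiplied by a radial integral. An integration
    by parts ([integration_by_parts_profile]) identifies the latter with the constant
    of [rho], up to factors that also occur in the limit of the denominator
    ([sheet_mass_cvg]).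

    One of these factors is the Hausdorff measure of the unit disc of [T]. Since it
    cancels, it is enough to know that it is finite and positive
    ([hausdorff_ball_lty], [hausdorff_ball_gt0]), and its comparison with the volume
    of the ball, which rests on the isodiametric inequality, is avoided. *)

(* the projection onto a subspace, not the one from a product space *)
Local Notation proj := Defs.proj.

(** * Euclidean geometry of row vectors *)

Section euclidean.
Context (R : realType).

Lemma dotpE n (u v : 'rV[R]_n) : dotp u v = (u *m v^T) 0 0.
Proof. by rewrite mxE; apply: eq_bigr => i _; rewrite mxE. Qed.

Lemma dotpC n (u v : 'rV[R]_n) : dotp u v = dotp v u.
Proof. by apply: eq_bigr => i _; rewrite mulrC. Qed.

Lemma dotpDl n (u v w : 'rV[R]_n) : dotp (u + v) w = dotp u w + dotp v w.
Proof. by rewrite !dotpE mulmxDl mxE. Qed.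

Lemma dotpZl n k (u w : 'rV[R]_n) : dotp (k *: u) w = k * dotp u w.
Proof. by rewrite !dotpE -scalemxAl mxE. Qed.

Lemma dotpNl n (u w : 'rV[R]_n) : dotp (- u) w = - dotp u w.
Proof. by rewrite -scaleN1r dotpZl mulN1r. Qed.

Lemma dotpBl n (u v w : 'rV[R]_n) : dotp (u - v) w = dotp u w - dotp v w.
Proof. by rewrite dotpDl dotpNl. Qed.

Lemma dotpDr n (u v w : 'rV[R]_n) : dotp w (u + v) = dotp w u + dotp w v.
Proof. by rewrite !(dotpC w) dotpDl. Qed.

Lemma dotpZr n k (u w : 'rV[R]_n) : dotp w (k *: u) = k * dotp w u.
Proof. by rewrite !(dotpC w) dotpZl. Qed.

Lemma dotpBr n (u v w : 'rV[R]_n) : dotp w (u - v) = dotp w u - dotp w v.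
Proof. by rewrite !(dotpC w) dotpBl. Qed.

Lemma dotp0l n (w : 'rV[R]_n) : dotp 0 w = 0.
Proof. by rewrite -(scale0r w) dotpZl mul0r. Qed.

Lemma dotp0r n (w : 'rV[R]_n) : dotp w 0 = 0.
Proof. by rewrite dotpC dotp0l. Qed.

Lemma dotp_mulmx m n (u : 'rV[R]_m) (A : 'M[R]_(m, n)) (v : 'rV[R]_n) :
  dotp (u *m A) v = dotp u (v *m A^T).
Proof. by rewrite !dotpE trmx_mul trmxK mulmxA. Qed.

Lemma dotp_eq0 n (u : 'rV[R]_n) : dotp u u = 0 -> u = 0.
Proof.
move=> /eqP; rewrite psumr_eq0; last by move=> i _; rewrite -expr2 sqr_ge0.
move=> /allP u0; apply/rowP => i; rewrite mxE.
by have /implyP/(_ isT) := u0 i (mem_index_enum i); rewrite mulf_eq0 orbb => /eqP.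
Qed.

Lemma enorm_ge0 n (u : 'rV[R]_n) : 0 <= enorm u.
Proof. exact: sqrtr_ge0. Qed.

Lemma enorm_sqr n (u : 'rV[R]_n) : enorm u ^+ 2 = dotp u u.
Proof. by rewrite sqr_sqrtr// dotpp_ge0. Qed.

Lemma enorm0 n : enorm (0 : 'rV[R]_n) = 0.
Proof. by rewrite /enorm dotp0l sqrtr0. Qed.

Lemma enorm0_eq0 n (u : 'rV[R]_n) : enorm u = 0 -> u = 0.
Proof. by move=> u0; apply: dotp_eq0; rewrite -enorm_sqr u0 expr0n. Qed.

Lemma enorm_gt0 n (u : 'rV[R]_n) : (0 < enorm u) = (u != 0).
Proof.
rewrite lt_def enorm_ge0 andbT; congr negb.
by apply/eqP/eqP => [/enorm0_eq0//|->]; rewrite enorm0.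
Qed.

Lemma enormZ n k (u : 'rV[R]_n) : enorm (k *: u) = `|k| * enorm u.
Proof.
by rewrite /enorm dotpZl dotpZr mulrA -expr2 sqrtrM ?sqr_ge0// sqrtr_sqr.
Qed.

Lemma enormN n (u : 'rV[R]_n) : enorm (- u) = enorm u.
Proof. by rewrite -scaleN1r enormZ normrN1 mul1r. Qed.

Lemma enormBC n (u v : 'rV[R]_n) : enorm (u - v) = enorm (v - u).
Proof. by rewrite -enormN opprB. Qed.

(** Cauchy-Schwarz, from the nonnegativity of
    [dotp v v *: u - dotp u v *: v]. *)
Lemma dotp_le n (u v : 'rV[R]_n) : `|dotp u v| <= enorm u * enorm v.
Proof.
rewrite -(ler_pXn2r (n := 2))// ?nnegrE ?mulr_ge0 ?enorm_ge0//.
rewrite exprMn !enorm_sqr real_normK ?num_real//.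
have [/dotp_eq0 ->|vv] := eqVneq (dotp v v) 0.
  by rewrite dotp0r dotp0l expr0n mulr0.
have v0 : 0 < dotp v v by rewrite lt_def vv dotpp_ge0.
have := dotpp_ge0 (dotp v v *: u - dotp u v *: v).
rewrite dotpBl !dotpBr !dotpZl !dotpZr (dotpC v u) => h.
rewrite -(ler_pM2l v0) -subr_ge0; apply: le_trans h _.
by rewrite le_eqVlt; apply/orP; left; apply/eqP; ring.
Qed.

Lemma dotp_le_enorm n (u v : 'rV[R]_n) : dotp u v <= enorm u * enorm v.
Proof. exact: le_trans (ler_norm _) (dotp_le _ _). Qed.

Lemma enormD n (u v : 'rV[R]_n) : enorm (u + v) <= enorm u + enorm v.
Proof.
rewrite -(ler_pXn2r (n := 2))// ?nnegrE ?addr_ge0 ?enorm_ge0//.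
rewrite sqrrD !enorm_sqr dotpDl !dotpDr (dotpC v u).
have := dotp_le_enorm u v; lra.
Qed.

Lemma enormB n (u v : 'rV[R]_n) : enorm (u - v) <= enorm u + enorm v.
Proof. by rewrite -[in leRHS](enormN v) enormD. Qed.

Lemma enorm_distD n (w u v : 'rV[R]_n) :
  enorm (u - v) <= enorm (u - w) + enorm (w - v).
Proof. by rewrite (_ : u - v = (u - w) + (w - v)) ?enormD// addrA subrK. Qed.

Lemma enorm_distr n (u v : 'rV[R]_n) : `|enorm u - enorm v| <= enorm (u - v).
Proof.
have h1 := enormD (u - v) v; have h2 := enormD (v - u) u.
rewrite !subrK in h1 h2; rewrite (enormBC v) in h2.
by rewrite ler_norml; apply/andP; split; lra.
Qed.

Lemma coord_enorm n (u : 'rV[R]_n) i : `|u 0 i| <= enorm u.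
Proof.
rewrite -(ler_pXn2r (n := 2))// ?nnegrE ?normr_ge0 ?enorm_ge0//.
rewrite enorm_sqr real_normK ?num_real// /dotp (bigD1 i)//= -expr2 lerDl.
by apply: sumr_ge0 => j _; rewrite -expr2 sqr_ge0.
Qed.

Lemma norm_le_enorm n (u : 'rV[R]_n) : `|u| <= enorm u.
Proof.
rewrite [leLHS]/Num.norm/= mx_normrE; apply/bigmax_leP; split.
  exact: enorm_ge0.
by case=> i j _; rewrite /= (ord1 i) coord_enorm.
Qed.

Lemma coord_norm m n (A : 'M[R]_(m, n)) i j : `|A i j| <= `|A|.
Proof.
by rewrite [leRHS]/Num.norm/= mx_normrE; apply/bigmax_geP; right; exists (i, j).
Qed.

Lemma enorm_le_norm n (u : 'rV[R]_n) : enorm u <= n.+1%:R * `|u|.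
Proof.
rewrite -(ler_pXn2r (n := 2))// ?nnegrE ?mulr_ge0 ?enorm_ge0//.
rewrite enorm_sqr /dotp.
apply: (@le_trans _ _ (\sum_(i < n) `|u| ^+ 2)).
  apply: ler_sum => i _; rewrite -expr2 -[in leLHS]real_normK ?num_real//.
  by rewrite ler_pXn2r// ?nnegrE// coord_norm.
rewrite sumr_const card_ord exprMn -[leLHS]mulr_natl ler_wpM2r ?exprn_ge0//.
by rewrite -natrX ler_nat (leq_trans (leqnSn n))// -{1}(expn1 n.+1) leq_pexp2l.
Qed.

Lemma enorm_isometry m n (E : 'M[R]_(m, n)) (w : 'rV[R]_m) : E *m E^T = 1%:M ->
  enorm (w *m E) = enorm w.
Proof. by move=> EE; rewrite /enorm dotp_mulmx -mulmxA EE mulmx1. Qed.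

(** The entries of a matrix bound its action on Euclidean lengths. *)
Lemma enorm_mulmx m n (u : 'rV[R]_m) (A : 'M[R]_(m, n)) :
  enorm (u *m A) <= (n.+1 * m)%:R * `|A| * enorm u.
Proof.
apply: le_trans (enorm_le_norm _) _; rewrite natrM -!mulrA ler_wpM2l//.
rewrite [leLHS]/Num.norm/= mx_normrE; apply/bigmax_leP; split.
  by rewrite !mulr_ge0 ?enorm_ge0.
case=> i j _; rewrite /= mxE (le_trans (ler_norm_sum _ _ _))//.
apply: (@le_trans _ _ (\sum_(k < m) `|A| * enorm u)).
  apply: ler_sum => k _; rewrite normrM mulrC (ord1 i).
  by apply: ler_pM => //; [exact: coord_norm|exact: coord_enorm].
by rewrite sumr_const card_ord mulr_natl.
Qed.

End euclidean.

(** * Hausdorff measure *)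

Section hausdorff_measure.
Context (R : realType).
Local Open Scope ereal_scope.

Lemma cover_outer_le (X : Type) (zeta : set X -> \bar R) (A : set X) E :
  A `<=` \bigcup_k E k -> cover_outer zeta A <= \sum_(0 <= k <oo) zeta (E k).
Proof. by move=> AE; apply: ereal_inf_lbound; exists E. Qed.

Section gauge.
Context (n d : nat).
Implicit Types (E F A B : set 'rV[R]_n) (delta : R).

Lemma enorm_le_ediam E x y : E x -> E y -> (enorm (x - y))%:E <= ediam E.
Proof. by move=> Ex Ey; apply: ereal_sup_ubound; exists (x, y). Qed.

Lemma ediam_le E (r : R) :
  (forall x y, E x -> E y -> (enorm (x - y) <= r)%R) -> ediam E <= r%:E.
Proof.
by move=> h; apply: ge_ereal_sup => _ [[x y] [/= Ex Ey] <-]; rewrite lee_fin h.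
Qed.

Lemma hausdorff_gauge_fin E delta : E !=set0 -> ediam E <= delta%:E ->
  exists r : R, [/\ ediam E = r%:E, (0 <= r)%R, (r <= delta)%R &
    hausdorff_gauge d delta E = (ball_volume R d * (r / 2) ^+ d)%:E].
Proof.
move=> E0 Ed; have Eg := ediam_ge0 E0.
have Ef : ediam E \is a fin_num.
  by rewrite ge0_fin_numE// (le_lt_trans Ed)// ltry.
exists (fine (ediam E)); split; rewrite ?fineK ?fine_ge0//.
  by rewrite -lee_fin fineK.
by rewrite /hausdorff_gauge; case: eqP => [E00|_]; rewrite ?Ed//; case: E0 => x; rewrite E00.
Qed.

Lemma hausdorff_gauge_oo E delta : E !=set0 -> delta%:E < ediam E ->
  hausdorff_gauge d delta E = +oo.
Proof.
move=> E0 Ed; rewrite /hausdorff_gauge; case: eqP => [E00|_].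
  by case: E0 => x; rewrite E00.
by rewrite leNgt Ed.
Qed.

Lemma hausdorff_gauge_le E delta (r : R) : (0 <= r)%R -> (r <= delta)%R ->
  (forall x y, E x -> E y -> (enorm (x - y) <= r)%R) ->
  hausdorff_gauge d delta E <= (ball_volume R d * (r / 2) ^+ d)%:E.
Proof.
move=> r0 rd h; have [->|/set0P E0] := eqVneq E set0.
  by rewrite hausdorff_gauge0 lee_fin mulr_ge0 ?ball_volume_ge0// exprn_ge0// divr_ge0.
have Er := ediam_le h.
have [|s [Es s0 sd ->]] := @hausdorff_gauge_fin E delta E0.
  by rewrite (le_trans Er).
rewrite lee_fin ler_wpM2l ?ball_volume_ge0// lerXn2r ?nnegrE ?divr_ge0//.
by rewrite ler_pM2r// -lee_fin -Es.
Qed.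

Lemma le_hausdorff_gauge delta : {homo @hausdorff_gauge R n d delta : E F / E `<=` F >-> E <= F}.
Proof.
move=> E F EF; have [->|/set0P E0] := eqVneq E set0.
  by rewrite hausdorff_gauge0 hausdorff_gauge_ge0.
have F0 : F !=set0 by case: E0 => x /EF; exists x.
have [Fd|Fd] := leP (ediam F) delta%:E; last first.
  by rewrite (hausdorff_gauge_oo F0 Fd) leey.
have [r [Fr r0 rd ->]] := hausdorff_gauge_fin F0 Fd.
apply: hausdorff_gauge_le => // x y Ex Ey.
by rewrite -lee_fin -Fr enorm_le_ediam//; exact: EF.
Qed.

(** A set whose gauge is finite is too small to meet both of two sets that are
    more than [delta] apart. *)
Lemma hausdorff_gauge_separated delta A B E :
  (forall a b, A a -> B b -> (delta < enorm (a - b))%R) ->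
  hausdorff_gauge d delta (E `&` A) + hausdorff_gauge d delta (E `&` B)
    <= hausdorff_gauge d delta E.
Proof.
move=> AB; have [->|/set0P EA] := eqVneq (E `&` A) set0.
  by rewrite hausdorff_gauge0 add0e; apply: le_hausdorff_gauge; exact: subIsetl.
have [->|/set0P EB] := eqVneq (E `&` B) set0.
  by rewrite hausdorff_gauge0 adde0; apply: le_hausdorff_gauge; exact: subIsetl.
case: EA EB => a [Ea Aa] [b [Eb Bb]].
have E0 : E !=set0 by exists a.
rewrite [leRHS](hausdorff_gauge_oo E0) ?leey//.
by apply: lt_le_trans (enorm_le_ediam Ea Eb); rewrite lte_fin; exact: AB.
Qed.

Lemma le_cover_gauge delta delta' A : (delta <= delta')%R ->
  cover_outer (hausdorff_gauge d delta') A <= cover_outer (hausdorff_gauge d delta) A.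
Proof.
move=> dd; apply: le_ereal_inf_tmp => _ [E AE <-].
apply: le_trans (cover_outer_le _ AE) _; apply: lee_nneseries => [k _ _|k _].
  exact: hausdorff_gauge_ge0.
have [->|/set0P E0] := eqVneq (E k) set0; first by rewrite !hausdorff_gauge0.
have [Ed|Ed] := leP (ediam (E k)) delta%:E; last first.
  by rewrite [leRHS]hausdorff_gauge_oo ?leey.
have [r [Fr r0 rd ->]] := hausdorff_gauge_fin E0 Ed.
apply: hausdorff_gauge_le => //; first exact: le_trans dd.
by move=> x y Ex Ey; rewrite -lee_fin -Fr enorm_le_ediam.
Qed.

Lemma cover_gauge_le_hausdorff delta A : (0 < delta)%R ->
  cover_outer (hausdorff_gauge d delta) A <= hausdorff d A.
Proof. by move=> d0; apply: ereal_sup_ubound; exists delta. Qed.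

Lemma hausdorff_le A x :
  (forall delta, (0 < delta)%R -> cover_outer (hausdorff_gauge d delta) A <= x) ->
  hausdorff d A <= x.
Proof. by move=> h; apply: ge_ereal_sup => _ [e e0 <-]; exact: h. Qed.

Lemma cover_gauge_separated delta A B :
  (forall a b, A a -> B b -> (delta < enorm (a - b))%R) ->
  cover_outer (hausdorff_gauge d delta) A + cover_outer (hausdorff_gauge d delta) B
  <= cover_outer (hausdorff_gauge d delta) (A `|` B).
Proof.
move=> AB; apply: le_ereal_inf_tmp => _ [E ABE <-].
have cov C : C `<=` A `|` B -> C `<=` \bigcup_k (E k `&` C).
  by move=> CAB x Cx; have [k _ Ekx] := ABE _ (CAB _ Cx); exists k.
apply: le_trans (leeD (cover_outer_le _ (cov A _)) (cover_outer_le _ (cov B _))) _.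
- exact: subsetUl.
- exact: subsetUr.
rewrite -nneseriesD; try by move=> *; exact: hausdorff_gauge_ge0.
apply: lee_nneseries => [k _ _|k _]; last exact: hausdorff_gauge_separated.
by rewrite adde_ge0// hausdorff_gauge_ge0.
Qed.

(** Covers by sets smaller than the distance of [A] and [B] split into covers of
    [A] and of [B]. *)
Lemma hausdorff_separated A B (e : R) : (0 < e)%R ->
  (forall a b, A a -> B b -> (e <= enorm (a - b))%R) ->
  hausdorff d A + hausdorff d B <= hausdorff d (A `|` B).
Proof.
move=> e0 AB; have [->|Hoo] := eqVneq (hausdorff d (A `|` B)) +oo; first by rewrite leey.
have fin C : C `<=` A `|` B -> hausdorff d C \is a fin_num.
  move=> CAB; rewrite ge0_fin_numE ?hausdorff_ge0//.
  by rewrite (le_lt_trans (le_hausdorff d CAB))// ltey.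
have finA : hausdorff d A \is a fin_num by apply: fin; exact: subsetUl.
have finB : hausdorff d B \is a fin_num by apply: fin; exact: subsetUr.
have h (d1 d2 : R) : (0 < d1)%R -> (0 < d2)%R ->
    cover_outer (hausdorff_gauge d d1) A + cover_outer (hausdorff_gauge d d2) B
    <= hausdorff d (A `|` B).
  move=> d10 d20; pose d3 := (Num.min (Num.min d1 d2) (e / 2))%R.
  have d30 : (0 < d3)%R by rewrite !lt_min d10 d20 divr_gt0.
  apply: le_trans (cover_gauge_le_hausdorff _ d30).
  apply: le_trans (cover_gauge_separated _); last first.
    move=> a b Aa Bb; apply: lt_le_trans (AB _ _ Aa Bb).
    by rewrite gt_min; apply/orP; right; rewrite ltr_pdivrMr// ltr_pMr// ltr1n.
  by apply: leeD; apply: le_cover_gauge; rewrite !ge_min lexx ?orbT.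
rewrite -leeBrDr//; apply: hausdorff_le => d1 d10.
rewrite leeBrDr// addeC.
have finC : cover_outer (hausdorff_gauge d d1) A \is a fin_num.
  rewrite ge0_fin_numE; last by apply: cover_outer_ge0; exact: hausdorff_gauge_ge0.
  by rewrite (le_lt_trans (cover_gauge_le_hausdorff _ d10))// -ge0_fin_numE// hausdorff_ge0.
rewrite -leeBrDr//; apply: hausdorff_le => d2 d20.
by rewrite leeBrDr// addeC h.
Qed.

End gauge.

(** The images of the pieces of a cover of [A] cover its image, and their
    diameters are multiplied by at most [L]. *)
Lemma hausdorff_lipschitz m n d (f : 'rV[R]_m -> 'rV[R]_n) (A : set 'rV[R]_m)
    (L : R) : (0 < L)%R ->
  (forall x y, A x -> A y -> (enorm (f x - f y) <= L * enorm (x - y))%R) ->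
  hausdorff d (f @` A) <= (L ^+ d)%:E * hausdorff d A.
Proof.
move=> L0 fL; have Ld0 : (0 < L ^+ d)%R by rewrite exprn_gt0.
apply: hausdorff_le => delta delta0.
have dL0 : (0 < delta / L)%R by rewrite divr_gt0.
apply: (@le_trans _ _ ((L ^+ d)%:E * cover_outer (hausdorff_gauge d (delta / L)) A)); last first.
  by rewrite lee_wpmul2l ?lee_fin ?(ltW Ld0)//; exact: cover_gauge_le_hausdorff.
rewrite -lee_pdivrMl//; apply: le_ereal_inf_tmp => _ [E AE <-].
rewrite lee_pdivrMl// -nneseriesZl; last by move=> k _; exact: hausdorff_gauge_ge0.
have fAE : f @` A `<=` \bigcup_k (f @` (E k `&` A)).
  by move=> _ [x Ax <-]; have [k _ Ek] := AE _ Ax; exists k => //; exists x.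
apply: le_trans (cover_outer_le _ fAE) _; apply: lee_nneseries => [k _ _|k _].
  exact: hausdorff_gauge_ge0.
have [->|/set0P E0] := eqVneq (E k) set0.
  by rewrite set0I image_set0 !hausdorff_gauge0 mule0.
have [Ed|Ed] := leP (ediam (E k)) (delta / L)%:E; last first.
  by rewrite [X in _ <= _ * X]hausdorff_gauge_oo// gt0_muley ?lte_fin ?leey.
have [r [Fr r0 rd ->]] := @hausdorff_gauge_fin m d (E k) _ E0 Ed.
rewrite -EFinM mulrCA -exprMn mulrA; apply: hausdorff_gauge_le.
- by rewrite mulr_ge0// ltW.
- by rewrite mulrC -ler_pdivlMr.
move=> _ _ [x [Ex Ax] <-] [y [Ey Ay] <-]; apply: le_trans (fL _ _ Ax Ay) _.
by rewrite ler_pM2l// -lee_fin -Fr enorm_le_ediam.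
Qed.

Lemma hausdorff_isometry m n d (f : 'rV[R]_m -> 'rV[R]_n) (A : set 'rV[R]_m) :
  (forall x y, A x -> A y -> enorm (f x - f y) = enorm (x - y)) ->
  hausdorff d (f @` A) = hausdorff d A.
Proof.
move=> fA; apply/le_anti/andP; split.
  have := @hausdorff_lipschitz _ _ d f A 1%R ltr01.
  by rewrite expr1n mul1e; apply => x y Ax Ay; rewrite mul1r fA.
have [->|/set0P[x0 Ax0]] := eqVneq A set0; first by rewrite hausdorff0 hausdorff_ge0.
(* a left inverse of f on A, which is again 1-Lipschitz *)
pose g y := xget x0 [set x | A x /\ f x = y].
have gP x : A x -> A (g (f x)) /\ f (g (f x)) = f x.
  by move=> Ax; rewrite /g; case: xgetP => [z -> //|] /(_ x)[].
have gf x : A x -> g (f x) = x.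
  move=> Ax; have [Ag fg] := gP _ Ax; apply/eqP; rewrite -subr_eq0; apply/eqP.
  by apply: enorm0_eq0; rewrite -fA// fg subrr enorm0.
have {1}<- : g @` (f @` A) = A.
  apply/seteqP; split => [_ [_ [x Ax <-] <-]|x Ax]; first by rewrite gf.
  by exists (f x); [exists x|rewrite gf].
have := @hausdorff_lipschitz _ _ d g (f @` A) 1%R ltr01.
rewrite expr1n mul1e; apply => _ _ [x Ax <-] [y Ay <-].
by rewrite mul1r fA// !gf.
Qed.

Lemma hausdorff_scale n d (A : set 'rV[R]_n) (r : R) : (0 < r)%R ->
  hausdorff d ((fun x => r *: x) @` A) = (r ^+ d)%:E * hausdorff d A.
Proof.
move=> r0; apply/le_anti/andP; split.
  apply: hausdorff_lipschitz => // x y _ _.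
  by rewrite -scalerBr enormZ gtr0_norm.
have rd : (0 < r ^+ d)%R by rewrite exprn_gt0.
rewrite -lee_pdivlMl// -exprVn.
have {1}<- : (fun x => r^-1 *: x)%R @` ((fun x => r *: x)%R @` A) = A.
  have rK x : r^-1 *: (r *: x : 'rV[R]_n) = x by rewrite scalerA mulVf ?scale1r// gt_eqF.
  apply/seteqP; split => [_ [_ [x Ax <-] <-]|x Ax]; first by rewrite rK.
  by exists (r *: x); [exists x|rewrite rK].
apply: hausdorff_lipschitz; first by rewrite invr_gt0.
by move=> x y _ _; rewrite -scalerBr enormZ gtr0_norm// invr_gt0.
Qed.

End hausdorff_measure.

Section ball_measure.
Context (R : realType).
Local Open Scope ereal_scope.

(** The grid of mesh [1/N] covers the unit ball by at most [(2N+1)^d] cubes of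
    diameter at most [(d+1)/N], so that the pre-measures stay bounded. *)
Lemma hausdorff_ball_lty (d : nat) :
  hausdorff d [set x : 'rV[R]_d | (enorm x <= 1)%R] < +oo.
Proof.
pose C : R := (ball_volume R d * (3 * d.+1%:R / 2) ^+ d)%R.
apply: (@le_lt_trans _ _ C%:E); last exact: ltry.
apply: hausdorff_le => delta delta0.
pose N := (Num.truncn (d.+1%:R / delta)%R).+1.
have N0 : (0 < N%:R :> R)%R by rewrite ltr0n.
have Nd : (d.+1%:R / N%:R <= delta :> R)%R.
  rewrite ler_pdivrMr// mulrC -ler_pdivrMr//; apply/ltW.
  by apply: truncnS_gt.
pose T : finType := {ffun 'I_d -> 'I_(2 * N).+1}.
pose cube (g : T) : set 'rV[R]_d :=
  [set x | forall i, (g i)%:R <= (x ord0 i + 1) * N%:R <= (g i)%:R + 1]%R.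
pose g0 : T := [ffun=> ord0].
pose E k := if (k < #|T|)%N then cube (nth g0 (enum T) k) else set0.
have cubed (g : T) : hausdorff_gauge d delta (cube g) <=
    (ball_volume R d * (d.+1%:R / N%:R / 2) ^+ d)%:E.
  apply: hausdorff_gauge_le => // x y cx cy.
  apply: le_trans (enorm_le_norm _) _; rewrite ler_pM2l//.
  rewrite [leLHS]/Num.norm/= mx_normrE; apply/bigmax_leP; split => //.
  case=> i j _; rewrite /= (ord1 i) !mxE.
  have /andP[x1 x2] := cx j; have /andP[y1 y2] := cy j.
  rewrite -(ler_pM2r N0) mulVf ?gt_eqF//.
  rewrite -{1}(gtr0_norm N0) -normrM ler_norml; apply/andP; split; lra.
have BE : [set x : 'rV[R]_d | (enorm x <= 1)%R] `<=` \bigcup_k E k.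
  move=> x /= x1.
  have xi i : (0 <= (x ord0 i + 1) * N%:R)%R.
    rewrite mulr_ge0// -lerBlDr sub0r; have := le_trans (coord_enorm x i) x1.
    by rewrite ler_norml => /andP[].
  pose g : T := [ffun i => inord (Num.truncn ((x ord0 i + 1) * N%:R)%R)].
  have gi i : g i = Num.truncn ((x ord0 i + 1) * N%:R)%R :> nat.
    rewrite ffunE inordK// ltnS.
    rewrite -(ler_nat R); apply: le_trans (_ : _ <= (x ord0 i + 1) * N%:R)%R _.
      by rewrite truncn_le.
    rewrite natrM ler_pM2r//; have := le_trans (coord_enorm x i) x1.
    by rewrite ler_norml => /andP[_]; lra.
  exists (index g (enum T)) => //.
  have gT : (index g (enum T) < #|T|)%N by rewrite cardE index_mem mem_enum.
  rewrite /E gT nth_index ?mem_enum// => i; rewrite gi truncn_le//=.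
  by rewrite xi/= natr1 ltW// truncnS_gt.
apply: le_trans (cover_outer_le _ BE) _.
rewrite (nneseries_split _ #|T|); last by move=> *; exact: hausdorff_gauge_ge0.
rewrite [X in _ + X]eseries0 ?adde0; last first.
  by move=> k; rewrite add0n => Tk _; rewrite /E ltnNge Tk/= hausdorff_gauge0.
apply: (@le_trans _ _ (\sum_(0 <= k < #|T|) (ball_volume R d * (d.+1%:R / N%:R / 2) ^+ d)%:E)).
  rewrite add0n; apply: lee_sum => k _; rewrite /E; case: ifPn => _; first exact: cubed.
  by rewrite hausdorff_gauge0 lee_fin mulr_ge0 ?ball_volume_ge0// exprn_ge0// !divr_ge0.
rewrite sumEFin lee_fin sumr_const_nat subn0 -mulrnAr ler_wpM2l ?ball_volume_ge0//.
have h1 : (0 <= (2 * N).+1%:R * (d.+1%:R / N%:R / 2) :> R)%R.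
  by rewrite mulr_ge0// !divr_ge0.
have h2 : (0 <= 3 * d.+1%:R / 2 :> R)%R by rewrite divr_ge0// mulr_ge0.
rewrite card_ffun !card_ord -mulr_natl natrX -exprMn lerXn2r ?nnegrE//.
rewrite !mulrA ler_pM2r// ?invr_gt0// mulrAC ler_pM2r//.
rewrite ler_pdivrMr// -natrM ler_nat.
by rewrite -addn1 (mulSn 2 N) addnC leq_add2r.
Qed.

(** A set of diameter [r] lies in a cube of side [2 r], so that Hausdorff
    measure dominates a multiple of Lebesgue measure. *)
Lemma hausdorff_ball_gt0 (d : nat) : (0 < ball_volume R d)%R ->
  0 < hausdorff d [set x : 'rV[R]_d | (enorm x <= 1)%R].
Proof.
move=> w0; set B := [set x | _].
have LB : lebesgue_outer B = (ball_volume R d)%:E.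
  move: w0; rewrite /ball_volume -/B; have := cover_outer_ge0 (@box_volume_ge0 R d) B.
  by rewrite -/(lebesgue_outer B); case: (lebesgue_outer B) => //=; rewrite ltxx.
pose c := (ball_volume R d / 4 ^+ d)%R.
have c0 : (0 < c)%R by rewrite divr_gt0// exprn_gt0.
apply: (@lt_le_trans _ _ (c * ball_volume R d)%:E); first by rewrite lte_fin mulr_gt0.
apply: le_trans (cover_gauge_le_hausdorff d B ltr01).
apply: le_ereal_inf_tmp => _ [E BE <-].
rewrite EFinM -LB -lee_pdivlMl//.
have boxed k : exists F, E k `<=` F /\
    box_volume F <= c^-1%:E * hausdorff_gauge d 1 (E k).
  have [->|/set0P E0] := eqVneq (E k) set0.
    by exists set0; split => //; rewrite hausdorff_gauge0 /box_volume eqxx mule0.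
  have [Ed|Ed] := leP (ediam (E k)) 1%:E; last first.
    exists (E k); split => //.
    by rewrite [X in _ <= _ * X]hausdorff_gauge_oo// gt0_muley ?leey// lte_fin invr_gt0.
  have [r [Er r0 _ ->]] := @hausdorff_gauge_fin R d d (E k) _ E0 Ed.
  case: E0 => x Ex.
  pose ab : 'rV[R]_d * 'rV[R]_d := (x - const_mx r, x + const_mx r)%R.
  exists (box ab.1 ab.2); split.
    move=> y Ey i; rewrite !mxE/=; apply/andP.
    have : (`|(y - x) ord0 i| <= r)%R.
      apply: le_trans (coord_enorm _ _) _.
      by rewrite -lee_fin -Er; exact: enorm_le_ediam.
    by rewrite !mxE ler_norml => /andP[]; lra.
  rewrite /box_volume; case: ifPn => [_|_].
    rewrite -EFinM lee_fin mulr_ge0// ?invr_ge0 ?(ltW c0)//.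
    by rewrite mulr_ge0 ?(ltW w0)// exprn_ge0// divr_ge0.
  apply: (@le_trans _ _ (\prod_(i < d) (ab.2 ord0 i - ab.1 ord0 i))%:E).
    by apply: ereal_inf_lbound; exists ab.
  rewrite (eq_bigr (fun=> 2 * r)%R); last by move=> i _; rewrite !mxE; lra.
  rewrite prodr_const card_ord -EFinM lee_fin /c invfM invrK mulrACA mulVf ?gt_eqF//.
  by rewrite mul1r -exprMn le_eqVlt; apply/orP; left; apply/eqP; congr (_ ^+ _)%R; field.
have [F EF] := choice boxed.
have BF : B `<=` \bigcup_k F k.
  by move=> x /BE [k _ Ekx]; exists k => //; exact: (EF k).1.
apply: le_trans (cover_outer_le _ BF) _; rewrite -nneseriesZl; last first.
  by move=> k _; exact: hausdorff_gauge_ge0.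
apply: lee_nneseries => [k _ _|k _]; first exact: box_volume_ge0.
exact: (EF k).2.
Qed.

End ball_measure.

(** * Borel sets are Caratheodory measurable *)

Section metric_outer_measure.
Context (R : realType) (n : nat) (mu : {outer_measure set 'rV[R]_n -> \bar R}).
Hypothesis mu_separated : forall (A B : set 'rV[R]_n) (e : R), (0 < e)%R ->
  (forall a b, A a -> B b -> e <= enorm (a - b)) ->
  (mu A + mu B <= mu (A `|` B))%E.
Local Open Scope ereal_scope.

Let inner (U : set 'rV[R]_n) (k : nat) : set 'rV[R]_n :=
  [set x | forall z, ~ U z -> (k.+1%:R^-1 <= enorm (x - z))%R].

Let inner_bigcup U x : open U -> U x -> exists k, inner U k x.
Proof.
move=> oU Ux; have [e /= e0 eU] : nbhs_ball x U.
  by apply/nbhs_ballP; exact: open_nbhs_nbhs.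
have [k ke] : exists k, (k.+1%:R^-1 < e)%R.
  exists (Num.truncn e^-1); rewrite invf_plt ?posrE//; exact: truncnS_gt.
exists k => z Uz; apply/ltW/(lt_le_trans ke); rewrite leNgt; apply/negP => xz.
apply: Uz; apply: eU; rewrite -ball_normE /=; apply: le_lt_trans xz.
exact: norm_le_enorm.
Qed.

Let le_inner U j k : (j <= k)%N -> inner U j `<=` inner U k.
Proof.
move=> jk x Ex z Uz; apply: le_trans (Ex _ Uz).
by rewrite lef_pV2 ?posrE// ler_nat.
Qed.

Let inner_gap U j A B : A `<=` inner U j -> B `<=` ~` inner U j.+1 ->
  mu A + mu B <= mu (A `|` B).
Proof.
move=> AE BE.
apply: (mu_separated (e := (j.+1%:R^-1 - j.+2%:R^-1)%R)).
  by rewrite subr_gt0 ltf_pV2 ?posrE// ltr_nat.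
move=> a b /AE aE /BE /existsNP[z /not_implyP[Uz /negP]]; rewrite -ltNge => bz.
rewrite lerBlDr; apply: le_trans (aE _ Uz) _.
by apply: le_trans (enorm_distD b a z) _; rewrite lerD2l ltW.
Qed.

Let layer (U X : set 'rV[R]_n) j := X `&` (inner U j.+2 `\` inner U j.+1).

(** Layers of indices of the same parity are far apart, so that the masses of
    the layers are summable. *)
Let layer_sum U X m : \sum_(0 <= j < m.*2) mu (layer U X j) <= mu X + mu X.
Proof.
suff [Q [Q' [[QX QE] [Q'X Q'E] /le_trans]]] : exists Q Q' : set 'rV[R]_n,
    [/\ Q `<=` X /\ Q `<=` inner U m.*2, Q' `<=` X /\ Q' `<=` inner U m.*2.+1 &
    \sum_(0 <= j < m.*2) mu (layer U X j) <= mu Q + mu Q'].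
  by apply; apply: leeD; exact: le_outer_measure.
elim: m => [|m [Q [Q' [[QX QE] [Q'X Q'E] S]]]].
  exists set0, set0; split; [by split; exact: sub0set..|].
  by rewrite double0 big_nil outer_measure0 adde0.
exists (Q `|` layer U X m.*2), (Q' `|` layer U X m.*2.+1); split.
- split; first by rewrite subUset; split => // x [].
  rewrite subUset; split; last by move=> x [_ []].
  by apply: subset_trans QE _; apply: le_inner; rewrite doubleS -addn2 leq_addr.
- split; first by rewrite subUset; split => // x [].
  rewrite subUset; split; last by move=> x [_ []].
  by apply: subset_trans Q'E _; apply: le_inner; rewrite doubleS -addn2 leq_addr.
rewrite doubleS !big_nat_recr//=.
apply: (@le_trans _ _ ((mu Q + mu (layer U X m.*2)) + (mu Q' + mu (layer U X m.*2.+1)))).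
  by rewrite addeACA -[leLHS]addeA leeD2r.
apply: leeD; [apply: (inner_gap QE)|apply: (inner_gap Q'E)]; by move=> x [_ []].
Qed.

(** The sets [inner U k] exhaust [U] and are at a positive distance from its
    complement, so that the additivity on separated sets applies to them; what is
    left of [U] is a tail of the convergent series of the masses of the layers. *)
Lemma open_caratheodory U : open U -> mu.-caratheodory U.
Proof.
move=> oU; apply: le_caratheodory_measurable => X.
have [->|Xoo] := eqVneq (mu X) +oo; first by rewrite leey.
have Xfin : mu X \is a fin_num by rewrite ge0_fin_numE ?outer_measure_ge0// ltey.
have s0 j (_ : (0 <= j)%N) (_ : true) : 0 <= mu (layer U X j) by exact: outer_measure_ge0.
have Sfin : \sum_(0 <= j <oo) mu (layer U X j) < +oo.
  apply: (@le_lt_trans _ _ (mu X + mu X)); last by rewrite lte_add_pinfty// ltey.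
  apply: lime_le; first exact: is_cvg_nneseries.
  apply: nearW => m; apply: le_trans (layer_sum U X m).
  by apply: lee_sum_nneg_natr => //; rewrite -addnn leq_addr.
apply/lee_addgt0Pr => e e0.
have tail0 := nneseries_tail_cvg Sfin (fun j => s0 j isT).
have [k tk] : exists k, \sum_(k <= j <oo) mu (layer U X j) <= e%:E.
  have [k _ /(_ k (leqnn k)) ek] : \forall k \near \oo,
      \sum_(k <= j <oo) mu (layer U X j) < e%:E.
    apply: (tail0 [set x | x < e%:E]); apply: open_nbhs_nbhs.
    by split; [exact: open_ereal_lt_ereal|rewrite /= lte_fin].
  by exists k; exact: ltW.
have XUk : X `&` U `<=` (X `&` inner U k.+1) `|` \bigcup_(j in ~` `I_k) layer U X j.
  move=> x [Xx Ux]; have [Ek|Ek] := pselect (inner U k.+1 x); first by left.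
  right; have [m0 Em0] := inner_bigcup oU Ux.
  have ex : exists m, `[< inner U m x >] by exists m0; apply/asboolP.
  have [m /asboolP Em minm] := ex_minnP ex.
  have km : (k.+1 < m)%N.
    by rewrite ltnNge; apply/negP => mk; apply: Ek; exact: le_inner Em.
  case: m => [|[|m]]// in Em minm km *; exists m; first by apply/negP; rewrite -leqNgt.
  split => //; split => // Em1.
  by have := minm m.+1 (asboolT Em1); rewrite ltnn.
apply: (@le_trans _ _ (mu (X `&` inner U k.+1) + e%:E + mu (X `&` ~` U))).
  rewrite leeD2r//; apply: le_trans (le_outer_measure mu _ _ XUk) _.
  apply: le_trans (outer_measureU2 _ _ _) _; rewrite leeD2l//.
  by apply: le_trans tk; exact: outer_measure_sigma_subadditive_tail.
rewrite addeAC leeD2r//.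
apply: le_trans (_ : mu ((X `&` inner U k.+1) `|` (X `&` ~` U)) <= _).
  apply: (@inner_gap U k.+1); first by move=> x [].
  move=> x [_ nUx] Ex; have := Ex _ nUx.
  by rewrite subrr enorm0 leNgt invr_gt0 ltr0n.
by apply: le_outer_measure; rewrite subUset; split => x [].
Qed.

End metric_outer_measure.

Section mass_borel.
Context (R : realType) (n d : nat) (M : set 'rV[R]_n).

Lemma mass_separated (A B : set 'rV[R]_n) (e : R) : 0 < e ->
  (forall a b, A a -> B b -> e <= enorm (a - b)) ->
  (mass d M A + mass d M B <= mass d M (A `|` B))%E.
Proof.
move=> e0 AB; rewrite /mass setIUl; apply: (hausdorff_separated _ e0).
by move=> a b [Aa _] [Bb _]; exact: AB.
Qed.

Lemma open_mass_measurable (U : set 'rV[R]_n) : open U ->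
  measurable (U : set (caratheodory_type (mass d M))).
Proof.
exact: (@open_caratheodory R n (mass d M : {outer_measure set 'rV[R]_n -> \bar R})
  mass_separated).
Qed.

End mass_borel.

(** * Integrals of bounded functions over sets of finite measure *)

Section bounded_integrals.
Context (R : realType) (disp : measure_display) (T : measurableType disp).
Implicit Types (mu : {measure set T -> \bar R}) (D : set T) (h : T -> R).

Lemma bounded_integrable mu D h (K : R) : measurable D -> (mu D < +oo)%E ->
  measurable_fun D h -> (forall x, D x -> `|h x| <= K) ->
  mu.-integrable D (EFin \o h).
Proof.
move=> mD Dfin mh hK; apply: measurable_bounded_integrable => //.
exists K; split; first exact: num_real.
by move=> y Ky x Dx; rewrite /= (le_trans (hK _ Dx))// ltW.
Qed.

Lemma Rintegral_bound mu D h (K : R) : measurable D -> (mu D < +oo)%E ->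
  measurable_fun D h -> (forall x, D x -> `|h x| <= K) ->
  `|\int[mu]_(x in D) h x| <= K * fine (mu D).
Proof.
move=> mD Dfin mh hK; have ih := bounded_integrable mD Dfin mh hK.
apply: le_trans (le_normr_Rintegral mD ih) _.
rewrite -(Rintegral_cst mu mD); apply: le_Rintegral => //.
- by have := integrable_norm ih.
- have [/set0P[x Dx]|] := boolP (D != set0).
    apply: (bounded_integrable mD Dfin (K := K)) => // y Dy.
    by rewrite ger0_norm//; exact: le_trans (hK _ Dy).
  by rewrite negbK => /eqP ->; exact: integrable_set0.
Qed.

Lemma ge0_le_measure_integral_on (m1 m2 : {measure set T -> \bar R}) D
    (f : T -> \bar R) : measurable D ->
  (forall A, measurable A -> A `<=` D -> (m1 A <= m2 A)%E) ->
  measurable_fun D f -> (forall x, D x -> (0 <= f x)%E) ->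
  (\int[m1]_(x in D) f x <= \int[m2]_(x in D) f x)%E.
Proof.
move=> mD m12 mf f0.
have restrE (m : {measure set T -> \bar R}) :
    (\int[m]_(x in D) f x = \int[mrestr m mD]_x (f \_ D) x)%E.
  rewrite -integral_mkcond; apply: eq_measure_integral => A mA AD.
  by rewrite /= /mrestr setIidl.
rewrite !restrE; apply: ge0_le_measure_integral => //.
- by move=> A mA; apply: m12; [exact: measurableI|exact: subIsetr].
- by move=> x; rewrite patchE; case: ifPn => // /set_mem/f0.
- exact/(measurable_restrictT _ mD).
Qed.

(** Adding a constant makes a bounded integrand nonnegative, which reduces
    comparisons of integrals to nonnegative integrands. *)
Lemma Rintegral_shift mu D h (K : R) : measurable D -> (mu D < +oo)%E ->
  measurable_fun D h -> (forall x, D x -> `|h x| <= K) ->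
  \int[mu]_(x in D) h x = \int[mu]_(x in D) (h x + K) - K * fine (mu D).
Proof.
move=> mD Dfin mh hK; rewrite RintegralD//; last 2 first.
- exact: bounded_integrable hK.
- by apply: (bounded_integrable mD Dfin (K := `|K|)).
by rewrite Rintegral_cst// addrK.
Qed.

Lemma shift_ge0 D h (K : R) : (forall x, D x -> `|h x| <= K) ->
  forall x, D x -> (0 <= (h x + K)%:E)%E /\ (h x + K <= 2 * K).
Proof.
by move=> hK x /hK; rewrite ler_norml lee_fin => /andP[? ?]; split; lra.
Qed.

Lemma Rintegral_mscale mu D h (K : R) (k : {nonneg R}) :
  measurable D -> (mu D < +oo)%E ->
  measurable_fun D h -> (forall x, D x -> `|h x| <= K) ->
  \int[mscale k mu]_(x in D) h x = k%:num * \int[mu]_(x in D) h x.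
Proof.
move=> mD Dfin mh hK.
have kDfin : (mscale k mu D < +oo)%E.
  by rewrite /mscale/= lte_mul_pinfty// lee_fin.
rewrite (Rintegral_shift mD kDfin mh hK) (Rintegral_shift mD Dfin mh hK).
have mhK : measurable_fun D (fun x => h x + K) by exact: measurable_funD.
have hK0 x : D x -> (0 <= (h x + K)%:E)%E by move=> Dx; exact: (shift_ge0 hK Dx).1.
rewrite /Rintegral ge0_integral_mscale//; last exact/measurable_EFinP.
have iK : (\int[mu]_(x in D) (h x + K)%:E)%E \is a fin_num.
  apply: integrable_fin_num => //.
  apply: (bounded_integrable mD Dfin mhK (K := 2 * K)) => x Dx.
  by have [? ?] := shift_ge0 hK Dx; rewrite ger0_norm.
have muD : mu D \is a fin_num by rewrite ge0_fin_numE.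
rewrite fineM// mulrBr; congr (_ - _); rewrite /= /mscale/= fineM//.
by rewrite mulrCA.
Qed.

Lemma Rintegral_compare (m1 m2 : {measure set T -> \bar R}) D h (K t : R) :
  measurable D -> (m1 D < +oo)%E -> 0 <= t ->
  (forall A, measurable A -> A `<=` D ->
     (m1 A <= m2 A /\ m2 A <= (1 + t)%:E * m1 A)%E) ->
  measurable_fun D h -> (forall x, D x -> `|h x| <= K) ->
  `|\int[m2]_(x in D) h x - \int[m1]_(x in D) h x| <= 2 * K * t * fine (m1 D).
Proof.
move=> mD D1 t0 m12 mh hK.
have [->|/set0P[x0 Dx0]] := eqVneq D set0.
  by rewrite !Rintegral_set0 subrr normr0 measure0 mulr0.
have K0 : 0 <= K by exact: le_trans (hK _ Dx0).
have t1 : 0 <= 1 + t by rewrite addr_ge0.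
have m1D : m1 D \is a fin_num by rewrite ge0_fin_numE.
have D2 : (m2 D < +oo)%E.
  by apply: le_lt_trans (m12 D mD _).2 _ => //; rewrite lte_mul_pinfty// lee_fin.
have m2D : m2 D \is a fin_num by rewrite ge0_fin_numE.
rewrite (Rintegral_shift mD D1 mh hK) (Rintegral_shift mD D2 mh hK).
have mhK : measurable_fun D (fun x => h x + K) by exact: measurable_funD.
have mhKE : measurable_fun D (fun x => (h x + K)%:E) by exact/measurable_EFinP.
have hK0 x : D x -> (0 <= (h x + K)%:E)%E by move=> Dx; exact: (shift_ge0 hK Dx).1.
have hK2 x : D x -> `|h x + K| <= 2 * K.
  by move=> Dx; have [? ?] := shift_ge0 hK Dx; rewrite ger0_norm.
have i1 := bounded_integrable mD D1 mhK hK2.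
have i2 := bounded_integrable mD D2 mhK hK2.
set a1 := \int[m1]_(x in D) (h x + K); set a2 := \int[m2]_(x in D) (h x + K).
have lea : a1 <= a2.
  apply: fine_le; [exact: integrable_fin_num..|].
  by apply: ge0_le_measure_integral_on => // A mA AD; exact: (m12 A mA AD).1.
have lea2 : a2 <= (1 + t) * a1.
  rewrite /a1 /Rintegral -[1 + t]/(fine (1 + t)%:E) -fineM//; last first.
    exact: integrable_fin_num.
  apply: fine_le; [exact: integrable_fin_num| |].
    by rewrite fin_numM// integrable_fin_num.
  have -> : (1 + t)%:E = (NngNum t1)%:num%:E by [].
  rewrite -ge0_integral_mscale//.
  by apply: ge0_le_measure_integral_on => // A mA AD; exact: (m12 A mA AD).2.
have a1K : a1 <= 2 * K * fine (m1 D).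
  apply: le_trans (ler_norm _) _; exact: (Rintegral_bound mD D1 mhK hK2).
have lem : fine (m1 D) <= fine (m2 D).
  by apply: fine_le => //; exact: (m12 D mD _).1.
have lem2 : fine (m2 D) <= (1 + t) * fine (m1 D).
  rewrite -[1 + t]/(fine (1 + t)%:E) -fineM//; apply: fine_le => //.
    by rewrite fin_numM.
  exact: (m12 D mD _).2.
have K1 : 0 <= t * a1 <= t * (2 * K * fine (m1 D)).
  rewrite mulr_ge0//=; last by apply: Rintegral_ge0 => x Dx; rewrite -lee_fin hK0.
  by rewrite ler_wpM2l.
have K2 : 0 <= K * (fine (m2 D) - fine (m1 D)) <= K * (t * fine (m1 D)).
  by rewrite mulr_ge0 ?subr_ge0//= ler_wpM2l//; lra.
have K3 : 0 <= K * (t * fine (m1 D)) by rewrite !mulr_ge0// fine_ge0.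
rewrite ler_norml; apply/andP; split; nra.
Qed.

End bounded_integrals.

Lemma Rintegral_image (R : realType) d1 d2 (X : measurableType d1)
    (Y : measurableType d2) (phi : X -> Y) (mu : {measure set X -> \bar R})
    (nu : {measure set Y -> \bar R}) (D : set Y) (h : Y -> R) (K : R) :
  measurable_fun setT phi ->
  (forall A, measurable A -> A `<=` D -> nu A = mu (phi @^-1` A)) ->
  measurable D -> (mu (phi @^-1` D) < +oo)%E ->
  measurable_fun D h -> (forall x, D x -> `|h x| <= K) ->
  \int[nu]_(y in D) h y = \int[mu]_(x in phi @^-1` D) h (phi x).
Proof.
move=> mphi nuE mD Dfin mh hK.
have mpD : measurable (phi @^-1` D) by rewrite -[X in measurable X]setTI; exact: mphi.
transitivity (\int[nu]_(y in D) (h \_ D) y).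
  by apply: eq_Rintegral => y yD; rewrite patchE yD.
transitivity (\int[mu]_(x in phi @^-1` D) (h \_ D) (phi x)); last first.
  by apply: eq_Rintegral => x; rewrite inE => xD; rewrite patchE mem_set.
have mhD : measurable_fun setT (h \_ D) by exact/(measurable_restrictT _ mD).
pose pm : {measure set Y -> \bar R} :=
  measure_function_pushforward__canonical__measure_function_Measure mu mphi.
congr fine; rewrite (eq_measure_integral pm)//.
apply: integral_pushforward => //.
- exact/measurable_EFinP.
- apply: (@bounded_integrable _ _ _ _ _ _ K) => //.
    exact: (measurableT_comp mhD (measurable_funTS mphi)).
  by move=> x Dx; rewrite patchE mem_set//; exact: hK.
Qed.

(** * Borel measures on Euclidean space *)

Definition borel (R : realType) (d : nat) := g_sigma_algebraType (@open 'rV[R]_d).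

Section borel_sets.
Context (R : realType).

Lemma open_borel d (U : set 'rV[R]_d) : open U -> measurable (U : set (borel R d)).
Proof. by move=> oU; exact: sub_sigma_algebra. Qed.

Lemma closed_borel d (F : set 'rV[R]_d) : closed F -> measurable (F : set (borel R d)).
Proof. by rewrite -openC => /open_borel mF; rewrite -(setCK F); exact: measurableC. Qed.

Lemma continuous_borel_fun d (U : set 'rV[R]_d) (f : 'rV[R]_d -> R) : open U ->
  (forall x, U x -> {for x, continuous f}) ->
  measurable_fun (U : set (borel R d)) (f : borel R d -> R).
Proof.
move=> oU cf; apply: (measurability _ (RGenOpens.measurableE R)).
move=> _ [_ [a [b ->] <-]]; apply: open_borel.
rewrite openE => x [Ux fx]; apply: filterI; first exact: open_nbhs_nbhs.
by apply: (cf x Ux); apply: open_nbhs_nbhs; split => //; exact: interval_open.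
Qed.

(** Measurability for the generated sigma-algebra only involves open sets. *)
Lemma continuous_to_borel disp (T : measurableType disp) d (p : T -> 'rV[R]_d) :
  (forall U, open U -> measurable (p @^-1` U)) ->
  measurable_fun setT (p : T -> borel R d).
Proof.
move=> mp; apply: (@measurability _ _ T (borel R d) setT p (@open 'rV[R]_d)) => // _ [U oU <-].
by rewrite setTI; exact: mp.
Qed.

Lemma continuous_borel d n (p : 'rV[R]_n -> 'rV[R]_d) : continuous p ->
  measurable_fun setT (p : borel R n -> borel R d).
Proof.
move=> /continuousP cp; apply: continuous_to_borel => U /cp; exact: open_borel.
Qed.

Lemma near_enorm n (x : 'rV[R]_n) (e : R) : 0 < e ->
  \forall y \near x, enorm (x - y) <= e.
Proof.
move=> e0; have r0 : 0 < n.+1%:R^-1 * e by rewrite mulr_gt0// invr_gt0.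
have : \forall y \near x, `|x - y| <= n.+1%:R^-1 * e.
  exact: (@cvgr_dist_le _ _ _ (nbhs x) _ id x (@cvg_id _ _) _ r0).
by apply: filterS => y; rewrite ler_pdivlMl//; exact/le_trans/enorm_le_norm.
Qed.

Lemma elipschitz_continuous n (V : normedModType R) (f : 'rV[R]_n -> V) (L : R) :
  0 < L -> (forall x y, `|f x - f y| <= L * enorm (x - y)) -> continuous f.
Proof.
move=> L0 fL x; apply: (proj2 (@cvgrPdist_le R V 'rV[R]_n (nbhs x) _ f (f x))) => e e0.
have := near_enorm x (divr_gt0 e0 L0); apply: filterS => y.
by rewrite ler_pdivlMr// mulrC; exact: le_trans.
Qed.

Lemma continuous_enorm n : continuous (@enorm R n).
Proof.
apply: (@elipschitz_continuous n R (@enorm R n) 1) => // x y.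
by rewrite mul1r enorm_distr.
Qed.

Lemma continuous_mulmxr n d (A : 'M[R]_(n, d)) :
  continuous (fun x : 'rV[R]_n => x *m A).
Proof.
apply: (@elipschitz_continuous n _ _ ((d.+1 * n)%:R * `|A| + 1)) => [|x y].
  by rewrite ltr_wpDl.
rewrite -mulmxBl mulrDl mul1r; apply: le_trans (norm_le_enorm _) _.
by apply: le_trans (enorm_mulmx _ _) _; rewrite lerDl enorm_ge0.
Qed.

End borel_sets.

Definition edisc (R : realType) (d : nat) (r : R) : set 'rV[R]_d :=
  [set x | enorm x <= r].

Section euclidean_disc.
Context (R : realType).

Lemma edisc_measurable d (r : R) : measurable (@edisc R d r : set (borel R d)).
Proof.
apply: closed_borel; rewrite (_ : @edisc R d r = @enorm R d @^-1` [set t | t <= r])//.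
by apply: closed_comp; [move=> x _; exact: continuous_enorm|exact: closed_le].
Qed.

Lemma le_edisc d (r s : R) : r <= s -> @edisc R d r `<=` @edisc R d s.
Proof. by move=> rs x /le_trans; apply. Qed.

(* The radial functions are continuous off the origin only. *)
Lemma measurable_off0 d (D : set 'rV[R]_d) (f : 'rV[R]_d -> R) U : open U ->
  measurable (D : set (borel R d)) -> D `<=` U ->
  (forall x, U x -> x != 0 -> {for x, continuous f}) ->
  measurable_fun (D : set (borel R d)) (f : borel R d -> R).
Proof.
move=> oU mD DU cf.
have c0 : closed [set (0 : 'rV[R]_d)].
  exact/accessible_closed_set1/hausdorff_accessible/norm_hausdorff.
have oU0 : open (U `&` ~` [set 0]) by apply: openI => //; exact: closed_openC.
have m0 : measurable ([set 0] : set (borel R d)) by exact: closed_borel.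
apply: (@measurable_funS _ _ (borel R d) R ((U `&` ~` [set 0]) `|` [set 0])).
- by apply: measurableU => //; exact: open_borel.
- move=> x Dx; have [->|/eqP x0] := eqVneq x 0; first by right.
  by left; split => //; exact: DU.
apply/measurable_funU => //; first exact: open_borel.
split; last exact: measurable_fun_set1.
by apply: continuous_borel_fun => // x [Ux /eqP x0]; exact: cf.
Qed.

End euclidean_disc.

Section image_mass.
Context (R : realType) (n d : nat) (M N : set 'rV[R]_n) (p : 'rV[R]_n -> 'rV[R]_d).
Hypotheses (oN : open N) (cp : continuous p).

Let mN : measurable (N : set (caratheodory_type (mass d M))).
Proof. exact: open_mass_measurable. Qed.

Let mp : measurable_fun setT (p : caratheodory_type (mass d M) -> borel R d).
Proof.
apply: continuous_to_borel => U oU; apply: open_mass_measurable.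
by move: cp => /continuousP; exact.
Qed.

(** Continuous maps carry the mass to a Borel measure, since the Borel sets are
    among the Caratheodory sets of the mass. *)
Definition image_mass : {measure set (borel R d) -> \bar R} :=
  measure_function_pushforward__canonical__measure_function_Measure
    (mrestr (mass d M : {measure set (caratheodory_type (mass d M)) -> \bar R}) mN) mp.

Lemma image_massE (A : set 'rV[R]_d) :
  image_mass A = hausdorff d (M `&` N `&` p @^-1` A).
Proof.
rewrite /image_mass/= /pushforward/= /mrestr /mass.
by congr hausdorff; apply/seteqP; split => y [[? ?] ?].
Qed.

Lemma image_mass_Rintegral (D : set (borel R d)) (h : borel R d -> R) (K : R) :
  measurable D -> (image_mass D < +oo)%E -> measurable_fun D h ->
  (forall x, D x -> `|h x| <= K) ->
  \int[image_mass]_(x in D) h x =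
  \int[mass d M : set (caratheodory_type (mass d M)) -> \bar R]_(y in p @^-1` D `&` N)
    h (p y).
Proof.
move=> mD Dfin mh hK.
pose m : {measure set (caratheodory_type (mass d M)) -> \bar R} := mass d M.
rewrite (Rintegral_image (mu := mrestr m mN) mp _ mD _ mh hK)//.
have mpD : measurable (p @^-1` D : set (caratheodory_type (mass d M))).
  by rewrite -[X in measurable X]setTI; exact: mp.
have ipD : (mrestr m mN).-integrable (p @^-1` D) (EFin \o (h \o p)).
  apply: (@bounded_integrable _ _ _ _ _ _ K) => //; last by move=> y Dy; exact: hK.
  apply: (measurable_comp mD _ mh); [by move=> _ [y Dy <-]|exact: measurable_funTS].
congr fine; rewrite (@negligible_integral _ _ _ _ _ (~` N : set (caratheodory_type (mass d M))))//; last 2 first.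
- exact: measurableC.
- by rewrite /= /mrestr setICl measure0.
rewrite setDE setCK; apply: eq_measure_integral => A mA AD.
by rewrite /= /mrestr setIidl// => y /AD[].
Qed.

End image_mass.

(** * Hausdorff measure of full dimension *)

Section full_measure.
Context (R : realType) (d : nat).

(** Hausdorff measure on Borel sets. Lebesgue measure is a multiple of it, but its
    invariances are all that the limits involve. *)
Definition haus : {measure set (borel R d) -> \bar R} :=
  image_mass (d := d) setT openT (fun x : 'rV[R]_d => @cvg_id _ (nbhs x)).

Lemma hausE (A : set 'rV[R]_d) : haus A = hausdorff d A.
Proof. by rewrite /haus image_massE !setTI. Qed.

(** The normalisation of Hausdorff measure; it cancels in the limits. *)
Definition disc_mass : R := fine (haus (@edisc R d 1)).

Hypotheses (d_gt0 : (0 < d)%N) (w_gt0 : 0 < ball_volume R d).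

Lemma disc_massE : haus (@edisc R d 1) = disc_mass%:E.
Proof.
rewrite fineK// ge0_fin_numE// hausE; exact: hausdorff_ball_lty.
Qed.

Lemma disc_mass_gt0 : 0 < disc_mass.
Proof. by rewrite -lte_fin -disc_massE hausE hausdorff_ball_gt0. Qed.

Lemma haus_scale (A : set 'rV[R]_d) (e : R) : 0 < e ->
  haus ((fun x : 'rV[R]_d => e^-1 *: x) @^-1` A) = ((e ^+ d)%:E * haus A)%E.
Proof.
move=> e0; rewrite !hausE -hausdorff_scale//; congr hausdorff.
apply/seteqP; split => [x /= Ax|_ [x Ax <-]] /=.
  by exists (e^-1 *: x) => //; rewrite scalerA divff ?scale1r// gt_eqF.
by rewrite scalerA mulVf ?scale1r// gt_eqF.
Qed.

Lemma edisc_scale (e : R) : 0 < e ->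
  (fun x : 'rV[R]_d => e^-1 *: x) @^-1` (@edisc R d 1) = @edisc R d e.
Proof.
move=> e0; apply/seteqP; split => x;
  by rewrite /edisc/= enormZ gtr0_norm ?invr_gt0// ler_pdivrMl// mulr1.
Qed.

Lemma haus_edisc (r : R) : 0 <= r -> haus (@edisc R d r) = (disc_mass * r ^+ d)%:E.
Proof.
rewrite le_eqVlt => /predU1P[<-|r0]; last first.
  by rewrite -edisc_scale// haus_scale// disc_massE -EFinM mulrC.
rewrite expr0n gtn_eqF// mulr0.
(* the origin is invariant by scaling *)
have := haus_scale (@edisc R d 0) (ltr0n R 2).
rewrite (_ : _ @^-1` _ = @edisc R d 0); last first.
  apply/seteqP; split => x; rewrite /edisc/= enormZ gtr0_norm ?invr_gt0//;
  by rewrite pmulr_rle0// invr_gt0.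
have Hfin : haus (@edisc R d 0) \is a fin_num.
  rewrite ge0_fin_numE// (@le_lt_trans _ _ (haus (@edisc R d 1)))// ?disc_massE ?ltry//.
  rewrite -disc_massE !hausE; exact: (le_hausdorff d (@le_edisc R d _ _ (@ler01 R))).
rewrite -(fineK Hfin) -EFinM => -[/eqP]; rewrite -subr_eq0 -{1}[fine _]mul1r -mulrBl.
rewrite mulf_eq0 => /orP[|/eqP -> //]; rewrite subr_eq0 => /eqP h1.
have : (1 < 2 ^+ d :> R) by rewrite exprn_egt1 ?ltr1n// -lt0n.
by rewrite -h1 ltxx.
Qed.

Lemma haus_edisc_lty (r : R) : 0 <= r -> (haus (@edisc R d r) < +oo)%E.
Proof. by move=> r0; rewrite haus_edisc// ltry. Qed.

Lemma haus_edisc_fine (r : R) : 0 <= r -> fine (haus (@edisc R d r)) = disc_mass * r ^+ d.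
Proof. by move=> r0; rewrite haus_edisc. Qed.

Lemma Rintegral_haus_scale (h : borel R d -> R) (K e : R) : 0 < e ->
  measurable_fun (@edisc R d 1 : set (borel R d)) h ->
  (forall x, edisc 1 x -> `|h x| <= K) ->
  \int[haus]_(x in @edisc R d e) h (e^-1 *: (x : 'rV[R]_d)) =
  e ^+ d * \int[haus]_(x in @edisc R d 1) h x.
Proof.
move=> e0 mh hK; have ed0 : 0 <= e ^+ d by rewrite exprn_ge0// ltW.
rewrite -edisc_scale//.
have mD := @edisc_measurable R d 1.
have D1 := haus_edisc_lty (@ler01 R).
rewrite -(Rintegral_mscale (NngNum ed0) mD D1 mh hK) /=.
rewrite (@Rintegral_image _ _ _ _ _ (fun x : borel R d => (e^-1 *: (x : 'rV[R]_d)) : borel R d) haus _ _ h K)//.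
- apply: continuous_borel; exact: scaler_continuous.
- by move=> A mA _; rewrite haus_scale.
- by rewrite edisc_scale//; apply: haus_edisc_lty; exact: ltW.
Qed.

Lemma Rintegral_haus_orthogonal (P : 'M[R]_d) (h : borel R d -> R) (K r : R) :
  P *m P^T = 1%:M -> 0 <= r ->
  measurable_fun (@edisc R d r : set (borel R d)) h ->
  (forall x, edisc r x -> `|h x| <= K) ->
  \int[haus]_(x in @edisc R d r) h ((x : 'rV[R]_d) *m P) =
  \int[haus]_(x in @edisc R d r) h x.
Proof.
move=> PP r0 mh hK; have PP' := mulmx1C PP.
have PD : (fun x : 'rV[R]_d => x *m P) @^-1` (@edisc R d r) = @edisc R d r.
  by apply/seteqP; split => x; rewrite /edisc/= enorm_isometry.
rewrite (@Rintegral_image _ _ _ _ _ (fun x : borel R d => ((x : 'rV[R]_d) *m P) : borel R d) haus haus _ h K)//.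
- by rewrite PD.
- apply: continuous_borel; exact: continuous_mulmxr.
- move=> A mA _; rewrite !hausE.
  have -> : (fun x : borel R d => (x : 'rV[R]_d) *m P) @^-1` A =
            (fun x : 'rV[R]_d => x *m P^T) @` A.
    apply/seteqP; split => [x /= Ax|_ [x Ax <-]] /=; last by rewrite -mulmxA PP' mulmx1.
    by exists (x *m P) => //; rewrite -mulmxA PP mulmx1.
  rewrite hausdorff_isometry// => x y _ _; rewrite -mulmxBl.
  by rewrite enorm_isometry// trmxK.
- exact: edisc_measurable.
- by rewrite PD; exact: haus_edisc_lty.
Qed.

End full_measure.

(** * Radial integrals *)

(** Derivatives as affine approximations, which is how they are estimated
    below. *)
Lemma is_derive_nearP (R : realType) (V : normedModType R) (f : R -> V) (t : R) (a : V) :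
  is_derive t 1 f a <->
  forall e : R, 0 < e -> \forall s \near t, `|f s - f t - (s - t) *: a| <= e * `|s - t|.
Proof.
have quot (s : R) : s != t -> forall e : R,
    (`|a - (s - t)^-1 *: (f s - f t)| <= e) =
    (`|f s - f t - (s - t) *: a| <= e * `|s - t|).
  move=> st e; have st0 : s - t != 0 by rewrite subr_eq0.
  rewrite -ler_pdivrMr ?normr_gt0// mulrC -normrV ?unitfE// -normrZ.
  by rewrite [in RHS]scalerBr scalerA mulVf// scale1r distrC.
have shiftE (P : R -> Prop) :
    (\forall h \near 0^', P (h + t)) <-> (\forall s \near t, s != t -> P s).
  split => [/nbhs_ballP[e /= e0 eP]|/nbhs_ballP[e /= e0 eP]]; apply/nbhs_ballP; exists e => //.
    move=> s ts st; have := eP (s - t); rewrite subrK; apply; last by rewrite subr_eq0.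
    by move: ts; rewrite -!ball_normE /= sub0r normrN distrC.
  move=> h /= h0 hn; apply: eP; last by rewrite -subr_eq0 addrK.
  by move: h0; rewrite -!ball_normE /= sub0r normrN opprD addrCA subrr addr0 normrN.
pose Q e s := `|a - (s - t)^-1 *: (f s - f t)| <= e.
split => [[df Df] e e0|h].
  have : h^-1 *: ((f \o shift t) (h *: 1) - f t) @[h --> 0^'] --> a by rewrite -Df.
  move=> /cvgrPdist_le /(_ _ e0) H.
  have /(shiftE (Q e)) : \forall h \near 0^', Q e (h + t).
    by apply: filterS H => h; rewrite /Q /= addrK [h *: 1]mulr1.
  apply: filterS => s; have [->|st] := eqVneq s t.
    by move=> _; rewrite !subrr scale0r subrr !normr0 mulr0.
  by move=> /(_ isT); rewrite /Q quot.
have cv : h^-1 *: ((f \o shift t) (h *: 1) - f t) @[h --> 0^'] --> a.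
  apply/cvgrPdist_le => e e0.
  have /(shiftE (Q e)) : \forall s \near t, s != t -> Q e s.
    by apply: filterS (h e e0) => s sP st; rewrite /Q quot.
  by apply: filterS => k; rewrite /Q /= addrK [k *: 1]mulr1.
split; first by apply/cvg_ex; exists a.
exact: (cvg_lim (@norm_hausdorff _ _) cv).
Qed.

Section radial.
Context (R : realType) (d : nat).
Hypothesis d_gt0 : (0 < d)%N.
Variables (f : R -> R) (K : R).
Hypotheses (cf : forall t, 0 < t -> {for t, continuous f})
  (cf0 : f t @[t --> 0^'+] --> f 0) (fK : forall t, 0 <= t <= 1 -> `|f t| <= K).

Let c := disc_mass R d.
Let P (r : R) : R := c * r ^+ d.
Let phi (r : R) : R := \int[haus R d]_(x in @edisc R d r) f (enorm (x : 'rV[R]_d)).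

Let mf (D : set (borel R d)) : measurable D ->
  measurable_fun D (fun x : borel R d => f (enorm (x : 'rV[R]_d))).
Proof.
move=> mD; apply: (measurable_off0 openT mD) => // x _ x0.
apply: continuous_comp; first exact: continuous_enorm.
by apply: cf; rewrite enorm_gt0.
Qed.

Let c_ge0 : 0 <= c. Proof. exact: fine_ge0. Qed.

Let P_le (r s : R) : 0 <= r -> r <= s -> P r <= P s.
Proof.
by move=> r0 rs; rewrite ler_wpM2l// lerXn2r// nnegrE// (le_trans r0).
Qed.

Let phi_increment (r s a e : R) : 0 <= r -> r <= s -> s <= 1 ->
  (forall t, r <= t <= s -> `|f t - a| <= e) ->
  `|phi s - phi r - a * (P s - P r)| <= e * (P s - P r).
Proof.
move=> r0 rs s1 fa; have s0 := le_trans r0 rs.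
have mr := @edisc_measurable R d r; have ms := @edisc_measurable R d s.
pose A : set (borel R d) := @edisc R d s `\` @edisc R d r.
have mA : measurable A by exact: measurableD.
have sE : @edisc R d s = @edisc R d r `|` A.
  by rewrite /A setDUK//; exact: le_edisc.
have AE : fine (haus R d A) = P s - P r.
  have rfin := haus_edisc_lty d_gt0 r0; have sfin := haus_edisc_lty d_gt0 s0.
  rewrite /A measureD// setIidr; last exact: le_edisc.
  rewrite (_ : (_ - _)%E = ((P s)%:E - (P r)%:E)%E)//.
  by congr (_ - _)%E; exact: haus_edisc.
have Afin : (haus R d A < +oo)%E.
  apply: le_lt_trans (haus_edisc_lty d_gt0 s0).
  by apply: le_measure; rewrite ?inE//; exact: subDsetl.
have Ax x : A x -> r <= enorm (x : 'rV[R]_d) <= s.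
  by move=> [/= xs /negP]; rewrite -ltNge xs andbT => /ltW.
have iA : (haus R d).-integrable A (EFin \o (fun x : borel R d => f (enorm (x : 'rV[R]_d)))).
  apply: (@bounded_integrable _ _ _ _ _ _ K) => //; first exact: mf.
  move=> x /Ax /andP[rx xs]; apply: fK.
  by rewrite (le_trans r0 rx) (le_trans xs s1).
have -> : phi s = phi r + \int[haus R d]_(x in A) f (enorm (x : 'rV[R]_d)).
  rewrite /phi [in LHS]sE Rintegral_setU//.
    rewrite -sE; apply: (@bounded_integrable _ _ _ _ _ _ K) => //.
    - exact: haus_edisc_lty.
    - exact: mf.
    - by move=> x /= xs; apply: fK; rewrite enorm_ge0 (le_trans xs s1).
  by apply/disj_setPS => x [/= ? []].
rewrite [phi r + _]addrC addrK -AE -(Rintegral_cst (haus R d) mA) -RintegralB//; last first.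
  by apply: (@bounded_integrable _ _ _ _ _ _ `|a|).
apply: Rintegral_bound => //; first by apply: measurable_funB => //; exact: mf.
by move=> x /Ax; exact: fa.
Qed.

Let phi_derive (r : R) : 0 < r < 1 -> is_derive r 1 phi (c * (d%:R * r ^+ d.-1) * f r).
Proof.
move=> /andP[r0 r1].
pose p' := c * (d%:R * r ^+ d.-1).
have dP : is_derive r 1 P p'.
  have -> : P = c \*: (id ^+ d : R -> R).
    by apply/funext => t; rewrite /P /= exprfctE.
  apply: is_derive_eq (is_deriveZ c (is_deriveX d (is_derive_id r 1))) _.
  by rewrite /p' /= /GRing.scale/= mulr1.
apply/is_derive_nearP => e e0.
pose b := `|p'| + 1; have b0 : 0 < b by rewrite ltr_wpDl.
pose a := `|f r| + 1; have a0 : 0 < a by rewrite ltr_wpDl.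
have e1 : 0 < e / 2 / b by rewrite !divr_gt0.
have e2 : 0 < e / 2 / a by rewrite !divr_gt0.
have /nbhs_ballP[u /= u0 fu] : \forall s \near r, `|f r - f s| <= e / 2 / b.
  exact: (cvgr_dist_le _ _ (cf r0) _ e1).
have := (proj1 (is_derive_nearP _ _ _) dP) _ e2.
have := (proj1 (is_derive_nearP _ _ _) dP) _ (@ltr01 R).
have : \forall s \near r, [/\ 0 < s, s < 1 & ball r u s].
  by near=> s; split; near: s; [exact: lt_nbhsr|exact: lt_nbhsl|exact: nbhsx_ballx].
apply: filterS3 => s [s0 s1 rus] P1 P2.
have Pb : `|P s - P r| <= b * `|s - r|.
  rewrite (_ : P s - P r = (P s - P r - (s - r) *: p') + (s - r) *: p'); last by rewrite subrK.
  apply: le_trans (ler_normD _ _) _; apply: le_trans (lerD P1 (lexx _)) _.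
  by rewrite normrZ /b mulrDl mul1r addrC mulrC.
have inc : `|phi s - phi r - f r * (P s - P r)| <= e / 2 / b * `|P s - P r|.
  have fr t : `|t - r| < u -> `|f t - f r| <= e / 2 / b.
    by move=> tr; rewrite distrC; apply: fu; rewrite -ball_normE /= distrC.
  have : `|s - r| < u by move: rus; rewrite -ball_normE /= distrC.
  have [rs|sr] := leP r s.
    move=> su; rewrite [in leRHS]ger0_norm; last by rewrite subr_ge0 P_le// ltW.
        apply: phi_increment => [|||t /andP[rt ts]]; [exact: ltW|by []|exact: ltW|apply: fr].
    by move: su; rewrite !ger0_norm ?subr_ge0//; lra.
  move=> su; rewrite [in leRHS]distrC [in leRHS]ger0_norm; last by rewrite subr_ge0 P_le ?ltW// ltW.
  rewrite -normrN (_ : - (_ - _) = phi r - phi s - f r * (P r - P s)); last by ring.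
  apply: phi_increment => [|||t /andP[rt ts]]; [exact: ltW|exact: ltW|exact: ltW|apply: fr].
  by move: su; rewrite !ler0_norm ?subr_le0//; lra.
rewrite (_ : phi s - _ - _ = (phi s - phi r - f r * (P s - P r)) +
  f r * (P s - P r - (s - r) *: p')); last by rewrite /p' /GRing.scale/=; ring.
apply: le_trans (ler_normD _ _) _; rewrite (splitr e) mulrDl; apply: lerD.
  apply: le_trans inc _; rewrite -mulrA ler_pM2l ?divr_gt0//.
  by rewrite ler_pdivrMl.
rewrite normrM; apply: (@le_trans _ _ (a * (e / 2 / a * `|s - r|))).
  by apply: ler_pM => //; rewrite /a lerDl.
by rewrite mulrA mulrCA mulfV ?gt_eqF// mulr1.
Unshelve. all: by end_near. Qed.

(** In polar coordinates: the mass of a disc of radius [r] is a multiple of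
    [r ^+ d], and the integral over it is differentiable in [r]. *)
Lemma Rintegral_radial :
  \int[haus R d]_(x in @edisc R d 1) f (enorm (x : 'rV[R]_d)) =
  disc_mass R d * d%:R * \int[@lebesgue_measure R]_(t in `[0, 1]) (f t * t ^+ d.-1).
Proof.
pose g t := c * (d%:R * t ^+ d.-1) * f t.
have K0 : 0 <= K by apply: le_trans (fK (t := 0) _); rewrite ?lexx ?ler01.
have phi0 : phi 0 = 0.
  apply/eqP; rewrite -normr_le0.
  apply: (@le_trans _ _ (K * fine (haus R d (@edisc R d 0)))); last first.
    by rewrite haus_edisc_fine// expr0n gtn_eqF// !mulr0.
  apply: Rintegral_bound.
  - exact: edisc_measurable.
  - exact: haus_edisc_lty.
  - by apply: mf; exact: edisc_measurable.
  - by move=> x /= x0; apply: fK; rewrite enorm_ge0 (le_trans x0).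
have cpoly : continuous (fun t : R => c * (d%:R * t ^+ d.-1)).
  move=> t; apply: cvgM; first exact: cvg_cst.
  by apply: cvgM; [exact: cvg_cst|exact: exprn_continuous].
have cP : continuous P.
  by move=> t; apply: cvgM; [exact: cvg_cst|exact: exprn_continuous].
have phiK r s : 0 <= r -> r <= s -> s <= 1 -> `|phi s - phi r| <= K * (P s - P r).
  move=> r0 rs s1; have := @phi_increment r s 0 K r0 rs s1.
  rewrite mul0r subr0; apply => t /andP[rt ts]; rewrite subr0 fK//.
  by rewrite (le_trans r0 rt) (le_trans ts).
have cg : {within `[0, 1], continuous g}.
  apply/continuous_within_itvP => //; split.
  - move=> t; rewrite in_itv/= => /andP[t0 _].
    by apply: cvgM; [exact: cpoly|exact: cf].
  - by apply: cvgM => //; apply: cvg_at_right_filter; exact: cpoly.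
  - apply: cvg_at_left_filter; apply: cvgM; [exact: cpoly|exact: cf].
have dphi : derivable_oo_LRcontinuous phi 0 1.
  split.
  - by move=> t; rewrite in_itv/= => /phi_derive[].
  - apply/cvgrPdist_le => e e0.
    have : P s @[s --> 0^'+] --> P 0 by apply: cvg_at_right_filter; exact: cP.
    have e1 : 0 < e / (K + 1) by rewrite divr_gt0// ltr_wpDl.
    move=> /cvgrPdist_le /(_ _ e1) H; near=> s.
    have s0 : 0 <= s by apply/ltW; near: s; exact: nbhs_right_gt.
    rewrite distrC; apply: le_trans (phiK 0 s _ _ _) _ => //.
      by apply/ltW; near: s; exact: nbhs_right_lt.
    apply: (@le_trans _ _ ((K + 1) * `|P 0 - P s|)).
      rewrite distrC; apply: ler_pM => //; first by rewrite subr_ge0 P_le.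
        by rewrite lerDl.
      exact: ler_norm.
    rewrite -ler_pdivlMl; last by rewrite ltr_wpDl.
    by rewrite mulrC; near: s.
  - apply/cvgrPdist_le => e e0.
    have : P s @[s --> 1^'-] --> P 1 by apply: cvg_at_left_filter; exact: cP.
    have e1 : 0 < e / (K + 1) by rewrite divr_gt0// ltr_wpDl.
    move=> /cvgrPdist_le /(_ _ e1) H; near=> s.
    have s1 : s <= 1 by apply/ltW; near: s; exact: nbhs_left_lt.
    have s0 : 0 <= s by apply/ltW; near: s; exact: nbhs_left_gt.
    apply: le_trans (phiK s 1 _ _ _) _ => //.
    apply: (@le_trans _ _ ((K + 1) * `|P 1 - P s|)).
      apply: ler_pM => //; first by rewrite subr_ge0 P_le.
        by rewrite lerDl.
      exact: ler_norm.
    rewrite -ler_pdivlMl; last by rewrite ltr_wpDl.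
    by rewrite mulrC; near: s.
have dg : {in `]0, 1[, derive1 phi =1 g}.
  by move=> t; rewrite in_itv/= => /phi_derive dt; rewrite derive1E; exact: derive_val.
have := @continuous_FTC2 R g phi 0 1 ltr01 cg dphi dg.
rewrite phi0 sube0 => FTC.
have cft : {within `[0, 1], continuous (fun t => f t * t ^+ d.-1)}.
  apply/continuous_within_itvP => //; split.
  - move=> t; rewrite in_itv/= => /andP[t0 _].
    by apply: cvgM; [exact: cf|exact: exprn_continuous].
  - by apply: cvgM => //; apply: cvg_at_right_filter; exact: exprn_continuous.
  - apply: cvg_at_left_filter; apply: cvgM; [exact: cf|exact: exprn_continuous].
rewrite -/(phi 1) -RintegralZl//; last first.
  by apply: continuous_compact_integrable => //; exact: segment_compact.
rewrite -[LHS]/(fine (phi 1)%:E) -FTC; congr fine.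
by apply: eq_integral => t _; congr EFin; rewrite /g /c; ring.
Unshelve. all: by end_near. Qed.

End radial.

Section finite_sums.
Context (R : realType) (disp : measure_display) (T : measurableType disp).
Variables (mu : {measure set T -> \bar R}) (D : set T) (mD : measurable D).
Context (I : Type) (F : I -> T -> R).
Hypothesis iF : forall i, mu.-integrable D (EFin \o F i).

Lemma integrable_sumR (s : seq I) :
  mu.-integrable D (EFin \o (fun x => \sum_(i <- s) F i x)).
Proof.
elim: s => [|i s IH].
  by apply: (eq_integrable _ (cst 0%E)) => // [x _|]; rewrite /= ?big_nil//; exact: integrable0.
have := integrableD mD (iF i) IH; apply: eq_integrable => // x _.
by rewrite /= big_cons EFinD.
Qed.

Lemma Rintegral_sum (s : seq I) :
  \int[mu]_(x in D) (\sum_(i <- s) F i x) = \sum_(i <- s) \int[mu]_(x in D) F i x.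
Proof.
elim: s => [|i s IH].
  rewrite big_nil -[RHS](mul0r (fine (mu D))) -Rintegral_cst//.
  by apply: eq_Rintegral => x _; rewrite big_nil.
rewrite big_cons -IH -RintegralD//; last exact: integrable_sumR.
by apply: eq_Rintegral => x _; rewrite big_cons.
Qed.

End finite_sums.

Section moments.
Context (R : realType) (d : nat).
Hypothesis d_gt0 : (0 < d)%N.
Variables (f : R -> R) (K : R).
Hypotheses (cf : forall t, 0 < t -> {for t, continuous f})
  (cf0 : f t @[t --> 0^'+] --> f 0) (fK : forall t, 0 <= t <= 1 -> `|f t| <= K).

Let D1 : set (borel R d) := @edisc R d 1.
Let mD1 : measurable D1. Proof. exact: edisc_measurable. Qed.
Let D1fin : (haus R d D1 < +oo)%E. Proof. exact: haus_edisc_lty. Qed.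
Let K_ge0 : 0 <= K. Proof. by apply: le_trans (fK (t := 0) _); rewrite ?lexx ?ler01. Qed.

Lemma kernel_measurable (D : set (borel R d)) (u : 'rV[R]_d -> R) : measurable D ->
  continuous u ->
  measurable_fun D (fun x : borel R d => f (enorm (x : 'rV[R]_d)) / enorm (x : 'rV[R]_d) * u x).
Proof.
move=> mD cu; apply: (measurable_off0 openT mD) => // x _ x0.
have ex : 0 < enorm x by rewrite enorm_gt0.
have h1 : f (enorm y) @[y --> x] --> f (enorm x).
  by apply: continuous_comp; [exact: continuous_enorm|exact: cf].
have h2 : (enorm y)^-1 @[y --> x] --> (enorm x)^-1.
  by apply: (@cvgV R _ (nbhs x) _ (@enorm R d) (enorm x)); [rewrite gt_eqF|exact: continuous_enorm].
exact: cvgM (cvgM h1 h2) (cu x).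
Qed.

(** The linear growth of [u] compensates the singularity of [1 / |x|]. *)
Lemma kernel_bound (u : 'rV[R]_d -> R) (L : R) : 0 <= L ->
  (forall x, edisc 1 x -> `|u x| <= L * enorm x) ->
  forall x, edisc 1 x -> `|f (enorm x) / enorm x * u x| <= K * L.
Proof.
move=> L0 uL x x1; have [->|x0] := eqVneq x 0.
  by rewrite enorm0 invr0 mulr0 mul0r normr0 mulr_ge0.
have ex : 0 < enorm x by rewrite enorm_gt0.
rewrite -mulrA normrM; apply: ler_pM => //; first by apply: fK; rewrite enorm_ge0.
by rewrite normrM gtr0_norm ?invr_gt0// ler_pdivrMl// mulrC uL.
Qed.

Lemma kernel_integrable (u : 'rV[R]_d -> R) (L : R) : 0 <= L -> continuous u ->
  (forall x, edisc 1 x -> `|u x| <= L * enorm x) ->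
  (haus R d).-integrable D1
    (EFin \o (fun x : borel R d => f (enorm (x : 'rV[R]_d)) / enorm (x : 'rV[R]_d) * u x)).
Proof.
move=> L0 cu uL; apply: (@bounded_integrable _ _ _ _ _ _ (K * L)) => //.
  exact: kernel_measurable.
exact: kernel_bound.
Qed.

(** Change of variables by an orthogonal matrix: only [u] is affected. *)
Lemma kernel_orthogonal (P : 'M[R]_d) (u : 'rV[R]_d -> R) (L : R) : 0 <= L ->
  P *m P^T = 1%:M -> continuous u ->
  (forall x, edisc 1 x -> `|u x| <= L * enorm x) ->
  \int[haus R d]_(x in D1) (f (enorm (x : 'rV[R]_d)) / enorm (x : 'rV[R]_d) * u x) =
  \int[haus R d]_(x in D1)
     (f (enorm (x : 'rV[R]_d)) / enorm (x : 'rV[R]_d) * u ((x : 'rV[R]_d) *m P)).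
Proof.
move=> L0 PP cu uL.
rewrite -(Rintegral_haus_orthogonal d_gt0 PP ler01 (kernel_measurable mD1 cu)
  (kernel_bound L0 uL)).
by apply: eq_Rintegral => x _; rewrite enorm_isometry.
Qed.

Let coord2_le (j l : 'I_d) (x : 'rV[R]_d) : edisc 1 x -> `|x 0 j * x 0 l| <= 1 * enorm x.
Proof.
move=> x1; rewrite mul1r normrM -[leRHS]mulr1; apply: ler_pM => //; first exact: coord_enorm.
exact: le_trans (coord_enorm _ _) x1.
Qed.

Let coord2_continuous (j l : 'I_d) : continuous (fun x : 'rV[R]_d => x 0 j * x 0 l).
Proof. by move=> x; exact: cvgM (@coord_continuous R _ _ 0 j x) (@coord_continuous R _ _ 0 l x). Qed.

Lemma kernel_odd_moment (u : 'rV[R]_d -> R) (L : R) : 0 <= L -> continuous u ->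
  (forall x, edisc 1 x -> `|u x| <= L * enorm x) -> (forall x, u (- x) = - u x) ->
  \int[haus R d]_(x in D1) (f (enorm (x : 'rV[R]_d)) / enorm (x : 'rV[R]_d) * u x) = 0.
Proof.
move=> L0 cu uL uN; set I := LHS; suff : I = - I by lra.
rewrite /I [LHS](@kernel_orthogonal (- 1%:M) u L)//.
  rewrite -[RHS]mulN1r -RintegralZl//; last exact: kernel_integrable L0 cu uL.
  by apply: eq_Rintegral => x _; rewrite mulmxN mulmx1 uN mulrN mulN1r.
by rewrite linearN/= mulmxN mulNmx opprK trmx1 mulmx1.
Qed.

Lemma kernel_mixed_moment (j l : 'I_d) : j != l ->
  \int[haus R d]_(x in D1) (f (enorm (x : 'rV[R]_d)) / enorm (x : 'rV[R]_d) *
    ((x : 'rV[R]_d) 0 j * (x : 'rV[R]_d) 0 l)) = 0.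
Proof.
move=> jl; set I := LHS; suff : I = - I by lra.
(* the reflection that changes the sign of the coordinate of index j *)
pose P : 'M[R]_d := diag_mx (\row_k (if k == j then -1 else 1)).
have xP (x : 'rV[R]_d) k : (x *m P) 0 k = (if k == j then -1 else 1) * x 0 k.
  rewrite mxE (bigD1 k)//= big1 ?addr0; last first.
    by move=> i ik; rewrite !mxE (negbTE ik) mulr0n mulr0.
  by rewrite !mxE eqxx mulr1n mulrC.
rewrite /I [LHS](@kernel_orthogonal P (fun x => x 0 j * x 0 l) 1)//.
- rewrite -[RHS]mulN1r -RintegralZl//; last first.
    exact: (@kernel_integrable (fun x => x 0 j * x 0 l) 1 ler01
      (@coord2_continuous j l) (@coord2_le j l)).
  apply: eq_Rintegral => x _; rewrite !xP eqxx eq_sym (negbTE jl) mul1r.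
  by rewrite mulN1r mulNr mulrN mulN1r.
- apply/matrixP => i k; rewrite !mxE (bigD1 i)//= big1 ?addr0; last first.
    by move=> m mi; rewrite !mxE [i == m]eq_sym (negbTE mi) mulr0n mul0r.
  rewrite !mxE eqxx mulr1n; have [->|ik] := eqVneq k i.
    by rewrite mulr1n; case: ifP => _; rewrite ?mulrNN mulr1.
  by rewrite mulr0n mulr0.
- exact: coord2_le.
Qed.

Lemma kernel_square_moment (j : 'I_d) :
  \int[haus R d]_(x in D1) (f (enorm (x : 'rV[R]_d)) / enorm (x : 'rV[R]_d) *
    ((x : 'rV[R]_d) 0 j * (x : 'rV[R]_d) 0 j)) =
  disc_mass R d * \int[@lebesgue_measure R]_(t in `[0, 1]) (f t * t ^+ d).
Proof.
pose I j := \int[haus R d]_(x in D1) (f (enorm (x : 'rV[R]_d)) / enorm (x : 'rV[R]_d) *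
    ((x : 'rV[R]_d) 0 j * (x : 'rV[R]_d) 0 j)).
rewrite -/(I j).
have intI i : (haus R d).-integrable D1 (EFin \o (fun x : borel R d =>
    f (enorm (x : 'rV[R]_d)) / enorm (x : 'rV[R]_d) *
    ((x : 'rV[R]_d) 0 i * (x : 'rV[R]_d) 0 i))).
  exact: (@kernel_integrable (fun x => x 0 i * x 0 i) 1 ler01
      (@coord2_continuous i i) (@coord2_le i i)).
(* exchanging two coordinates shows that all the square moments agree *)
have Ieq i : I i = I j.
  rewrite /I [LHS](@kernel_orthogonal (tperm_mx i j) (fun x => x 0 i * x 0 i) 1)//.
  - apply: eq_Rintegral => x _; rewrite /tperm_mx -[tperm i j]tpermV -col_permE !mxE tpermL.
    by [].
  - by rewrite tr_tperm_mx -perm_mxM tperm2 perm_mx1.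
  - exact: coord2_le.
have sumI : \sum_i I i = \int[haus R d]_(x in D1) (f (enorm (x : 'rV[R]_d)) * enorm (x : 'rV[R]_d)).
  rewrite -Rintegral_sum//; apply: eq_Rintegral => x _; rewrite -mulr_sumr -/(dotp x x).
  rewrite -enorm_sqr; have [->|x0] := eqVneq (x : 'rV[R]_d) 0; first by rewrite enorm0 expr0n !mulr0.
  by rewrite expr2 mulrA mulfVK// gt_eqF// enorm_gt0.
have d0 : d%:R != 0 :> R by rewrite pnatr_eq0 -lt0n.
apply: (mulfI d0); have -> : d%:R * I j = \sum_i I i.
  by rewrite (eq_bigr (fun=> I j))// sumr_const card_ord mulr_natl.
rewrite sumI (@Rintegral_radial R d d_gt0 (fun t => f t * t) K).
- rewrite mulrA [d%:R * _]mulrC; congr (_ * _); apply: eq_Rintegral => t _.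
  by rewrite -mulrA -exprS prednK.
- by move=> t t0; apply: cvgM; [exact: cf|exact: cvg_id].
- by apply: cvgM => //; apply: cvg_at_right_filter; exact: cvg_id.
- move=> t /andP[t0 t1]; rewrite normrM -[leRHS]mulr1; apply: ler_pM => //.
    by apply: fK; rewrite t0.
  by rewrite ger0_norm.
Qed.

(** By symmetry the matrix of second moments is a multiple of the identity, so that
    integrating a quadratic form computes its trace. *)
Lemma kernel_second_moment (b : 'I_d -> 'I_d -> R) :
  \int[haus R d]_(x in D1) (f (enorm (x : 'rV[R]_d)) / enorm (x : 'rV[R]_d) *
    \sum_j \sum_l (x : 'rV[R]_d) 0 j * (x : 'rV[R]_d) 0 l * b j l) =
  disc_mass R d * \int[@lebesgue_measure R]_(t in `[0, 1]) (f t * t ^+ d) * \sum_j b j j.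
Proof.
pose k (x : 'rV[R]_d) := f (enorm x) / enorm x.
have int2 i l : (haus R d).-integrable D1 (EFin \o (fun x : borel R d =>
    k x * ((x : 'rV[R]_d) 0 i * (x : 'rV[R]_d) 0 l))).
  exact: (@kernel_integrable (fun x => x 0 i * x 0 l) 1 ler01
      (@coord2_continuous i l) (@coord2_le i l)).
have intb i l : (haus R d).-integrable D1 (EFin \o (fun x : borel R d =>
    b i l * (k x * ((x : 'rV[R]_d) 0 i * (x : 'rV[R]_d) 0 l)))).
  by have := integrableZl mD1 (b i l) (int2 i l); apply: eq_integrable.
have ints i : (haus R d).-integrable D1 (EFin \o (fun x : borel R d =>
    \sum_l b i l * (k x * ((x : 'rV[R]_d) 0 i * (x : 'rV[R]_d) 0 l)))).
  exact: integrable_sumR.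
transitivity (\int[haus R d]_(x in D1) \sum_i \sum_l b i l *
    (k x * ((x : 'rV[R]_d) 0 i * (x : 'rV[R]_d) 0 l))).
  apply: eq_Rintegral => x _; rewrite mulr_sumr; apply: eq_bigr => i _.
  by rewrite mulr_sumr; apply: eq_bigr => l _; rewrite mulrA mulrC.
rewrite Rintegral_sum// mulr_sumr; apply: eq_bigr => i _.
rewrite Rintegral_sum// (bigD1 i)//= big1 ?addr0; last first.
  by move=> l li; rewrite RintegralZl// kernel_mixed_moment ?mulr0// eq_sym.
by rewrite RintegralZl// kernel_square_moment mulrC.
Qed.

End moments.

(** * Rescaled integrals *)

Section rescaled.
Context (R : realType) (d : nat).
Hypothesis d_gt0 : (0 < d)%N.
Variables (nu : {measure set (borel R d) -> \bar R}) (r0 C : R).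
Hypotheses (r0_gt0 : 0 < r0) (C_ge0 : 0 <= C).
(** [nu] agrees with Hausdorff measure to second order at the origin. *)
Hypothesis nu_haus : forall s, 0 < s -> s <= r0 ->
  forall A : set (borel R d), measurable A -> A `<=` @edisc R d s ->
  (haus R d A <= nu A /\ nu A <= (1 + C * s ^+ 2)%:E * haus R d A)%E.
Variables (h : R -> borel R d -> R) (k1 k2 : borel R d -> R) (K : R).
Let D (s : R) : set (borel R d) := @edisc R d s.
Hypotheses (mk1 : measurable_fun (D 1) k1) (mk2 : measurable_fun (D 1) k2)
  (k1K : forall x, D 1 x -> `|k1 x| <= K) (k2K : forall x, D 1 x -> `|k2 x| <= K)
  (k10 : \int[haus R d]_(x in D 1) k1 x = 0)
  (mh : forall e, 0 < e -> e <= r0 -> measurable_fun (D e) (h e)).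
Hypothesis hk : forall eta, 0 < eta -> \forall e \near 0^'+, forall x : 'rV[R]_d,
  edisc e x -> `|h e x - (k1 (e^-1 *: x) + e * k2 (e^-1 *: x))| <= eta * e.

Let mD s : measurable (D s). Proof. exact: edisc_measurable. Qed.

(** The integral of [k1] would contribute a term of order [e ^- 1]; once it
    vanishes, the relative error [C * e ^+ 2] between the two measures and the error
    [eta * e] of the expansion are both negligible against the factor [e] of [k2]. *)
Lemma rescaled_Rintegral_cvg :
  e ^- d.+1 * \int[nu]_(x in D e) h e x @[e --> 0^'+] -->
  \int[haus R d]_(x in D 1) k2 x.
Proof.
have K0 : 0 <= K.
  by apply: le_trans (normr_ge0 (k1 (0 : 'rV[R]_d))) (k1K _); rewrite /D/edisc/= enorm0.
pose c := disc_mass R d; have c0 : 0 <= c by exact: fine_ge0.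
apply/cvgrPdist_le => a a0.
pose eta := a / 2 / (2 * c + 1).
have c1 : 0 < 2 * c + 1 by rewrite ltr_wpDl// mulr_ge0.
have eta0 : 0 < eta by rewrite !divr_gt0.
have b1 : 0 < 4 * K * C * c + 1 by rewrite ltr_wpDl// !mulr_ge0.
have H := hk eta0; near=> e.
have e0 : 0 < e by near: e; exact: nbhs_right_gt.
have er0 : e <= r0 by apply/ltW; near: e; exact: nbhs_right_lt.
have e1 : e <= 1 by apply/ltW; near: e; exact: nbhs_right_lt.
have eC : e < (C + 1)^-1.
  by near: e; apply: nbhs_right_lt; rewrite invr_gt0 ltr_wpDl.
have eb : e < a / 2 / (4 * K * C * c + 1).
  by near: e; apply: nbhs_right_lt; rewrite !divr_gt0.
have he : forall x : 'rV[R]_d, edisc e x ->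
    `|h e x - (k1 (e^-1 *: x) + e * k2 (e^-1 *: x))| <= eta * e.
  by near: e.
have t0 : 0 <= C * e ^+ 2 by rewrite mulr_ge0// exprn_ge0// ltW.
have t1 : C * e ^+ 2 <= 1.
  have C1 : 0 < C + 1 by rewrite ltr_wpDl.
  apply: (@le_trans _ _ ((C + 1) * e)); last first.
    by rewrite mulrC -ler_pdivlMr// div1r ltW.
  by rewrite expr2 mulrA ler_pM// ?mulr_ge0// ?(ltW e0)//; nra.
have nuD : (nu (D e) < +oo)%E.
  apply: le_lt_trans (nu_haus e0 er0 (mD e) _).2 _ => //.
  by rewrite /D (haus_edisc d_gt0 (ltW e0)) -EFinM ltry.
have hausD : (haus R d (D e) < +oo)%E by apply: haus_edisc_lty => //; exact: ltW.
have hausDE : fine (haus R d (D e)) = c * e ^+ d.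
  by apply: haus_edisc_fine => //; exact: ltW.
have nuDE : fine (nu (D e)) <= 2 * (c * e ^+ d).
  have le2 : (nu (D e) <= (2 * (c * e ^+ d))%:E)%E.
    apply: le_trans (nu_haus e0 er0 (mD e) _).2 _ => //.
    rewrite /D (haus_edisc d_gt0 (ltW e0)) -EFinM lee_fin ler_wpM2r//.
      by rewrite mulr_ge0// exprn_ge0// ltW.
    by rewrite -[2]/(1 + 1) lerD2l.
  by rewrite -lee_fin fineK// ge0_fin_numE.
pose s1 (x : borel R d) := k1 (e^-1 *: (x : 'rV[R]_d)).
pose s2 (x : borel R d) := k2 (e^-1 *: (x : 'rV[R]_d)).
have sD x : D e x -> D 1 (e^-1 *: (x : 'rV[R]_d)).
  by rewrite -[D e](edisc_scale d e0).
have msc (k : borel R d -> R) : measurable_fun (D 1) k ->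
    measurable_fun (D e) (fun x : borel R d => k (e^-1 *: (x : 'rV[R]_d))).
  move=> mk; apply: (measurable_comp (mD 1) _ mk); first by move=> _ [x Dx <-]; exact: sD.
  apply: measurable_funTS; apply: continuous_borel; exact: scaler_continuous.
have ms1 := msc _ mk1; have ms2 := msc _ mk2.
pose m x := s1 x + e * s2 x.
have mm : measurable_fun (D e) m.
  by apply: measurable_funD => //; exact: measurable_funM.
have s1K x : D e x -> `|s1 x| <= K by move=> /sD/k1K.
have s2K x : D e x -> `|s2 x| <= K by move=> /sD/k2K.
have mK x : D e x -> `|m x| <= 2 * K.
  move=> Dx; apply: le_trans (ler_normD _ _) _; rewrite mulrDl mul1r.
  apply: lerD; first exact: s1K.
  rewrite normrM (gtr0_norm e0) -[leRHS]mul1r; apply: ler_pM.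
  - exact: ltW.
  - by [].
  - by [].
  - exact: s2K.
have hmE x : D e x -> `|h e x - m x| <= eta * e by exact: he.
have mhe := mh e0 er0.
have ie : nu.-integrable (D e) (EFin \o m) by exact: (bounded_integrable (mD e) nuD mm mK).
have ih : nu.-integrable (D e) (EFin \o h e).
  apply: (bounded_integrable (mD e) nuD mhe (K := eta * e + 2 * K)) => x Dx.
  rewrite -(subrK (m x) (h e x)); apply: le_trans (ler_normD _ _) _.
  by apply: lerD; [exact: hmE|exact: mK].
have A1 : `|\int[nu]_(x in D e) h e x - \int[nu]_(x in D e) m x| <=
    eta * e * (2 * (c * e ^+ d)).
  rewrite -RintegralB//; apply: le_trans (Rintegral_bound (mD e) nuD _ hmE) _.
    exact: measurable_funB.
  by rewrite ler_wpM2l// mulr_ge0// ltW.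
have A2 := Rintegral_compare (mD e) hausD t0 (nu_haus e0 er0) mm mK.
rewrite hausDE in A2.
have A3 : \int[haus R d]_(x in D e) m x = e ^+ d * e * \int[haus R d]_(x in D 1) k2 x.
  rewrite RintegralD//; last 2 first.
  - exact: (bounded_integrable (mD e) hausD ms1 s1K).
  - have := integrableZl (mD e) e (bounded_integrable (mD e) hausD ms2 s2K).
    by apply: eq_integrable.
  rewrite (Rintegral_haus_scale d_gt0 e0 mk1 k1K) k10 mulr0 add0r.
  rewrite RintegralZl//; last exact: (bounded_integrable (mD e) hausD ms2 s2K).
  by rewrite (Rintegral_haus_scale d_gt0 e0 mk2 k2K); ring.
rewrite distrC.
have ed : 0 < e ^+ d.+1 by rewrite exprn_gt0.
rewrite -(ler_pM2l ed) -{1}(gtr0_norm ed) -normrM mulrBr mulrA mulfV ?gt_eqF// mul1r.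
set I := \int[nu]_(x in D e) h e x in A1 *.
set J := \int[nu]_(x in D e) m x in A1 A2.
rewrite A3 in A2; rewrite exprSr -{1}(subrK J I) -addrA.
apply: le_trans (ler_normD _ _) _; apply: le_trans (lerD A1 A2) _.
have [p0 p1] : 0 <= c * e ^+ d /\ 0 <= e ^+ d by rewrite mulr_ge0 ?exprn_ge0 ?(ltW e0).
have B1 : eta * (2 * c) <= a / 2.
  by rewrite /eta mulrAC ler_pdivrMr// ler_wpM2l ?divr_ge0// ?(ltW a0)// lerDl.
have B2 : 4 * K * C * c * e <= a / 2.
  move: eb; rewrite ltr_pdivlMr// => eb; apply: le_trans (ltW eb).
  by rewrite mulrC ler_pM2l// lerDl.
rewrite (_ : _ + _ = (eta * (2 * c) + 4 * K * C * c * e) * (e ^+ d * e)); last by ring.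
rewrite mulrC ler_wpM2l ?mulr_ge0// ?(ltW e0)//.
by rewrite [leRHS](splitr a) lerD.
Unshelve. all: by end_near. Qed.

End rescaled.

(** * Orthogonal projections *)

Section projections.
Context (R : realType) (n : nat).
Implicit Types (V W : set 'rV[R]_n) (u v w y : 'rV[R]_n).

Definition row_space m (A : 'M[R]_(m, n)) : set 'rV[R]_n :=
  [set v | exists w : 'rV[R]_m, v = w *m A].

(** Linear subspaces on which [proj] computes the orthogonal projection. *)
Definition has_proj V : Prop :=
  [/\ forall k u v, V u -> V v -> V (k *: u + v),
      forall y, V (proj V y) & forall y w, V w -> dotp (y - proj V y) w = 0].

Section with_proj.
Variable V : set 'rV[R]_n.
Hypothesis VP : has_proj V.

Lemma proj_in y : V (proj V y). Proof. by case: VP. Qed.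

Lemma perp_orthogonal y w : V w -> dotp (perp (proj V) y) w = 0.
Proof. by case: VP => _ _; exact. Qed.

Lemma proj_unique y v : V v -> (forall w, V w -> dotp (y - v) w = 0) -> proj V y = v.
Proof.
move=> Vv vP; have [lV _ _] := VP.
apply/eqP; rewrite -subr_eq0; apply/eqP/dotp_eq0; set a := _ - _.
have Va : V a by rewrite /a addrC -scaleN1r; apply: lV => //; exact: proj_in.
have := perp_orthogonal y Va; rewrite /perp => h1; have h2 := vP _ Va.
have aE : a = (y - v) - (y - proj V y) by rewrite /a opprB [RHS]addrC addrA subrK.
by rewrite {1}aE dotpBl h1 h2 subrr.
Qed.

Lemma projD y u : proj V (y + u) = proj V y + proj V u.
Proof.
have [lV _ _] := VP; apply: proj_unique.
  by rewrite -[proj V y]scale1r; apply: lV; exact: proj_in.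
move=> w Vw; rewrite opprD addrACA dotpDl.
by rewrite (perp_orthogonal y Vw) (perp_orthogonal u Vw) addr0.
Qed.

Lemma proj_id v : V v -> proj V v = v.
Proof. by move=> Vv; apply: proj_unique => // w _; rewrite subrr dotp0l. Qed.

Lemma has_proj0 : V 0.
Proof.
have [lV _ _] := VP; have V0 := proj_in 0.
by have := lV (-1) _ _ V0 V0; rewrite scaleN1r addNr.
Qed.

Lemma projZ k y : proj V (k *: y) = k *: proj V y.
Proof.
have [lV _ _] := VP; apply: proj_unique.
  by rewrite -[_ *: _]addr0; apply: lV; [exact: proj_in|exact: has_proj0].
by move=> w Vw; rewrite -scalerBr dotpZl (perp_orthogonal y Vw) mulr0.
Qed.

Lemma projN y : proj V (- y) = - proj V y.
Proof. by rewrite -scaleN1r projZ scaleN1r. Qed.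

Lemma projB y u : proj V (y - u) = proj V y - proj V u.
Proof. by rewrite projD projN. Qed.

Lemma perpD y u : perp (proj V) (y + u) = perp (proj V) y + perp (proj V) u.
Proof. by rewrite /perp projD opprD addrACA. Qed.

Lemma perpZ k y : perp (proj V) (k *: y) = k *: perp (proj V) y.
Proof. by rewrite /perp projZ scalerBr. Qed.

Lemma perpN y : perp (proj V) (- y) = - perp (proj V) y.
Proof. by rewrite /perp projN opprD. Qed.

Lemma perpB y u : perp (proj V) (y - u) = perp (proj V) y - perp (proj V) u.
Proof. by rewrite perpD perpN. Qed.

Lemma perp_in v : V v -> perp (proj V) v = 0.
Proof. by move=> Vv; rewrite /perp proj_id// subrr. Qed.

Lemma perp_eq0 v : perp (proj V) v = 0 -> V v.
Proof. by move=> /eqP; rewrite subr_eq0 => /eqP ->; exact: proj_in. Qed.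

Lemma proj_pythagoras y :
  enorm y ^+ 2 = enorm (proj V y) ^+ 2 + enorm (perp (proj V) y) ^+ 2.
Proof.
have ab := perp_orthogonal y (proj_in y); rewrite !enorm_sqr.
have yE : y = perp (proj V) y + proj V y by rewrite subrK.
move: (perp (proj V) y) (proj V y) yE ab => p q -> ab.
by rewrite dotpDl !dotpDr [dotp q p]dotpC ab; ring.
Qed.

Lemma enorm_proj y : enorm (proj V y) <= enorm y.
Proof.
rewrite -(ler_pXn2r (n := 2))// ?nnegrE ?enorm_ge0// [leRHS]proj_pythagoras lerDl.
by rewrite exprn_ge0// enorm_ge0.
Qed.

Lemma enorm_perp y : enorm (perp (proj V) y) <= enorm y.
Proof.
rewrite -(ler_pXn2r (n := 2))// ?nnegrE ?enorm_ge0// [leRHS]proj_pythagoras lerDr.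
by rewrite exprn_ge0// enorm_ge0.
Qed.

Lemma perp_le_dist y w : V w -> enorm (perp (proj V) y) <= enorm (y - w).
Proof.
move=> Vw; rewrite -[perp _ y](_ : perp (proj V) (y - w) = _) ?enorm_perp//.
by rewrite perpB (perp_in Vw) subr0.
Qed.

End with_proj.

(** The difference of the projections [P] and [Q] is [P Q^perp - P^perp Q]. The
    second term is controlled by the distance of the vectors of [W] to [V]; the first
    one is the adjoint of [Q^perp P], controlled by that of the vectors of [V] to [W]. *)
Lemma enorm_projB V W (k : R) : has_proj V -> has_proj W -> 0 <= k ->
  (forall v, V v -> exists2 w, W w & enorm (v - w) <= k * enorm v) ->
  (forall w, W w -> exists2 v, V v & enorm (w - v) <= k * enorm w) ->
  forall u, enorm (proj V u - proj W u) <= 2 * k * enorm u.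
Proof.
move=> VP WP k0 VW WV u.
pose P := proj V; pose Q := proj W.
have -> : proj V u - proj W u = P (perp Q u) - perp P (Q u).
  by rewrite /P /Q /perp (projB VP) opprB addrA subrK.
have h1 : enorm (perp P (Q u)) <= k * enorm u.
  have [v Vv] := WV _ (proj_in WP u) => h; apply: le_trans (perp_le_dist VP _ Vv) _.
  by apply: le_trans h _; rewrite ler_wpM2l// enorm_proj.
suff h2 : enorm (P (perp Q u)) <= k * enorm u.
  by apply: le_trans (enormB _ _) _; rewrite -mulrA mulrDl mul1r lerD.
set a := P (perp Q u).
have [->|a0] := eqVneq a 0; first by rewrite enorm0 mulr_ge0// enorm_ge0.
have ea : 0 < enorm a by rewrite enorm_gt0.
(* the adjoint of P Q^perp is Q^perp P *)
have aE : enorm a ^+ 2 = dotp u (perp Q a).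
  rewrite enorm_sqr; transitivity (dotp (perp Q u) a).
    have := perp_orthogonal VP (perp Q u) (proj_in VP (perp Q u)).
    by rewrite -/P -/a /perp dotpBl => /eqP; rewrite subr_eq0 eq_sym => /eqP.
  have h1' := perp_orthogonal WP u (proj_in WP a).
  have h2' := perp_orthogonal WP a (proj_in WP u).
  rewrite -[in LHS](subrK (Q a) a) -/(perp Q a) dotpDr h1' addr0.
  by rewrite /perp dotpBl -/Q [dotp (Q u) _]dotpC h2' subr0.
have [w Ww aw] := VW _ (proj_in VP (perp Q u)).
have h3 : enorm (perp Q a) <= k * enorm a by apply: le_trans aw; exact: perp_le_dist.
rewrite -(ler_pM2r ea) -expr2 aE; apply: le_trans (dotp_le_enorm _ _) _.
by rewrite mulrAC (mulrC (enorm u)) ler_wpM2r// enorm_ge0.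
Qed.

Lemma gram_unit m (A : 'M[R]_(m, n)) : row_free A -> A *m A^T \in unitmx.
Proof.
move=> fA; rewrite -row_free_unit -kermx_eq0; apply/rowV0P => v /sub_kermxP vA.
apply/eqP; rewrite -(mulmx_free_eq0 _ fA); apply/eqP/dotp_eq0.
by rewrite dotp_mulmx -mulmxA vA dotp0r.
Qed.

Lemma row_space_has_proj m (A : 'M[R]_(m, n)) : row_free A -> has_proj (row_space A).
Proof.
move=> fA; have uA := gram_unit fA.
pose P (y : 'rV[R]_n) := y *m A^T *m invmx (A *m A^T) *m A.
have PP y : row_space A (P y) /\ forall w, row_space A w -> dotp (y - P y) w = 0.
  split; first by exists (y *m A^T *m invmx (A *m A^T)).
  move=> _ [w ->]; rewrite dotpC dotp_mulmx mulmxBl /P -!mulmxA mulVmx// mulmx1.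
  by rewrite subrr dotp0r.
have pP y : row_space A (proj (row_space A) y) /\
    forall w, row_space A w -> dotp (y - proj (row_space A) y) w = 0.
  by apply: (@xgetPex _ 0 [set v | row_space A v /\ forall w, row_space A w -> dotp (y - v) w = 0]); exists (P y).
split; [|by move=> y; case: (pP y)|by move=> y; case: (pP y)].
by move=> k _ _ [a ->] [b ->]; exists (k *: a + b); rewrite mulmxDl scalemxAl.
Qed.

Lemma orthonormal_free m (E : 'M[R]_(m, n)) : E *m E^T = 1%:M -> row_free E.
Proof. by move=> EE; apply/row_freeP; exists E^T. Qed.

Lemma proj_orthonormal m (E : 'M[R]_(m, n)) y : E *m E^T = 1%:M ->
  proj (row_space E) y = y *m E^T *m E.
Proof.
move=> EE; apply: (proj_unique (row_space_has_proj (orthonormal_free EE))).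
  by exists (y *m E^T).
by move=> _ [w ->]; rewrite dotpC dotp_mulmx mulmxBl -[_ *m E *m _]mulmxA EE mulmx1 subrr dotp0r.
Qed.

Lemma orthonormal_basis_exists m (A : 'M[R]_(m, n)) : row_free A ->
  exists E : 'M[R]_(m, n), E *m E^T = 1%:M /\ (E <= A)%MS.
Proof.
move=> fA; suff h k : (k <= m)%N ->
    exists E : 'M[R]_(k, n), E *m E^T = 1%:M /\ (E <= A)%MS by exact: h.
elim: k => [_|k IH km].
  by exists 0; rewrite mul0mx sub0mx; split => //; apply/matrixP => -[].
have [E [EE EA]] := IH (ltnW km).
(* Gram-Schmidt: the part of some row of A that is orthogonal to E *)
have /row_subPn[i iE] : ~~ (A <= E)%MS.
  apply/negP => /mxrankS; rewrite (eqP fA) (eqP (orthonormal_free EE)).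
  by rewrite leqNgt km.
pose a := row i A; pose b := a - a *m E^T *m E.
have b0 : b != 0.
  apply: contra iE; rewrite subr_eq0 => /eqP; rewrite -/a => ->; exact: submxMl.
have bE : b *m E^T = 0 by rewrite /b mulmxBl -[a *m E^T *m E *m E^T]mulmxA EE mulmx1 subrr.
pose c := (enorm b)^-1 *: b.
have eb : enorm b != 0 by rewrite gt_eqF// enorm_gt0.
have cc : c *m c^T = 1%:M.
  apply/matrixP => x y; rewrite !ord1 -dotpE -enorm_sqr enormZ normfV ger0_norm ?enorm_ge0//.
  by rewrite mulVf// expr1n mxE.
have cE : c *m E^T = 0 by rewrite -scalemxAl bE scaler0.
have Ec : E *m c^T = 0 by rewrite -[LHS]trmxK trmx_mul trmxK cE trmx0.
have EE1 : col_mx c E *m (col_mx c E)^T = (1%:M : 'M[R]_(1 + k)).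
  rewrite tr_col_mx mul_col_row cc EE cE Ec; exact/esym/scalar_mx_block.
exists (col_mx c E); split; first exact: EE1.
have -> : (col_mx c E <= A)%MS = (c <= A)%MS && (E <= A)%MS by rewrite -col_mx_sub.
rewrite EA andbT /c /b; apply: scalemx_sub; apply: addmx_sub; first exact: row_sub.
by rewrite eqmx_opp; apply: submx_trans (submxMl _ _) EA.
Qed.

Lemma orthonormal_change m (A E : 'M[R]_(m, n)) : row_free A -> E *m E^T = 1%:M ->
  (forall i, row_space A (row i E)) ->
  exists K : 'M[R]_m, K \in unitmx /\ A = K *m E.
Proof.
move=> fA EE rE; have fE := orthonormal_free EE.
have EA : (E <= A)%MS.
  by apply/row_subP => i; have [w ->] := rE i; exact: submxMl.
have AE : (A <= E)%MS.
  by have [_] := mxrank_leqif_eq EA; rewrite (eqP fA) (eqP fE) eqxx => /esym/andP[].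
have [K AK] := submxP AE; exists K; split => //.
rewrite -row_free_unit /row_free eqn_leq rank_leq_row/= -{1}(eqP fA) AK.
exact: mxrankM_maxl.
Qed.

End projections.

(** * Charts and tangent spaces *)

Section differentiability.
Context (R : realType).

Lemma differentiable_near d n (f : 'rV[R]_d -> 'rV[R]_n) x : differentiable f x ->
  forall e, 0 < e -> \forall y \near x,
    enorm (f y - f x - (y - x) *m jacobian f x) <= e * enorm (y - x).
Proof.
move=> df e e0; have e1 : 0 < e / n.+1%:R by rewrite divr_gt0.
have /eqaddoP/(_ _ e1)/nbhs_ballP[r /= r0 rP] := diff_locally df.
apply/nbhs_ballP; exists r => //= y xy.
have xy0 : ball (0 : 'rV[R]_d) r (y - x).
  by move: xy; rewrite -!ball_normE /= sub0r normrN distrC.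
have := rP (y - x) xy0; rewrite !fctE /= /shift subrK opprD addrA.
rewrite -(deriveE _ df) (deriveEjacobian _ df) => h.
apply: le_trans (enorm_le_norm _) _; rewrite -ler_pdivlMl// mulrA [_^-1 * e]mulrC.
by apply: le_trans h _; rewrite ler_wpM2l ?(ltW e1)// norm_le_enorm.
Qed.

Lemma is_derive_enorm n (f : R -> 'rV[R]_n) (t : R) (a : 'rV[R]_n) :
  is_derive t 1 f a <->
  forall e : R, 0 < e -> \forall s \near t, enorm (f s - f t - (s - t) *: a) <= e * `|s - t|.
Proof.
split => [fa e e0|h].
  have e1 : 0 < e / n.+1%:R by rewrite divr_gt0.
  have := (proj1 (is_derive_nearP _ _ _) fa) _ e1; apply: filterS => s fs.
  apply: le_trans (enorm_le_norm _) _; rewrite -ler_pdivlMl// mulrA [_^-1 * e]mulrC.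
  exact: fs.
apply/is_derive_nearP => e e0; apply: filterS (h e e0) => s.
exact/le_trans/norm_le_enorm.
Qed.

(** The mean value inequality: apply the scalar theorem to the component of the
    curve along its own increment. *)
Lemma mean_value n (f df : R -> 'rV[R]_n) (m : R) :
  (forall t : R, 0 <= t <= 1 -> is_derive t 1 f (df t)) ->
  (forall t, 0 <= t <= 1 -> enorm (df t) <= m) ->
  enorm (f 1 - f 0) <= m.
Proof.
move=> fd dm; set v := f 1 - f 0.
have [->|v0] := eqVneq v 0.
  by rewrite enorm0; apply: le_trans (enorm_ge0 _) (dm 0 _); rewrite lexx ler01.
have ev : 0 < enorm v by rewrite enorm_gt0.
pose u t := dotp (f t) v.
have ud (t : R) : 0 <= t <= 1 -> is_derive t 1 u (dotp (df t) v).
  move=> t01; apply/is_derive_nearP => e e0.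
  have e1 : 0 < e / enorm v by rewrite divr_gt0.
  have := (proj1 (is_derive_enorm _ _ _) (fd _ t01)) _ e1.
  apply: filterS => s h.
  have -> : u s - u t - (s - t) *: dotp (df t) v = dotp (f s - f t - (s - t) *: df t) v.
    by rewrite !dotpBl dotpZl.
  apply: le_trans (dotp_le _ _) _; rewrite -ler_pdivlMr//.
  by rewrite mulrAC.
have cu : {within `[0, 1], continuous u}.
  apply: continuous_in_subspaceT => t; rewrite inE/= in_itv/= => /ud ut.
  apply: differentiable_continuous; apply/derivable1_diffP; exact: ex_derive.
have du (t : R) : t \in `]0, 1[ -> is_derive t 1 u (dotp (df t) v).
  by rewrite in_itv/= => /andP[t0 t1]; apply: ud; rewrite !ltW.
have [c c01 uc] := MVT_segment (@ler01 R) du cu.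
have h : enorm v * enorm v = dotp (df c) v.
  by rewrite -expr2 enorm_sqr {1}/v dotpBl -/(u 1) -/(u 0) uc subr0 mulr1.
rewrite -(ler_pM2r ev) h; apply: le_trans (dotp_le_enorm _ _) _.
by rewrite ler_wpM2r ?enorm_ge0// dm//; move: c01; rewrite in_itv/=.
Qed.

Definition bilinear_map d n (Q : 'rV[R]_d -> 'rV[R]_d -> 'rV[R]_n) : Prop :=
  (forall k w w' z, Q (k *: w + w') z = k *: Q w z + Q w' z) /\
  (forall k w z z', Q w (k *: z + z') = k *: Q w z + Q w z').

Section bilinear.
Context (d n : nat) (Q : 'rV[R]_d -> 'rV[R]_d -> 'rV[R]_n).
Hypothesis QL : bilinear_map Q.

Lemma bilinear0l z : Q 0 z = 0.
Proof.
by have [h _] := QL; have := h (-1) 0 0 z; rewrite scaler0 addr0 scaleN1r addNr.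
Qed.

Lemma bilinear0r w : Q w 0 = 0.
Proof.
by have [_ h] := QL; have := h (-1) w 0 0; rewrite scaler0 addr0 scaleN1r addNr.
Qed.

Lemma bilinearZl k w z : Q (k *: w) z = k *: Q w z.
Proof. by have [h _] := QL; rewrite -[k *: w]addr0 h bilinear0l addr0. Qed.

Lemma bilinearZr k w z : Q w (k *: z) = k *: Q w z.
Proof. by have [_ h] := QL; rewrite -[k *: z]addr0 h bilinear0r addr0. Qed.

Lemma bilinearDl w w' z : Q (w + w') z = Q w z + Q w' z.
Proof. by have [h _] := QL; rewrite -[w]scale1r h !scale1r. Qed.

Lemma bilinearDr w z z' : Q w (z + z') = Q w z + Q w z'.
Proof. by have [_ h] := QL; rewrite -[z]scale1r h !scale1r. Qed.

Lemma bilinear_suml (I : Type) (s : seq I) (F : I -> 'rV[R]_d) z :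
  Q (\sum_(i <- s) F i) z = \sum_(i <- s) Q (F i) z.
Proof.
by elim: s => [|i s IH]; rewrite ?(big_nil, big_cons) ?bilinear0l// bilinearDl IH.
Qed.

Lemma bilinear_sumr (I : Type) (s : seq I) (F : I -> 'rV[R]_d) w :
  Q w (\sum_(i <- s) F i) = \sum_(i <- s) Q w (F i).
Proof.
by elim: s => [|i s IH]; rewrite ?(big_nil, big_cons) ?bilinear0r// bilinearDr IH.
Qed.

Lemma bilinearE w z : Q w z = \sum_i \sum_j
  (w 0 i * z 0 j) *: Q (delta_mx 0 i) (delta_mx 0 j).
Proof.
rewrite {1}(row_sum_delta w) {1}(row_sum_delta z) bilinear_suml; apply: eq_bigr => i _.
rewrite bilinear_sumr; apply: eq_bigr => j _.
by rewrite bilinearZl bilinearZr scalerA.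
Qed.

Lemma enorm_sum (I : Type) (s : seq I) m (F : I -> 'rV[R]_m) :
  enorm (\sum_(i <- s) F i) <= \sum_(i <- s) enorm (F i).
Proof.
elim: s => [|i s IH]; first by rewrite !big_nil enorm0.
by rewrite !big_cons; apply: le_trans (enormD _ _) _; rewrite lerD2l.
Qed.

Lemma bilinear_bound : exists2 L, 0 <= L &
  forall w z, enorm (Q w z) <= L * enorm w * enorm z.
Proof.
exists (\sum_i \sum_j enorm (Q (delta_mx 0 i) (delta_mx 0 j))).
  by apply: sumr_ge0 => i _; apply: sumr_ge0 => j _; exact: enorm_ge0.
move=> w z; rewrite {1}bilinearE; apply: le_trans (enorm_sum _ _) _.
rewrite !mulr_suml; apply: ler_sum => i _; apply: le_trans (enorm_sum _ _) _.
rewrite !mulr_suml; apply: ler_sum => j _; rewrite enormZ normrM.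
rewrite mulrC -mulrA ler_wpM2l ?enorm_ge0//.
by apply: ler_pM => //; exact: coord_enorm.
Qed.

End bilinear.
End differentiability.

Lemma near_line (R : realType) d (z w : 'rV[R]_d) (t : R) (P : 'rV[R]_d -> Prop) :
  (\forall y \near z, P y) -> \forall s \near t, P (z + (s - t) *: w).
Proof.
move=> H; have r : (fun s : R => z + (s - t) *: w) @ nbhs t --> nbhs z.
  have ct : (fun s : R => z + (s - t) *: w) @ nbhs t --> z + (t - t) *: w.
    apply: (@cvgD R _ _ (nbhs t) _ (fun=> z) (fun s : R => (s - t) *: w)); first exact: cvg_cst.
    apply: (@cvgZr_tmp R _ _ (nbhs t) _ (fun s => s - t) (t - t) w).
    by apply: cvgB; [exact: cvg_id|exact: cvg_cst].
  by move: ct; rewrite subrr scale0r addr0.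
exact: (r _ H).
Qed.

(** A C^1 chart of [M] with Jacobian [J] and inverse [psi]; the differentiability
    conditions are stated as the estimates they are used through. *)
Record chart (R : realType) n d (M U : set 'rV[R]_n) (V : set 'rV[R]_d)
    (phi : 'rV[R]_d -> 'rV[R]_n) (J : 'rV[R]_d -> 'M[R]_(d, n))
    (psi : 'rV[R]_n -> 'rV[R]_d) : Prop := Chart {
  chart_openU : open U;
  chart_openV : open V;
  chart_image : phi @` V = M `&` U;
  chart_psi : {within M `&` U, continuous psi};
  chart_inv : forall z, V z -> psi (phi z) = z;
  chart_free : forall z, V z -> row_free (J z);
  chart_diff : forall z, V z -> forall e, 0 < e -> \forall y \near z,
    enorm (phi y - phi z - (y - z) *m J z) <= e * enorm (y - z);
  chart_C1 : forall z, V z -> forall e, 0 < e -> \forall y \near z,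
    forall w, enorm (w *m J y - w *m J z) <= e * enorm w }.

Section charts.
Context (R : realType) (n d : nat).

Lemma C2_chart (M : set 'rV[R]_n) : C2_submanifold d M -> forall p, M p ->
  exists U V phi J psi z0 Q, [/\ chart M U V phi J psi, V z0, phi z0 = p,
    bilinear_map Q &
    forall e, 0 < e -> \forall y \near z0, forall w : 'rV[R]_d,
      enorm (w *m J y - w *m J z0 - Q w (y - z0)) <= e * enorm w * enorm (y - z0)].
Proof.
move=> C2M p Mp.
have [U [V [phi [psi [[oU Up] oV [[C1 C2] imm] im [cpsi inv]]]]]] := C2M _ Mp.
have [z0 Vz0 phiz0] : (phi @` V) p by rewrite im.
pose J := jacobian phi.
pose Q (w z : 'rV[R]_d) : 'rV[R]_n :=
  \sum_i w 0 i *: (z *m jacobian ('D_(delta_mx 0 i) phi) z0).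
have wJ y w : V y -> w *m J y = \sum_i w 0 i *: 'D_(delta_mx 0 i) phi y.
  move=> Vy; have [dphi _] := C1 _ Vy.
  rewrite {1}(row_sum_delta w) mulmx_suml; apply: eq_bigr => i _.
  by rewrite -scalemxAl (deriveEjacobian _ dphi).
have nV z : V z -> \forall y \near z, V y.
  by move=> Vz; exact: open_nbhs_nbhs.
have coordw (w : 'rV[R]_d) (F : 'I_d -> 'rV[R]_n) (e : R) : 0 <= e ->
    (forall i, enorm (F i) <= e / d.+1%:R) ->
    enorm (\sum_i w 0 i *: F i) <= e * enorm w.
  move=> e0 Fe; apply: le_trans (enorm_sum _ _) _.
  apply: (@le_trans _ _ (\sum_(i < d) enorm w * (e / d.+1%:R))).
    apply: ler_sum => i _; rewrite enormZ; apply: ler_pM => //; first exact: enorm_ge0.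
    exact: coord_enorm.
  rewrite sumr_const card_ord -mulrnAr mulrC ler_wpM2r ?enorm_ge0//.
  rewrite -mulr_natr -mulrA -[leRHS]mulr1 ler_wpM2l// mulrC ler_pdivrMr// mul1r ler_nat.
  exact: leqnSn.
have wJB y z (w : 'rV[R]_d) : V y -> V z -> w *m J y - w *m J z =
    \sum_i w 0 i *: ('D_(delta_mx 0 i) phi y - 'D_(delta_mx 0 i) phi z).
  move=> Vy Vz; transitivity (\sum_i (w 0 i *: 'D_(delta_mx 0 i) phi y -
      w 0 i *: 'D_(delta_mx 0 i) phi z)).
    by rewrite sumrB; congr (_ - _); exact: wJ.
  by apply: eq_bigr => i _; exact/esym/scalerBr.
exists U, V, phi, J, psi, z0, Q; split => //.
- split => //.
  + move=> z Vz; apply: inj_row_free => w wJ0; apply: (imm z) => //.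
    by have [dphi _] := C1 _ Vz; rewrite (deriveEjacobian _ dphi).
  + by move=> z Vz; have [dphi _] := C1 _ Vz; exact: differentiable_near.
  + move=> z Vz e e0.
    have e1 : 0 < e / d.+1%:R / n.+1%:R by rewrite !divr_gt0.
    have H (i : 'I_d) : \forall y \near z,
        `|'D_(delta_mx 0 i) phi z - 'D_(delta_mx 0 i) phi y| <= e / d.+1%:R / n.+1%:R.
      have [_ /(_ (delta_mx 0 i)) cD] := C1 _ Vz.
      exact: (@cvgr_dist_le _ _ _ (nbhs z) _ ('D_(delta_mx 0 i) phi) _ cD _ e1).
    apply: filterS2 (nV _ Vz) (filter_forall _ H) => y Vy h w.
    rewrite (wJB y z w Vy Vz).
    apply: (coordw w (fun i => 'D_(delta_mx 0 i) phi y - 'D_(delta_mx 0 i) phi z)).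
      exact: ltW.
    move=> i; rewrite enormBC; apply: le_trans (enorm_le_norm _) _.
    by rewrite mulrC -ler_pdivlMr//; exact: (h i).
- split => [k w w' z|k w z z']; rewrite /Q.
    rewrite scaler_sumr -big_split/=; apply: eq_bigr => i _.
    by rewrite !mxE scalerDl scalerA.
  rewrite scaler_sumr -big_split/=; apply: eq_bigr => i _.
  by rewrite mulmxDl scalerDr -scalemxAl !scalerA mulrC.
- move=> e e0; have e1 : 0 < e / d.+1%:R by rewrite divr_gt0.
  have H (i : 'I_d) := differentiable_near (C2 (delta_mx 0 i) _ Vz0).1 e1.
  apply: filterS2 (nV _ Vz0) (filter_forall _ H) => y Vy h w.
  rewrite (wJB y z0 w Vy Vz0) /Q -sumrB.
  pose F i := 'D_(delta_mx 0 i) phi y - 'D_(delta_mx 0 i) phi z0 -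
    (y - z0) *m jacobian ('D_(delta_mx 0 i) phi) z0.
  rewrite (eq_bigr (fun i => w 0 i *: F i)); last first.
    by move=> i _; exact/esym/scalerBr.
  rewrite mulrAC; apply: (coordw w F).
    by rewrite mulr_ge0 ?enorm_ge0// ltW.
  by move=> i; rewrite mulrAC; exact: (h i).
Qed.

Lemma chart_line_derive (M U : set 'rV[R]_n) V phi J psi z w (t : R) :
  @chart R n d M U V phi J psi -> V (z + t *: w) ->
  is_derive t 1 (fun s => phi (z + s *: w)) (w *m J (z + t *: w)).
Proof.
move=> ch Vt; apply/is_derive_enorm => e e0.
have e1 : 0 < e / (enorm w + 1) by rewrite divr_gt0// ltr_wpDl// enorm_ge0.
apply: filterS (near_line w t (chart_diff ch Vt e1)) => s.
have -> : z + t *: w + (s - t) *: w = z + s *: w by rewrite -addrA -scalerDl (addrC t) subrK.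
have -> : z + s *: w - (z + t *: w) = (s - t) *: w.
  by rewrite opprD addrACA subrr add0r -scalerBl.
rewrite -scalemxAl enormZ => /le_trans; apply.
rewrite [`|s - t| * _]mulrC mulrA ler_wpM2r// mulrAC ler_pdivrMr ?ltr_wpDl ?enorm_ge0//.
by rewrite ler_pM2l// lerDl.
Qed.

(** Velocities of curves of [M] through a point of the chart are velocities of
    curves in the chart: the coordinates of the curve are Lipschitz because the
    Jacobian is injective, and its image is closed. *)
Lemma chart_tangent_space (M U : set 'rV[R]_n) V phi J psi z :
  @chart R n d M U V phi J psi -> V z ->
  tangent_space M (phi z) = row_space (J z).
Proof.
move=> ch Vz; have fJ := chart_free ch Vz.
have JP := row_space_has_proj fJ.
have phiMU y : V y -> M (phi y) /\ U (phi y).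
  by move=> Vy; rewrite -[_ /\ _]/((M `&` U) (phi y)) -(chart_image ch); exists y.
have MUphi y : M y -> U y -> V (psi y) /\ phi (psi y) = y.
  move=> My Uy; have [v Vv <-] : (phi @` V) y by rewrite (chart_image ch).
  by rewrite (chart_inv ch).
have [Mz Uz] := phiMU _ Vz.
apply/seteqP; split => [u [gam [gM gam0 dgam]]|_ [w ->]]; last first.
  exists (fun t => phi (z + t *: w)); split; last 1 first.
  - have Vz0 : V (z + 0 *: w) by rewrite scale0r addr0.
    by have := chart_line_derive ch Vz0; rewrite scale0r addr0.
  - have nV : \forall y \near z, V y by apply: open_nbhs_nbhs; split; [exact: (chart_openV ch)|].
    by apply: filterS (near_line w 0 nV) => t; rewrite subr0 => /phiMU[].
  - by rewrite scale0r addr0.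
pose k := (d.+1 * n)%:R * `|(J z)^T *m invmx (J z *m (J z)^T)| + 1.
have k0 : 0 < k by rewrite ltr_wpDl// mulr_ge0.
have Jk (w : 'rV[R]_d) : enorm w <= k * enorm (w *m J z).
  have {1}-> : w = (w *m J z) *m ((J z)^T *m invmx (J z *m (J z)^T)).
    by rewrite -mulmxA [X in _ *m X]mulmxA mulmxV ?mulmx1// gram_unit.
  apply: le_trans (enorm_mulmx _ _) _; rewrite ler_wpM2r ?enorm_ge0//.
  by rewrite /k lerDl.
apply: (perp_eq0 JP); apply: enorm0_eq0; apply/eqP.
rewrite eq_le enorm_ge0 andbT; apply/ler_addgt0Pr => a a0; rewrite add0r.
pose b := 2 * k * (enorm u + 1) + 1.
have b0 : 0 < b by rewrite ltr_wpDl// !mulr_ge0 ?addr_ge0 ?enorm_ge0// ltW.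
pose e := Num.min (a / b) ((2 * k)^-1).
have e0 : 0 < e by rewrite lt_min divr_gt0//= invr_gt0 mulr_gt0.
have ea : e * b <= a by rewrite -ler_pdivlMr// ge_min lexx.
have ek : e * k <= 2^-1.
  by rewrite -ler_pdivlMr// -invfM ge_min lexx orbT.
have D1 := (proj1 (is_derive_enorm _ _ _) dgam) _ e0.
have D2 := (proj1 (is_derive_enorm _ _ _) dgam) _ (@ltr01 R).
have cgam : {for 0, continuous gam}.
  by apply: differentiable_continuous; apply/derivable1_diffP; exact: ex_derive.
have nU : \forall t \near (0 : R), U (gam t).
  apply: cgam; rewrite gam0; apply: open_nbhs_nbhs; split => //; exact: (chart_openU ch).
have nc : \forall t \near (0 : R), M (gam t) /\ U (gam t) ->
    enorm (phi (psi (gam t)) - phi z - (psi (gam t) - z) *m J z) <= e * enorm (psi (gam t) - z).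
  move: (chart_psi ch) => /subspace_continuousP/(_ (phi z) (conj Mz Uz)) cpsi.
  have := chart_diff ch Vz e0; rewrite -{1}(chart_inv ch Vz) => /cpsi.
  by rewrite -gam0 => /cgam.
have : \forall t \near (0 : R), enorm (perp (proj (row_space (J z))) (t *: u)) <= e * b * `|t|.
  near=> t.
  have [Mt Ut] : M (gam t) /\ U (gam t) by split; near: t.
  have [Vc phic] := MUphi _ Mt Ut.
  have h0 : M (gam t) /\ U (gam t) ->
    enorm (phi (psi (gam t)) - phi z - (psi (gam t) - z) *m J z) <= e * enorm (psi (gam t) - z).
    by near: t.
  have h := h0 (conj Mt Ut); rewrite phic in h; clear h0.
  set c := psi (gam t) - z in h *.
  have h1 : enorm (gam t - gam 0 - (t - 0) *: u) <= e * `|t - 0| by near: t.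
  have h2 : enorm (gam t - gam 0 - (t - 0) *: u) <= 1 * `|t - 0| by near: t.
  rewrite !subr0 in h1 h2; rewrite -gam0 in h.
  set g := gam t - gam 0 in h h1 h2.
  have gu : enorm g <= (enorm u + 1) * `|t|.
    rewrite -(subrK (t *: u) g); apply: le_trans (enormD _ _) _.
    by rewrite enormZ addrC mulrDl [enorm u * _]mulrC lerD2l.
  have cg : enorm c <= 2 * k * enorm g.
    have h3 : enorm (c *m J z) <= enorm g + e * enorm c.
      rewrite -(subrK g (c *m J z)) addrC; apply: le_trans (enormD _ _) _.
      by rewrite lerD2l enormBC.
    have h4 : enorm c <= k * enorm g + 2^-1 * enorm c.
      apply: le_trans (Jk c) _; apply: le_trans (ler_wpM2l (ltW k0) h3) _.
      by rewrite mulrDr lerD2l mulrA [k * e]mulrC ler_wpM2r// enorm_ge0.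
    by rewrite -mulrA; lra.
  have -> : t *: u = g - (g - t *: u) by rewrite opprB addrC subrK.
  rewrite (perpB JP); apply: le_trans (enormB _ _) _.
  have h5 : enorm (perp (proj (row_space (J z))) g) <= e * enorm c.
    by apply: le_trans (perp_le_dist JP _ _) h; exists c.
  have h6 := le_trans (enorm_perp JP (g - t *: u)) h1.
  apply: le_trans (lerD h5 h6) _.
  rewrite -mulrA -mulrDr ler_wpM2l ?(ltW e0)// /b mulrDl mul1r lerD2r.
  apply: le_trans cg _; rewrite -!mulrA ler_pM2l// ler_pM2l//.
move=> /nbhs_ballP[r /= r0 rP].
have r2 : 0 < r / 2 by rewrite divr_gt0.
have r2r : ball (0 : R) r (r / 2).
  by rewrite -ball_normE /= sub0r normrN gtr0_norm// ltr_pdivrMr// ltr_pMr// ltr1n.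
have := rP (r / 2) r2r; rewrite (perpZ JP) enormZ gtr0_norm// [leRHS]mulrC.
by rewrite ler_pM2l// => /le_trans; apply.
Unshelve. all: by end_near. Qed.

End charts.

(** * Charts adapted to the tangent space *)

Lemma near_edisc (R : realType) d (P : 'rV[R]_d -> Prop) :
  (\forall y \near (0 : 'rV[R]_d), P y) -> exists2 r : R, 0 < r &
  forall y, enorm y <= r -> P y.
Proof.
move=> /nbhs_ballP[r /= r0 rP]; exists (r / 2); first by rewrite divr_gt0.
move=> y yr; apply: rP; rewrite -ball_normE /= sub0r normrN.
apply: le_lt_trans (norm_le_enorm _) _; apply: le_lt_trans yr _.
by rewrite ltr_pdivrMr// ltr_pMr// ltr1n.
Qed.

Lemma is_derive_quadratic (R : realType) n (a b : 'rV[R]_n) (t : R) :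
  is_derive t 1 (fun s => s *: a + s ^+ 2 *: b) (a + (2 * t) *: b).
Proof.
apply/is_derive_enorm => e e0.
have b0 : 0 < enorm b + 1 by rewrite ltr_wpDl// enorm_ge0.
have e1 : 0 < e / (enorm b + 1) by rewrite divr_gt0.
apply: filterS (nbhsx_ballx t _ e1) => s; rewrite -ball_normE /= distrC => st.
have -> : s *: a + s ^+ 2 *: b - (t *: a + t ^+ 2 *: b) - (s - t) *: (a + (2 * t) *: b) =
    (s - t) ^+ 2 *: b.
  by apply/rowP => i; rewrite !mxE; ring.
rewrite enormZ normrX expr2 mulrAC ler_wpM2r// ltW//.
apply: le_lt_trans (_ : `|s - t| * (enorm b + 1) < e); last by rewrite -ltr_pdivlMr.
by rewrite ler_wpM2l// lerDl.
Qed.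

HB.instance Definition _ (R : realType) (d : nat) := Complete.on 'rV[R]_d.

Lemma expr1D_le (R : realType) (a : R) m : 0 <= a -> a <= 1 ->
  (1 + a) ^+ m <= 1 + (2 ^+ m - 1) * a.
Proof.
move=> a0 a1; elim: m => [|m IH]; first by rewrite !expr0 subrr mul0r addr0.
rewrite exprS; apply: (@le_trans _ _ ((1 + a) * (1 + (2 ^+ m - 1) * a))).
  by rewrite ler_wpM2l// addr_ge0.
have : (1 : R) <= 2 ^+ m by rewrite exprn_ege1// ler1n.
rewrite exprS; move: (2 ^+ m) => c c1.
have : 0 <= (c - 1) * (a * (1 - a)) by rewrite !mulr_ge0 ?subr_ge0.
lra.
Qed.

(** [M] is near the origin the graph of a function over the disc of radius [r]
    of its tangent space, in coordinates [E]: [phi (g x)] is the point above [x].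
    The increments of [phi \o g] are isometric up to a second order error,
    because those of its normal part are of second order. *)
Record graph_chart (R : realType) n d (M : set 'rV[R]_n) (V : set 'rV[R]_d)
    (phi : 'rV[R]_d -> 'rV[R]_n) (J : 'rV[R]_d -> 'M[R]_(d, n)) (E : 'M[R]_(d, n))
    (r C delta : R) (g : 'rV[R]_d -> 'rV[R]_d) : Prop := GraphChart {
  graph_in : forall x, enorm x <= r -> V (g x);
  graph_coord : forall x, enorm x <= r -> phi (g x) *m E^T = x;
  graph_id : forall x, enorm x <= r -> enorm (g x - x) <= C * enorm x ^+ 2;
  graph_jacobian : forall x, enorm x <= r -> forall w,
    enorm (w *m J (g x) - w *m E) <= C * enorm x * enorm w;
  graph_jacobian_half : forall x, enorm x <= r -> forall w,
    enorm (w *m J (g x) - w *m E) <= 2^-1 * enorm w;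
  graph_lipschitz : forall x x', enorm x <= r -> enorm x' <= r ->
    enorm (g x - g x') <= 2 * enorm (x - x');
  graph_area : forall s x x', s <= r -> enorm x <= s -> enorm x' <= s ->
    enorm (phi (g x) - phi (g x')) <= (1 + C * s ^+ 2) * enorm (x - x');
  graph_cover : forall y, M y -> enorm y <= delta ->
    enorm (y *m E^T) <= r /\ phi (g (y *m E^T)) = y }.

Section normal_chart.
Context (R : realType) (n d : nat).
Variables (M U : set 'rV[R]_n) (V : set 'rV[R]_d) (phi : 'rV[R]_d -> 'rV[R]_n)
  (J : 'rV[R]_d -> 'M[R]_(d, n)) (psi : 'rV[R]_n -> 'rV[R]_d)
  (E : 'M[R]_(d, n)) (Q : 'rV[R]_d -> 'rV[R]_d -> 'rV[R]_n).
Hypotheses (ch : chart M U V phi J psi) (V0 : V 0) (phi0 : phi 0 = 0)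
  (J0 : J 0 = E) (EE : E *m E^T = 1%:M) (QL : bilinear_map Q).
Hypothesis JQ : forall e, 0 < e -> \forall y \near (0 : 'rV[R]_d), forall w : 'rV[R]_d,
  enorm (w *m J y - w *m E - Q w y) <= e * enorm w * enorm y.

Let T := proj (row_space E).
Let TP : has_proj (row_space E).
Proof. exact/row_space_has_proj/orthonormal_free. Qed.

(** Coordinates on the tangent space at the origin. *)
Let p (y : 'rV[R]_n) : 'rV[R]_d := y *m E^T.

Let TE y : T y = p y *m E. Proof. exact: proj_orthonormal. Qed.

Let pE w : p (w *m E) = w. Proof. by rewrite /p -mulmxA EE mulmx1. Qed.

Let pB y z : p (y - z) = p y - p z. Proof. exact: mulmxBl. Qed.

Lemma enorm_coordinates y : enorm (p y) <= enorm y.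
Proof. by rewrite -(enorm_isometry _ EE) -TE enorm_proj. Qed.

Lemma normal_jacobian : exists2 r, 0 < r & exists2 C, 0 < C &
  forall z, enorm z <= r -> V z /\ forall w, enorm (w *m J z - w *m E) <= C * enorm z * enorm w.
Proof.
have nV : \forall y \near (0 : 'rV[R]_d), V y.
  by apply: open_nbhs_nbhs; split => //; exact: (chart_openV ch).
have [r1 r10 r1P] := near_edisc nV.
have [r2 r20 r2P] := near_edisc (JQ ltr01).
have [L L0 LQ] := bilinear_bound QL.
exists (Num.min r1 r2); first by rewrite lt_min r10 r20.
exists (1 + L); first by rewrite ltr_pwDl.
move=> z; rewrite le_min => /andP[z1 z2]; split; first exact: r1P.
move=> w; rewrite -(subrK (Q w z) (w *m J z - w *m E)).
apply: le_trans (enormD _ _) _; rewrite !mulrDl mul1r; apply: lerD.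
  by have := r2P _ z2 w; rewrite mul1r mulrC.
by have := LQ w z; rewrite mulrAC.
Qed.

(** The mean value inequality for the chart minus its linear part, along the segment
    from [z'] to [z]. *)
Lemma normal_increment (r C : R) : 0 <= C ->
  (forall z, enorm z <= r -> V z /\
    forall w, enorm (w *m J z - w *m E) <= C * enorm z * enorm w) ->
  forall s z z', s <= r -> enorm z <= s -> enorm z' <= s ->
  enorm (phi z - phi z' - (z - z') *m E) <= C * s * enorm (z - z').
Proof.
move=> C0 rP s z z' sr zs z's.
pose h := z - z'; pose c (t : R) := z' + t *: h.
have cs t : 0 <= t <= 1 -> enorm (c t) <= s.
  move=> /andP[t0 t1]; have -> : c t = (1 - t) *: z' + t *: z.
    by rewrite /c /h; apply/rowP => i; rewrite !mxE; ring.
  apply: le_trans (enormD _ _) _; rewrite !enormZ !ger0_norm ?subr_ge0//.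
  have h1 : (1 - t) * enorm z' <= (1 - t) * s by rewrite ler_wpM2l// subr_ge0.
  have h2 : t * enorm z <= t * s by rewrite ler_wpM2l.
  by apply: le_trans (lerD h1 h2) _; rewrite -mulrDl subrK mul1r.
have cP t : 0 <= t <= 1 -> V (c t) /\
    forall w, enorm (w *m J (c t) - w *m E) <= C * enorm (c t) * enorm w.
  by move=> /cs ct; apply: rP; exact: le_trans sr.
pose f (t : R) := phi (c t) - (t *: (h *m E) + t ^+ 2 *: 0).
have fd (t : R) : 0 <= t <= 1 -> is_derive t 1 f (h *m J (c t) - (h *m E + (2 * t) *: 0)).
  move=> /cP[Vt _]; apply: is_deriveB; [exact: (chart_line_derive ch)|exact: is_derive_quadratic].
have f10 : f 1 - f 0 = phi z - phi z' - (z - z') *m E.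
  rewrite /f /c scale1r !scale0r !scaler0 !addr0 scale1r subr0.
  by rewrite /h [z' + _]addrC subrK addrAC.
rewrite -f10; apply: (mean_value fd) => t t01; rewrite scaler0 addr0.
apply: le_trans ((cP _ t01).2 h) _; rewrite ler_wpM2r ?enorm_ge0// ler_wpM2l//.
exact: cs.
Qed.

(** The mean value inequality for the chart minus its expansion, along the segment
    from the origin to [z]. *)
Lemma normal_taylor e : 0 < e -> exists2 r, 0 < r & forall z, enorm z <= r ->
  enorm (phi z - z *m E - 2^-1 *: Q z z) <= e * enorm z ^+ 2.
Proof.
move=> e0; have nV : \forall y \near (0 : 'rV[R]_d), V y.
  by apply: open_nbhs_nbhs; split => //; exact: (chart_openV ch).
have [r1 r10 r1P] := near_edisc nV.
have [r2 r20 r2P] := near_edisc (JQ e0).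
exists (Num.min r1 r2); first by rewrite lt_min r10 r20.
move=> z; rewrite le_min => /andP[z1 z2].
have tz t : 0 <= t <= 1 -> enorm (t *: z) <= enorm z.
  by move=> /andP[t0 t1]; rewrite enormZ ger0_norm// ler_piMl// enorm_ge0.
pose f (t : R) := phi (0 + t *: z) - (t *: (z *m E) + t ^+ 2 *: (2^-1 *: Q z z)).
have fd (t : R) : 0 <= t <= 1 -> is_derive t 1 f
    (z *m J (0 + t *: z) - (z *m E + (2 * t) *: (2^-1 *: Q z z))).
  move=> t01; apply: is_deriveB; last exact: is_derive_quadratic.
  apply: (chart_line_derive ch); rewrite add0r; apply: r1P.
  exact: le_trans (tz _ t01) z1.
have f10 : f 1 - f 0 = phi z - z *m E - 2^-1 *: Q z z.
  rewrite /f !add0r scale1r scale0r phi0 !expr1n expr0n !scale1r !scale0r addr0.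
  by rewrite !subr0 opprD addrA.
rewrite -f10; apply: (mean_value fd) => t t01; rewrite add0r.
have -> : (2 * t) *: (2^-1 *: Q z z) = Q z (t *: z).
  by rewrite (bilinearZr QL) scalerA mulrAC mulfV ?mul1r// pnatr_eq0.
rewrite opprD addrA; have := r2P (t *: z) (le_trans (tz _ t01) z2) z.
move=> /le_trans; apply; rewrite expr2 mulrA ler_wpM2l ?tz//.
by rewrite mulr_ge0 ?enorm_ge0// ltW.
Qed.

(** The tangential coordinates of the chart are a small Lipschitz perturbation
    of the identity, so they are inverted by the contraction principle. *)
Lemma normal_graph : exists r C delta g,
  [/\ 0 < r, 0 < C, 0 < delta & graph_chart M V phi J E r C delta g].
Proof.
have [r1 r10 [C1 C10 r1P]] := normal_jacobian.
pose K : R := d.+1%:R; have K1 : 1 <= K by rewrite ler1n.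
have K0 : 0 < K by exact: lt_le_trans K1.
pose r2 := Num.min r1 (4 * K * C1)^-1.
have r20 : 0 < r2 by rewrite lt_min r10 invr_gt0 !mulr_gt0.
have r21 : r2 <= r1 by rewrite ge_min lexx.
have CKr : C1 * r2 * K <= 4^-1.
  have h : r2 <= (4 * K * C1)^-1 by rewrite ge_min lexx orbT.
  have KC : 0 < 4 * K * C1 by rewrite !mulr_gt0.
  rewrite -(ler_pM2l KC) mulfV in h; last by rewrite gt_eqF.
  lra.
have Cr0 : 0 <= C1 * r2 by rewrite ltW// mulr_gt0.
have Cr : C1 * r2 <= 4^-1 by apply: le_trans CKr; rewrite ler_peMr.
have inc s z z' (sr : s <= r2) := @normal_increment r1 C1 (ltW C10) r1P s z z' (le_trans sr r21).
pose q z := p (phi z).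
have q0 : q 0 = 0 by rewrite /q phi0 /p mul0mx.
have qinc s z z' : s <= r2 -> enorm z <= s -> enorm z' <= s ->
    enorm (q z - q z' - (z - z')) <= C1 * s * enorm (z - z').
  move=> sr zs z's; apply: le_trans (inc s z z' sr zs z's).
  rewrite /q -[in X in enorm X](pE (z - z')) -!pB; exact: enorm_coordinates.
have q2 z z' : enorm z <= r2 -> enorm z' <= r2 -> enorm (z - z') <= 2 * enorm (q z - q z').
  move=> zr z'r; have h := qinc _ _ _ (lexx _) zr z'r.
  have h1 : C1 * r2 * enorm (z - z') <= 4^-1 * enorm (z - z') by rewrite ler_wpM2r// enorm_ge0.
  have := enorm_distD (q z - q z') (z - z') 0.
  rewrite !subr0 [enorm (z - z' - _)]enormBC; have := enorm_ge0 (q z - q z'); lra.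
have qsurj x : enorm x <= r2 / 2 -> exists z, enorm z <= r2 /\ q z = x.
  move=> xr; pose B := [set z : 'rV[R]_d | enorm z <= r2].
  pose f z := x - (q z - z).
  have fB : {homo f : z / B z >-> B z}.
    move=> z /= zr; rewrite /B/=; apply: le_trans (enormB _ _) _.
    have := qinc _ z 0 (lexx _) zr; rewrite enorm0 q0 !subr0 => /(_ (ltW r20)) h.
    have : C1 * r2 * enorm z <= 4^-1 * r2.
      by apply: ler_pM => //; exact: enorm_ge0.
    by lra.
  have ctr : is_contraction (mkfun_fun fB).
    have half0 : 0 <= (2^-1 : R) by [].
    exists (NngNum half0); split; first by rewrite /= invf_lt1// ltr1n.
    move=> [z z'] [/= zr z'r].
    have -> : f z - f z' = - (q z - q z' - (z - z')).
      by rewrite /f; apply/rowP => i; rewrite !mxE; ring.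
    rewrite normrN; apply: le_trans (norm_le_enorm _) _.
    apply: le_trans (qinc _ _ _ (lexx _) zr z'r) _.
    apply: (@le_trans _ _ (C1 * r2 * (K * `|z - z'|))).
      by rewrite ler_wpM2l// enorm_le_norm.
    rewrite mulrA ler_wpM2r//; apply: le_trans CKr _.
    by rewrite lef_pV2 ?posrE// ler_nat.
  have cB : closed B.
    rewrite (_ : B = @enorm R d @^-1` [set t | t <= r2])//.
    by apply: closed_comp; [move=> z _; exact: continuous_enorm|exact: closed_le].
  have B0 : B !=set0 by exists 0; rewrite /B/= enorm0 ltW.
  have [z Bz zf] := banach_fixed_point ctr cB B0.
  exists z; split => //; move: zf; rewrite /= /mkfun /f opprB addrA => /eqP.
  by rewrite eq_sym subr_eq addrC => /eqP/addrI.
pose g x := xget 0 [set z | enorm z <= r2 /\ q z = x].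
have gP x : enorm x <= r2 / 2 -> enorm (g x) <= r2 /\ q (g x) = x.
  move=> /qsurj; exact: (@xgetPex _ 0 [set z | enorm z <= r2 /\ q z = x]).
have gl x x' : enorm x <= r2 / 2 -> enorm x' <= r2 / 2 ->
    enorm (g x - g x') <= 2 * enorm (x - x').
  by move=> /gP[gx qx] /gP[gx' qx']; rewrite -{2}qx -{2}qx'; exact: q2.
have g2 x : enorm x <= r2 / 2 -> enorm (g x) <= 2 * enorm x.
  move=> /gP[gx qx]; have := q2 _ 0 gx; rewrite q0 !subr0 qx enorm0; apply; exact: ltW.
have nU : \forall y \near (0 : 'rV[R]_n), U y /\ (M y /\ U y -> enorm (psi y) <= r2).
  have MU0 : (M `&` U) 0 by rewrite -(chart_image ch); exists 0.
  have psi0 : psi 0 = 0 by rewrite -{1}phi0; exact: (chart_inv ch).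
  have U0 : \forall y \near (0 : 'rV[R]_n), U y.
    by apply: open_nbhs_nbhs; split; [exact: (chart_openU ch)|exact: MU0.2].
  have npsi : \forall y \near (0 : 'rV[R]_n), (M `&` U) y -> enorm (psi y) <= r2.
    have cp := proj1 (subspace_continuousP _ _) (chart_psi ch) 0 MU0.
    have nr : nbhs (psi 0) [set z | enorm z <= r2].
      rewrite psi0; have := near_enorm (0 : 'rV[R]_d) r20.
      by apply: filterS => y; rewrite sub0r enormN.
    exact: (cp _ nr).
  by apply: filterS2 U0 npsi.
have [d1 d10 d1P] := near_edisc nU.
exists (r2 / 2), (4 * C1 + 16 * C1 ^+ 2), (Num.min d1 (r2 / 2)), g.
have CC : 0 < C1 ^+ 2 by rewrite exprn_gt0.
split.
- by rewrite divr_gt0.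
- by rewrite addr_gt0// mulr_gt0.
- by rewrite lt_min d10 divr_gt0.
have gJ x w : enorm x <= r2 / 2 ->
    enorm (w *m J (g x) - w *m E) <= 2 * C1 * enorm x * enorm w.
  move=> xr; have [gr _] := gP _ xr; have [_ h] := r1P _ (le_trans gr r21).
  apply: le_trans (h w) _; rewrite ler_wpM2r ?enorm_ge0// [2 * C1]mulrC -mulrA.
  by rewrite ler_pM2l// g2.
split.
- by move=> x /gP[gr _]; exact: (r1P _ (le_trans gr r21)).1.
- by move=> x /gP[].
- move=> x xr; have [gr qx] := gP _ xr; have := qinc _ (g x) 0 gr (lexx _).
  rewrite enorm0 q0 !subr0 qx enormBC => /(_ (enorm_ge0 _)) h; apply: le_trans h _.
  have g2x := g2 _ xr; have e0 := enorm_ge0 x; have ge0 := enorm_ge0 (g x).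
  apply: (@le_trans _ _ (C1 * (4 * enorm x ^+ 2))); last by nra.
  rewrite -mulrA ler_pM2l// -expr2 (_ : 4 * enorm x ^+ 2 = (2 * enorm x) ^+ 2); last by ring.
  by rewrite lerXn2r// nnegrE// mulr_ge0.
- move=> x xr w; apply: le_trans (gJ _ _ xr) _; rewrite ler_wpM2r ?enorm_ge0//.
  have e0 := enorm_ge0 x; rewrite ler_wpM2r//.
  by have := ltW C10; nra.
- move=> x xr w; apply: le_trans (gJ _ _ xr) _; rewrite ler_wpM2r ?enorm_ge0//.
  apply: (@le_trans _ _ (2 * C1 * (r2 / 2))); first by rewrite ler_pM2l// mulr_gt0.
  rewrite (_ : _ * _ = C1 * r2); last by field.
  by apply: le_trans Cr _; rewrite lef_pV2 ?posrE// ler_nat.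
- exact: gl.
- move=> s x x' sr xs x's; have xr := le_trans xs sr; have x'r := le_trans x's sr.
  have [gx qx] := gP _ xr; have [gx' qx'] := gP _ x'r.
  have s0 : 0 <= s by apply: le_trans xs; exact: enorm_ge0.
  set D := phi (g x) - phi (g x').
  have pD : p D = x - x' by rewrite pB -/(q _) -/(q _) qx qx'.
  have TD : enorm (T D) = enorm (x - x') by rewrite TE pD enorm_isometry.
  have ND : enorm (perp T D) <= 4 * C1 * s * enorm (x - x').
    have sr2 : 2 * s <= r2 by rewrite mulrC -ler_pdivlMr.
    have h := inc (2 * s) (g x) (g x') sr2.
    have -> : perp T D = perp T (D - (g x - g x') *m E).
      have hE : row_space E ((g x - g x') *m E) by exists (g x - g x').
      by rewrite (perpB TP D) (perp_in TP hE) subr0.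
    apply: le_trans (enorm_perp TP _) _.
    apply: le_trans (h _ _) _.
    + by apply: le_trans (g2 _ xr) _; rewrite ler_pM2l.
    + by apply: le_trans (g2 _ x'r) _; rewrite ler_pM2l.
    rewrite (_ : 4 * C1 * s * _ = C1 * (2 * s) * (2 * enorm (x - x'))); last by ring.
    by rewrite ler_wpM2l ?gl// !mulr_ge0// ltW.
  rewrite -(ler_pXn2r (n := 2))// ?nnegrE ?mulr_ge0 ?enorm_ge0 ?addr_ge0 ?exprn_ge0 ?(ltW C10)//; last first.
    by rewrite mulr_ge0 ?exprn_ge0// addr_ge0// mulr_ge0// ltW.
  rewrite (proj_pythagoras TP D) TD exprMn.
  have ND2 : enorm (perp T D) ^+ 2 <= 16 * C1 ^+ 2 * s ^+ 2 * enorm (x - x') ^+ 2.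
    rewrite (_ : 16 * _ * _ * _ = (4 * C1 * s * enorm (x - x')) ^+ 2); last by ring.
    by rewrite lerXn2r// nnegrE ?enorm_ge0// !mulr_ge0 ?enorm_ge0// ltW.
  apply: le_trans (lerD (lexx _) ND2) _.
  rewrite -[X in X + _]mul1r -mulrDl ler_wpM2r ?exprn_ge0 ?enorm_ge0//.
  have : 0 <= C1 * s ^+ 2 by rewrite mulr_ge0 ?exprn_ge0// ltW.
  have : 0 <= C1 ^+ 2 * s ^+ 2 by rewrite mulr_ge0 ?exprn_ge0// ltW.
  rewrite mulrDl -!mulrA; move: (C1 * s ^+ 2) (C1 ^+ 2 * s ^+ 2) => a b; nra.
- move=> y My; rewrite le_min => /andP[yd yr].
  have pyr : enorm (p y) <= r2 / 2 by apply: le_trans (enorm_coordinates y) yr.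
  split => //; have [Uy /(_ (conj My Uy)) psir] := d1P _ yd.
  have [z Vz zy] : (phi @` V) y by rewrite (chart_image ch).
  have psiz : psi y = z by rewrite -zy (chart_inv ch).
  rewrite psiz in psir; have [gr qg] := gP _ pyr.
  have : enorm (g (p y) - z) <= 0.
    by apply: le_trans (q2 _ _ gr psir) _; rewrite qg /q zy subrr enorm0 mulr0.
  rewrite le_eqVlt ltNge enorm_ge0 orbF => /eqP/enorm0_eq0/eqP.
  by rewrite subr_eq0 => /eqP ->.
Qed.

End normal_chart.

(** * Tangent planes of a graph *)

Section graph_planes.
Context (R : realType) (n d : nat).
Variables (M U : set 'rV[R]_n) (V : set 'rV[R]_d) (phi : 'rV[R]_d -> 'rV[R]_n)
  (J : 'rV[R]_d -> 'M[R]_(d, n)) (psi : 'rV[R]_n -> 'rV[R]_d)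
  (E : 'M[R]_(d, n)) (Q : 'rV[R]_d -> 'rV[R]_d -> 'rV[R]_n).
Hypotheses (ch : chart M U V phi J psi) (V0 : V 0) (phi0 : phi 0 = 0)
  (J0 : J 0 = E) (EE : E *m E^T = 1%:M) (QL : bilinear_map Q).
Hypothesis JQ : forall e, 0 < e -> \forall y \near (0 : 'rV[R]_d), forall w : 'rV[R]_d,
  enorm (w *m J y - w *m E - Q w y) <= e * enorm w * enorm y.
Variables (r C delta : R) (g : 'rV[R]_d -> 'rV[R]_d).
Hypotheses (r_gt0 : 0 < r) (C_gt0 : 0 < C) (gr : graph_chart M V phi J E r C delta g).

Let T := proj (row_space E).
Let TP : has_proj (row_space E).
Proof. exact/row_space_has_proj/orthonormal_free. Qed.

Let S x := proj (row_space (J (g x))).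
Let SP x : enorm x <= r -> has_proj (row_space (J (g x))).
Proof. by move=> /(graph_in gr) /(chart_free ch) /row_space_has_proj. Qed.

Let jacobian_lower x w : enorm x <= r -> enorm w <= 2 * enorm (w *m J (g x)).
Proof.
move=> /(graph_jacobian_half gr)/(_ w) h.
have := enorm_distD (w *m J (g x)) (w *m E) 0.
rewrite !subr0 enormBC (enorm_isometry w EE); lra.
Qed.

Lemma graph_plane_dist x u : enorm x <= r ->
  enorm (S x u - T u) <= 4 * C * enorm x * enorm u.
Proof.
move=> xr; have C0 := ltW C_gt0; have e0 := enorm_ge0 x.
rewrite (_ : 4 * C * enorm x = 2 * (2 * C * enorm x)); last by ring.
apply: (enorm_projB (SP xr) TP); first by rewrite !mulr_ge0.
  move=> _ [w ->]; exists (w *m E); first by exists w.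
  apply: le_trans (graph_jacobian gr xr w) _.
  have := jacobian_lower w xr; have := enorm_ge0 (w *m J (g x)) => h1 h2.
  apply: (@le_trans _ _ (C * enorm x * (2 * enorm (w *m J (g x))))).
    by rewrite ler_wpM2l// mulr_ge0.
  by rewrite le_eqVlt; apply/orP; left; apply/eqP; ring.
move=> _ [w ->]; exists (w *m J (g x)); first by exists w.
rewrite enormBC; apply: le_trans (graph_jacobian gr xr w) _.
rewrite (enorm_isometry w EE) ler_wpM2r ?enorm_ge0// ler_wpM2r//.
by rewrite mulr_natl mulr2n lerDl.
Qed.

Lemma graph_plane_continuous x0 e : enorm x0 <= r -> 0 < e ->
  \forall x \near x0, enorm x <= r -> forall u, enorm (S x u - S x0 u) <= e * enorm u.
Proof.
move=> x0r e0; have e1 : 0 < e / 4 by rewrite divr_gt0.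
have := chart_C1 ch (graph_in gr x0r) e1.
have : \forall x \near x0, enorm x <= r -> enorm (g x0 - g x) <= 1.
  have := near_enorm x0 (divr_gt0 (@ltr01 R) (ltr0n R 2)).
  apply: filterS => x xx0 xr; apply: le_trans (graph_lipschitz gr x0r xr) _.
  by rewrite -ler_pdivlMl// mulrC.
move=> _ /nbhs_ballP[a /= a0 aP].
have a1 : 0 < a / 4 by rewrite divr_gt0.
have := near_enorm x0 a1; apply: filterS => x xx0 xr.
have JB w : enorm (w *m J (g x) - w *m J (g x0)) <= e / 4 * enorm w.
  apply: aP; rewrite -ball_normE /=; apply: le_lt_trans (norm_le_enorm _) _.
  apply: le_lt_trans (graph_lipschitz gr x0r xr) _.
  apply: (@le_lt_trans _ _ (2 * (a / 4))); first by rewrite ler_pM2l.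
  by lra.
have half (w : 'rV[R]_d) b : enorm w <= 2 * b -> e / 4 * enorm w <= e / 2 * b.
  move=> wb; apply: (@le_trans _ _ (e / 4 * (2 * b))); first by rewrite ler_pM2l.
  by rewrite le_eqVlt; apply/orP; left; apply/eqP; field.
move=> u; rewrite -[e](@mulfVK _ 2)// [e / 2 * 2]mulrC.
apply: (enorm_projB (SP xr) (SP x0r)); first by rewrite divr_ge0// ltW.
  move=> _ [w ->]; exists (w *m J (g x0)); first by exists w.
  by apply: le_trans (JB w) _; apply: half; exact: jacobian_lower.
move=> _ [w ->]; exists (w *m J (g x)); first by exists w.
by rewrite enormBC; apply: le_trans (JB w) _; apply: half; exact: jacobian_lower.
Qed.

(** Landau's [o(|x|^2)] at the origin, for the Euclidean norm. *)
Definition small2 (F : 'rV[R]_d -> 'rV[R]_n) : Prop := forall e, 0 < e ->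
  \forall x \near (0 : 'rV[R]_d), enorm (F x) <= e * enorm x ^+ 2.

Lemma small2D F G : small2 F -> small2 G -> small2 (fun x => F x + G x).
Proof.
move=> sF sG e e0; have e1 : 0 < e / 2 by rewrite divr_gt0.
apply: filterS2 (sF _ e1) (sG _ e1) => x h1 h2.
by apply: le_trans (enormD _ _) _; rewrite [e](splitr e) mulrDl lerD.
Qed.

Lemma small2_le F (G : 'rV[R]_d -> 'rV[R]_n) (k : R) : 0 <= k ->
  (\forall x \near (0 : 'rV[R]_d), enorm (G x) <= k * enorm (F x)) ->
  small2 F -> small2 G.
Proof.
move=> k0 GF sF e e0; have k1 : 0 < k + 1 by rewrite ltr_wpDl.
have e1 : 0 < e / (k + 1) by rewrite divr_gt0.
apply: filterS2 GF (sF _ e1) => x h1 h2; apply: le_trans h1 _.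
apply: (@le_trans _ _ ((k + 1) * (e / (k + 1) * enorm x ^+ 2))).
  by apply: ler_pM => //; [exact: enorm_ge0|rewrite lerDl].
by rewrite mulrA [_ * (e / _)]mulrC divfK ?gt_eqF.
Qed.

Lemma small2_ext F (G : 'rV[R]_d -> 'rV[R]_n) :
  (\forall x \near (0 : 'rV[R]_d), G x = F x) -> small2 F -> small2 G.
Proof.
move=> GF; apply: (@small2_le _ _ 1) => //; apply: filterS GF => x ->.
by rewrite mul1r.
Qed.

Lemma small2N F : small2 F -> small2 (fun x => - F x).
Proof.
by apply: (@small2_le _ _ 1) => //; apply: (@filterE _ (nbhs (0 : 'rV[R]_d))) => x; rewrite enormN mul1r.
Qed.

Lemma small2B F G : small2 F -> small2 G -> small2 (fun x => F x - G x).
Proof. by move=> sF /small2N; exact: small2D. Qed.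

Lemma small2Z k F : small2 F -> small2 (fun x => k *: F x).
Proof.
by apply: (@small2_le _ _ `|k|) => //; apply: (@filterE _ (nbhs (0 : 'rV[R]_d))) => x; rewrite enormZ.
Qed.

Lemma small2_cubic F (k : R) : 0 <= k ->
  (\forall x \near (0 : 'rV[R]_d), enorm (F x) <= k * enorm x ^+ 3) -> small2 F.
Proof.
move=> k0 Fk e e0; have k1 : 0 < k + 1 by rewrite ltr_wpDl.
have e1 : 0 < e / (k + 1) by rewrite divr_gt0.
have := near_enorm (0 : 'rV[R]_d) e1; apply: filterS2 Fk => x h1.
rewrite sub0r enormN => h2; apply: le_trans h1 _.
rewrite exprS mulrA ler_wpM2r ?exprn_ge0 ?enorm_ge0//.
move: h2; rewrite ler_pdivlMr//; have := enorm_ge0 x; nra.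
Qed.

Let near_r : \forall x \near (0 : 'rV[R]_d), enorm x <= r.
Proof. by have := near_enorm (0 : 'rV[R]_d) r_gt0; apply: filterS => x; rewrite sub0r enormN. Qed.

Let g_le x : enorm x <= r -> enorm (g x) <= 2 * enorm x.
Proof.
move=> xr; have h0 : enorm (0 : 'rV[R]_d) <= r by rewrite enorm0 ltW.
have g0 : g 0 = 0.
  have := graph_id gr h0; rewrite subr0 enorm0 expr0n mulr0 => h.
  by apply: enorm0_eq0; apply/eqP; rewrite eq_le enorm_ge0 h.
by have := graph_lipschitz gr xr h0; rewrite g0 !subr0.
Qed.

Let near_g (P : 'rV[R]_d -> Prop) : (\forall z \near (0 : 'rV[R]_d), P z) ->
  \forall x \near (0 : 'rV[R]_d), P (g x).
Proof.
move=> /near_edisc[a a0 aP]; have a2 : 0 < a / 2 by rewrite divr_gt0.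
have := near_enorm (0 : 'rV[R]_d) a2; apply: filterS2 near_r => x xr.
rewrite sub0r enormN => xa; apply: aP; apply: le_trans (g_le xr) _.
by rewrite mulrC -ler_pdivlMr.
Qed.

Let small2_g (F : 'rV[R]_d -> 'rV[R]_n) : small2 F -> small2 (fun x => F (g x)).
Proof.
move=> sF e e0; have e4 : 0 < e / 4 by rewrite divr_gt0.
apply: filterS2 near_r (near_g (sF _ e4)) => x xr h; apply: le_trans h _.
have -> : e * enorm x ^+ 2 = e / 4 * (2 * enorm x) ^+ 2 by field.
by rewrite ler_pM2l// lerXn2r ?nnegrE ?enorm_ge0 ?mulr_ge0 ?enorm_ge0// g_le.
Qed.

(** Twice the leading part of the height of the graph. *)
Definition normal_form (x : 'rV[R]_d) : 'rV[R]_n := perp (proj (row_space E)) (Q x x).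
Let B := normal_form.

Let Q_g : small2 (fun x => Q (g x) (g x) - Q x x).
Proof.
have [L L0 LQ] := bilinear_bound QL.
apply: (@small2_cubic _ (3 * L * C)); first by rewrite !mulr_ge0// ltW.
apply: filterS near_r => x xr.
have -> : Q (g x) (g x) - Q x x = Q (g x - x) (g x) + Q x (g x - x).
  have [Q1 Q2] := QL.
  have -> : g x - x = -1 *: x + g x by rewrite scaleN1r addrC.
  by rewrite Q1 Q2; apply/rowP => i; rewrite !mxE; ring.
have C0 := ltW C_gt0; have e0 := enorm_ge0 x.
have h := graph_id gr xr; have h2 := g_le xr.
apply: le_trans (enormD _ _) _.
apply: (@le_trans _ _ (L * (C * enorm x ^+ 2) * (2 * enorm x) + L * enorm x * (C * enorm x ^+ 2))).
  apply: lerD; apply: le_trans (LQ _ _) _.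
    apply: ler_pM; rewrite ?mulr_ge0 ?enorm_ge0//; exact: ler_wpM2l.
  by rewrite ler_wpM2l// mulr_ge0.
by rewrite le_eqVlt; apply/orP; left; apply/eqP; ring.
Qed.

Let quadratic_plane : small2 (fun x => S x (Q x x) - T (Q x x)).
Proof.
have [L L0 LQ] := bilinear_bound QL.
apply: (@small2_cubic _ (4 * C * L)); first by rewrite !mulr_ge0// ltW.
apply: filterS near_r => x xr; apply: le_trans (graph_plane_dist _ xr) _.
apply: (@le_trans _ _ (4 * C * enorm x * (L * enorm x * enorm x))).
  by rewrite ler_wpM2l// !mulr_ge0 ?enorm_ge0// ltW.
by rewrite le_eqVlt; apply/orP; left; apply/eqP; ring.
Qed.

Let taylor : small2 (fun x => phi (g x) - g x *m E - 2^-1 *: Q (g x) (g x)).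
Proof.
apply: (small2_g (F := fun z => phi z - z *m E - 2^-1 *: Q z z)) => e e0.
have [a a0 aP] := normal_taylor ch V0 phi0 QL JQ e0.
have := near_enorm (0 : 'rV[R]_d) a0; apply: filterS => z.
by rewrite sub0r enormN => /aP.
Qed.

Let jacobian_taylor : small2 (fun x => g x *m J (g x) - g x *m E - Q (g x) (g x)).
Proof.
apply: (small2_g (F := fun z => z *m J z - z *m E - Q z z)) => e e0.
by apply: filterS (JQ e0) => z /(_ z); rewrite expr2 mulrA.
Qed.

(** [phi z] is [z *m E + 2^-1 *: Q z z] up to [o(|z|^2)], and replacing [g x] by [x]
    in the quadratic term only changes it by a cubic term. *)
Lemma graph_height : small2 (fun x => perp T (phi (g x)) - 2^-1 *: B x).
Proof.
have h : small2 (fun x => (phi (g x) - g x *m E - 2^-1 *: Q (g x) (g x)) +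
    2^-1 *: (Q (g x) (g x) - Q x x)).
  by apply: small2D => //; exact: small2Z.
apply: (@small2_le _ _ 1 ler01 _ h).
apply: filterS near_r => x xr; rewrite mul1r.
have -> : (phi (g x) - g x *m E - 2^-1 *: Q (g x) (g x)) +
    2^-1 *: (Q (g x) (g x) - Q x x) = phi (g x) - g x *m E - 2^-1 *: Q x x.
  by apply/rowP => i; rewrite !mxE; ring.
rewrite /B /normal_form -(perpZ TP).
have hE : row_space E (g x *m E) by exists (g x).
rewrite -[perp T (phi (g x))]subr0 -(perp_in TP hE) -(perpB TP) -(perpB TP).
exact: enorm_perp.
Qed.

(** The vector [z *m J z] is tangent at [phi z] and is [z *m E + Q z z] up to
    [o(|z|^2)]: subtracting it from [phi z] leaves [- 2^-1 *: Q z z]. This is why the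
    sign is the opposite of that of the height. *)
Lemma graph_position : small2 (fun x => perp (S x) (phi (g x)) + 2^-1 *: B x).
Proof.
pose F x := (phi (g x) - g x *m E - 2^-1 *: Q (g x) (g x)) -
  (g x *m J (g x) - g x *m E - Q (g x) (g x)) - 2^-1 *: (Q (g x) (g x) - Q x x).
have hF : small2 F by apply: small2B; [exact: small2B|exact: small2Z].
have h1 : small2 (fun x => perp (S x) (F x)).
  apply: (@small2_le _ _ 1 ler01 _ hF).
  by apply: filterS near_r => x xr; rewrite mul1r; exact: (enorm_perp (SP xr)).
apply: small2_ext (small2D h1 (small2Z 2^-1 quadratic_plane)).
apply: filterS near_r => x xr.
have FE : F x = phi (g x) - g x *m J (g x) + 2^-1 *: Q x x.
  by apply/rowP => i; rewrite !mxE; field.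
have hJ : row_space (J (g x)) (g x *m J (g x)) by exists (g x).
rewrite FE (perpD (SP xr)) (perpB (SP xr)) (perp_in (SP xr) hJ) subr0 (perpZ (SP xr)).
by rewrite /B /normal_form /perp; apply/rowP => i; rewrite !mxE; ring.
Qed.

Lemma graph_height_perp :
  small2 (fun x => perp (S x) (perp T (phi (g x))) - 2^-1 *: B x).
Proof.
have h1 : small2 (fun x => perp (S x) (perp T (phi (g x)) - 2^-1 *: B x)).
  apply: (@small2_le _ _ 1 ler01 _ graph_height).
  by apply: filterS near_r => x xr; rewrite mul1r; exact: (enorm_perp (SP xr)).
have [L L0 LQ] := bilinear_bound QL.
have h2 : small2 (fun x => S x (B x)).
  apply: (@small2_cubic _ (4 * C * L)); first by rewrite !mulr_ge0// ltW.
  apply: filterS near_r => x xr.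
  have TB : T (B x) = 0.
    apply: (proj_unique TP); first exact: (has_proj0 TP).
    by move=> w Ew; rewrite subr0; exact: (perp_orthogonal TP).
  rewrite -[S x (B x)]subr0 -TB; apply: le_trans (graph_plane_dist _ xr) _.
  apply: (@le_trans _ _ (4 * C * enorm x * (L * enorm x * enorm x))).
    rewrite ler_wpM2l// ?mulr_ge0 ?enorm_ge0 ?(ltW C_gt0)//.
    exact: le_trans (enorm_perp TP _) (LQ _ _).
  by rewrite le_eqVlt; apply/orP; left; apply/eqP; ring.
apply: small2_ext (small2B h1 (small2Z 2^-1 h2)).
apply: filterS near_r => x xr.
rewrite (perpB (SP xr) (perp T (phi (g x)))) (perpZ (SP xr)) [perp _ (B x)]/perp.
move: (perp (S x) (perp T (phi (g x)))) (B x) => a b.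
by rewrite -/(S x) (scalerBr 2^-1 b) opprB [2^-1 *: S x b - _]addrC addrA addrK.
Qed.

Let tangent_spaceE z : V z -> tangent_space M (phi z) = row_space (J z).
Proof. exact: chart_tangent_space ch. Qed.

Let tangent_space0 : tangent_space M 0 = row_space E.
Proof. by rewrite -phi0 tangent_spaceE// J0. Qed.

(** The second fundamental form at the origin is the normal part of the second
    derivative of the chart: along a curve with velocity [a *m E], the tangent
    field [b_t *m J z_t] has a normal part equivalent to [t *: Q b a]. *)
Lemma graph_second_form (delta_gt0 : 0 < delta) (a b : 'rV[R]_d) :
  second_fundamental_form M 0 (a *m E) (b *m E) = perp T (Q b a).
Proof.
have [L L0 LQ] := bilinear_bound QL.
have tproj0 : tproj M 0 = T by rewrite /tproj tangent_space0.
set W := [set w | exists (gam X : R -> 'rV[R]_n) (dX : 'rV[R]_n),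
    [/\ \forall t \near (0 : R), M (gam t) /\ tangent_space M (gam t) (X t),
        gam 0 = 0 /\ X 0 = b *m E,
        is_derive (0 : R) 1 gam (a *m E),
        is_derive (0 : R) 1 X dX &
        w = perp (tproj M 0) dX]].
have VM z : V z -> M (phi z).
  by move=> Vz; have : (phi @` V) (phi z) by [exists z]; rewrite (chart_image ch) => -[].
have W0 : W (perp T (Q b a)).
  exists (fun t => phi (0 + t *: a)), (fun t => b *m J (t *: a)), (Q b a).
  have nV : \forall t \near (0 : R), V (0 + (t - 0) *: a).
    by apply: near_line; apply: open_nbhs_nbhs; split => //; exact: (chart_openV ch).
  split.
  - apply: filterS nV => t; rewrite subr0 add0r => Vt; split; first exact: VM.
    by rewrite tangent_spaceE//; exists b.
  - by rewrite scale0r addr0 phi0 J0.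
  - have Va : V (0 + 0 *: a) by rewrite scale0r addr0.
    by have := chart_line_derive ch Va; rewrite scale0r addr0 J0.
  - apply/is_derive_enorm => e e0; rewrite scale0r J0.
    have k0 : 0 < enorm b * enorm a + 1 by rewrite ltr_wpDl// mulr_ge0 ?enorm_ge0.
    have e1 : 0 < e / (enorm b * enorm a + 1) by rewrite divr_gt0.
    apply: filterS (near_line a 0 (JQ e1)) => t /(_ b); rewrite add0r subr0.
    rewrite -(bilinearZr QL) => /le_trans; apply; rewrite enormZ.
    rewrite (_ : _ * _ * _ = e * `|t| * ((enorm b * enorm a) / (enorm b * enorm a + 1))); last by ring.
    rewrite ler_piMr ?mulr_ge0 ?(ltW e0)// ler_pdivrMr// mul1r lerDl.
    by [].
  - by rewrite tproj0.
suff Wuniq w0 : W w0 -> w0 = perp T (Q b a).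
  by rewrite /second_fundamental_form -/W; apply: Wuniq; apply: (@xgetPex _ 0 W); exists (perp T (Q b a)).
move=> [gam [X [dX [near_MX [gam0 X0] dgam dX0 ->]]]]; rewrite tproj0.
have hE v : perp T (v *m E) = 0 by apply: (perp_in TP); exists v.
have F1 : is_derive (0 : R) 1 (fun t => perp T (X t)) (perp T dX).
  apply/is_derive_enorm => e e0; apply: filterS (proj1 (is_derive_enorm _ _ _) dX0 _ e0) => t.
  by rewrite -(perpZ TP) -!(perpB TP); apply: le_trans; exact: (enorm_perp TP).
suff F2 : is_derive (0 : R) 1 (fun t => perp T (X t)) (perp T (Q b a)).
  by rewrite -(@derive_val _ _ _ _ _ _ _ F1) (@derive_val _ _ _ _ _ _ _ F2).
apply/is_derive_enorm => e e_gt0.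
have [a0 b0 dX_ge0 C0] : [/\ 0 <= enorm a, 0 <= enorm b, 0 <= enorm dX & 0 <= C].
  by split; rewrite ?enorm_ge0// ltW.
pose K3 := C * (1 + enorm a) * (2 * (enorm b + 1)) + (1 + enorm dX).
have K30 : 0 <= K3 by rewrite addr_ge0 ?mulr_ge0 ?addr_ge0.
pose K := 2 * (enorm b + 1) * (2 + enorm a) + 1 + 2 * L * enorm b.
have K0 : 0 < K by rewrite ltr_pwDl ?mulr_ge0 ?addr_ge0// ltr_wpDl// !mulr_ge0 ?addr_ge0.
pose e1 := Num.min 1 (e / K).
have e1_gt0 : 0 < e1 by rewrite lt_min ltr01 divr_gt0.
have e11 : e1 <= 1 by rewrite ge_min lexx.
have e1K : e1 * K <= e by rewrite -ler_pdivlMr// ge_min lexx orbT.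
have G1 := proj1 (is_derive_enorm _ _ _) dgam _ e1_gt0.
have G2 := proj1 (is_derive_enorm _ _ _) dX0 _ (@ltr01 R).
have [z1 z10 z1P] := near_edisc (JQ e1_gt0).
have near_t (k : R) : 0 < k -> \forall t \near (0 : R), `|t| < k.
  by move=> k0; exact: (@nbhs0_lt _ R^o).
have small (k q : R) : 0 <= k -> 0 < q -> \forall t \near (0 : R), k * `|t| <= q.
  move=> k0 q0; have k1 : 0 < k + 1 by rewrite ltr_wpDl.
  apply: filterS (near_t _ (divr_gt0 q0 k1)) => t; rewrite ltr_pdivlMr// => h.
  apply: le_trans (ltW h); rewrite mulrC ler_wpM2l// lerDl//.
near=> t.
have [Mt Xt] : M (gam t) /\ tangent_space M (gam t) (X t) by near: t.
have g1 : enorm (gam t - t *: (a *m E)) <= e1 * `|t|.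
  have : enorm (gam t - gam 0 - (t - 0) *: (a *m E)) <= e1 * `|t - 0| by near: t.
  by rewrite gam0 !subr0.
have x1 : enorm (X t - b *m E - t *: dX) <= `|t|.
  have : enorm (X t - X 0 - (t - 0) *: dX) <= 1 * `|t - 0| by near: t.
  by rewrite X0 !subr0 mul1r.
have s1 : (1 + enorm a) * `|t| <= delta by near: t; apply: small; rewrite ?addr_ge0.
have s2 : C * (1 + enorm a) ^+ 2 * `|t| <= e1.
  by near: t; apply: small; rewrite ?mulr_ge0 ?exprn_ge0 ?addr_ge0.
have s3 : (1 + enorm dX) * `|t| <= 1 by near: t; apply: small; rewrite ?addr_ge0.
have s4 : (2 + enorm a) * `|t| <= z1 by near: t; apply: small; rewrite ?addr_ge0.
have s5 : L * K3 * (2 + enorm a) * `|t| <= e1.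
  near: t; apply: small => //; apply: mulr_ge0; [exact: mulr_ge0|exact: addr_ge0].
have t0 := normr_ge0 t.
have gt : enorm (gam t) <= (1 + enorm a) * `|t|.
  rewrite -(subrK (t *: (a *m E)) (gam t)); apply: le_trans (enormD _ _) _.
  rewrite enormZ (enorm_isometry a EE) mulrDl [enorm a * _]mulrC lerD2r mul1r.
  by apply: le_trans g1 _; rewrite ler_piMl.
have [] := graph_cover gr Mt (le_trans gt s1).
set x := gam t *m E^T; set z := g x => xr phiz.
have xt : enorm (x - t *: a) <= e1 * `|t|.
  apply: le_trans g1; rewrite -[t *: a](_ : (t *: (a *m E)) *m E^T = _).
    by rewrite /x -mulmxBl; exact: (enorm_coordinates EE).
  by rewrite -scalemxAl -mulmxA EE mulmx1.
have x_le : enorm x <= (1 + enorm a) * `|t|.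
  by apply: le_trans gt; exact: (enorm_coordinates EE).
have zt : enorm (z - t *: a) <= 2 * e1 * `|t|.
  apply: le_trans (enorm_distD x _ _) _; rewrite mulrDl mul1r mulrDl; apply: lerD => //.
  apply: le_trans (graph_id gr xr) _.
  apply: (@le_trans _ _ (C * ((1 + enorm a) * `|t|) ^+ 2)).
    by rewrite ler_wpM2l// lerXn2r// nnegrE ?enorm_ge0// mulr_ge0// addr_ge0.
  by rewrite exprMn mulrA [`|t| ^+ 2]expr2 mulrA ler_wpM2r.
have z_le : enorm z <= (2 + enorm a) * `|t|.
  rewrite -(subrK (t *: a) z); apply: le_trans (enormD _ _) _.
  rewrite enormZ mulrDl [enorm a * _]mulrC lerD2r; apply: le_trans zt _.
  by rewrite ler_wpM2r// ler_piMr.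
have Vz : V z by exact: (graph_in gr xr).
move: Xt; rewrite -phiz -/z tangent_spaceE// => -[w Xw].
have X_le : enorm (X t - b *m E) <= (1 + enorm dX) * `|t|.
  rewrite -(subrK (t *: dX) (X t - b *m E)); apply: le_trans (enormD _ _) _.
  by rewrite enormZ mulrDl mul1r [enorm dX * _]mulrC lerD2r.
have w_le : enorm w <= 2 * (enorm b + 1).
  apply: le_trans (jacobian_lower w xr) _; rewrite ler_pM2l// -/z -Xw.
  rewrite -(subrK (b *m E) (X t)); apply: le_trans (enormD _ _) _.
  by rewrite (enorm_isometry b EE) addrC lerD2l (le_trans X_le).
have wb : enorm (w - b) <= K3 * `|t|.
  rewrite -(enorm_isometry _ EE) mulmxBl; apply: le_trans (enorm_distD (X t) _ _) _.
  rewrite /K3 mulrDl; apply: lerD => //.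
  rewrite Xw enormBC; apply: le_trans (graph_jacobian gr xr w) _.
  apply: (@le_trans _ _ (C * ((1 + enorm a) * `|t|) * (2 * (enorm b + 1)))).
    by apply: ler_pM; rewrite ?mulr_ge0 ?enorm_ge0// ler_wpM2l.
  by rewrite le_eqVlt; apply/orP; left; apply/eqP; ring.
have h4 : enorm (w *m J z - w *m E - Q w z) <= e1 * (2 * (enorm b + 1) * (2 + enorm a) * `|t|).
  apply: le_trans (z1P z (le_trans z_le s4) w) _; rewrite -mulrA ler_pM2l//.
  by rewrite -!mulrA mulrA; apply: ler_pM; rewrite ?enorm_ge0.
have h5 : enorm (Q w z - Q b (t *: a)) <= e1 * ((1 + 2 * L * enorm b) * `|t|).
  have -> : Q w z - Q b (t *: a) = Q (w - b) z + Q b (z - t *: a).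
    have [Q1 Q2] := QL.
    have -> : w - b = -1 *: b + w by rewrite scaleN1r addrC.
    have -> : z - t *: a = -1 *: (t *: a) + z by rewrite scaleN1r addrC.
    by rewrite Q1 Q2; apply/rowP => i; rewrite !mxE; ring.
  apply: le_trans (enormD _ _) _.
  apply: (@le_trans _ _ (L * (K3 * `|t|) * ((2 + enorm a) * `|t|) + L * enorm b * (2 * e1 * `|t|))).
    apply: lerD; apply: le_trans (LQ _ _) _.
      apply: ler_pM; rewrite ?mulr_ge0 ?enorm_ge0//; exact: ler_wpM2l.
    by rewrite ler_wpM2l// mulr_ge0.
  have : L * (K3 * `|t|) * ((2 + enorm a) * `|t|) <= e1 * `|t|.
    rewrite (_ : _ * _ * _ = L * K3 * (2 + enorm a) * `|t| * `|t|); last by ring.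
    by rewrite ler_wpM2r.
  move=> h; apply: le_trans (lerD h (lexx _)) _.
  by rewrite le_eqVlt; apply/orP; left; apply/eqP; ring.
rewrite X0 hE !subr0 -(perpZ TP) -(bilinearZr QL).
have -> : perp T (X t) - perp T (Q b (t *: a)) =
    perp T ((w *m J z - w *m E - Q w z) + (Q w z - Q b (t *: a))).
  rewrite addrA subrK (perpB TP _ (Q b (t *: a))) (perpB TP (w *m J z)) hE subr0.
  by rewrite -Xw.
apply: le_trans (enorm_perp TP _) _; apply: le_trans (enormD _ _) _.
apply: le_trans (lerD h4 h5) _; rewrite -mulrDr -mulrDl mulrA addrA.
by rewrite ler_wpM2r.
Unshelve. all: by end_near. Qed.

End graph_planes.

(** * Adapting a chart to an orthonormal basis *)

Section adapted_chart.
Context (R : realType) (n d : nat).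

Lemma dotp_row m (A : 'M[R]_(m, n)) i j : dotp (row i A) (row j A) = (A *m A^T) i j.
Proof. by rewrite mxE; apply: eq_bigr => k _; rewrite !mxE. Qed.

(** The basis [E] is one for which [mean_curvature] takes its value. A linear change
    of coordinates turns the Jacobian at the origin, whose rows are another basis of
    the tangent space, into [E]. *)
Lemma normal_chart_exists (M : set 'rV[R]_n) : C2_submanifold d M -> M 0 ->
  exists U V phi J psi (E : 'M[R]_(d, n)) Q,
    [/\ @chart R n d M U V phi J psi, V 0, phi 0 = 0, J 0 = E & E *m E^T = 1%:M] /\
    [/\ bilinear_map Q,
      forall e, 0 < e -> \forall y \near (0 : 'rV[R]_d), forall w : 'rV[R]_d,
        enorm (w *m J y - w *m E - Q w y) <= e * enorm w * enorm y &
      mean_curvature d M 0 = \sum_i second_fundamental_form M 0 (row i E) (row i E)].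
Proof.
move=> C2M M0.
have [U [V [phi [J [psi [z0 [Q [ch Vz0 phiz0 QL JQ]]]]]]]] := C2_chart C2M M0.
have T0 : tangent_space M 0 = row_space (J z0) by rewrite -phiz0; exact: chart_tangent_space ch Vz0.
have fJ := chart_free ch Vz0.
have [e [eT ee Hm]] : exists e : 'I_d -> 'rV[R]_n,
    [/\ forall i, tangent_space M 0 (e i), forall i j, dotp (e i) (e j) = (i == j)%:R &
    mean_curvature d M 0 = \sum_(i < d) second_fundamental_form M 0 (e i) (e i)].
  apply: (@xgetPex _ 0 [set h | exists e : 'I_d -> 'rV[R]_n,
    [/\ forall i, tangent_space M 0 (e i), forall i j, dotp (e i) (e j) = (i == j)%:R &
    h = \sum_(i < d) second_fundamental_form M 0 (e i) (e i)]]).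
  have [E0 [EE0 /submxP[K E0K]]] := orthonormal_basis_exists fJ.
  exists (\sum_(i < d) second_fundamental_form M 0 (row i E0) (row i E0)).
  exists (fun i => row i E0); split => // [i|i j].
    by rewrite T0 E0K row_mul; exists (row i K).
  by rewrite dotp_row EE0 mxE.
pose E : 'M[R]_(d, n) := \matrix_i e i.
have rE i : row i E = e i by rewrite rowK.
have EE : E *m E^T = 1%:M.
  by apply/matrixP => i j; rewrite -dotp_row !rE ee mxE.
have rowE i : row_space (J z0) (row i E) by rewrite rE -T0.
have [K [uK JK]] := orthonormal_change fJ EE rowE.
pose K' := invmx K.
pose c (w : 'rV[R]_d) := z0 + w *m K'.
have cc : continuous c.
  move=> w; apply: (@cvgD R _ _ (nbhs w) _ (fun=> z0) (fun w : 'rV[R]_d => w *m K')).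
    exact: cvg_cst.
  exact: continuous_mulmxr.
have cB w y : c y - c w = (y - w) *m K'.
  by rewrite /c opprD addrACA subrr add0r mulmxBl.
have c0 : c 0 = z0 by rewrite /c mul0mx addr0.
have cK z : c ((z - z0) *m K) = z.
  by rewrite /c -mulmxA mulmxV// mulmx1 addrC subrK.
have Kc w : (c w - z0) *m K = w.
  by rewrite /c addrAC subrr add0r -mulmxA mulVmx// mulmx1.
pose k : R := (d.+1 * d)%:R * `|K'| + 1.
have k0 : 0 < k by rewrite ltr_wpDl// mulr_ge0.
have kP (w : 'rV[R]_d) : enorm (w *m K') <= k * enorm w.
  apply: le_trans (enorm_mulmx _ _) _; rewrite ler_wpM2r ?enorm_ge0//.
  by rewrite /k lerDl.
have ek (e' : R) (w : 'rV[R]_d) : 0 < e' -> e' / k * enorm (w *m K') <= e' * enorm w.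
  move=> e'0; rewrite -mulrA ler_pM2l// mulrC ler_pdivrMr// mulrC; exact: kP.
exists U, (c @^-1` V), (phi \o c), (fun w => K' *m J (c w)), (fun y => (psi y - z0) *m K), E,
  (fun w z => Q (w *m K') (z *m K')).
split; split.
- split.
  + exact: (chart_openU ch).
  + by move: cc => /continuousP; apply; exact: (chart_openV ch).
  + rewrite -(chart_image ch); apply/seteqP; split => [_ [w Vw <-]|_ [z Vz <-]].
      by exists (c w).
    by exists ((z - z0) *m K); rewrite /= cK.
  + apply/subspace_continuousP => y MUy.
    have := proj1 (subspace_continuousP _ _) (chart_psi ch) y MUy => cpsi.
    apply: (@cvg_comp _ _ _ psi (fun z : 'rV[R]_d => (z - z0) *m K) _ (nbhs (psi y)) _ cpsi).
    apply: (@cvg_comp _ _ _ (fun z : 'rV[R]_d => z - z0) (fun v => v *m K) _ (nbhs (psi y - z0))).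
      apply: (@cvgB R _ _ (nbhs (psi y)) _ id (fun=> z0)); [exact: cvg_id|exact: cvg_cst].
    exact: continuous_mulmxr.
  + by move=> w Vw; rewrite /= (chart_inv ch)// Kc.
  + move=> w Vw; apply: (@inj_row_free _ _ _ (K' *m J (c w))) => v; rewrite mulmxA => vJ.
    have fw := chart_free ch Vw.
    have vK : v *m K' = 0 by apply/eqP; rewrite -(mulmx_free_eq0 _ fw) vJ.
    by rewrite -[v]mulmx1 -(mulVmx uK) mulmxA vK mul0mx.
  + move=> w Vw e' e'0; have e1 : 0 < e' / k by rewrite divr_gt0.
    have H : \forall y \near w, enorm (phi (c y) - phi (c w) - (c y - c w) *m J (c w)) <=
        e' / k * enorm (c y - c w) by exact: (cc w _ (chart_diff ch Vw e1)).
    apply: filterS H => y; rewrite /= cB mulmxA => /le_trans; apply; exact: ek.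
  + move=> w Vw e' e'0; have e1 : 0 < e' / k by rewrite divr_gt0.
    have H : \forall y \near w, forall v, enorm (v *m J (c y) - v *m J (c w)) <=
        e' / k * enorm v by exact: (cc w _ (chart_C1 ch Vw e1)).
    apply: filterS H => y /= h v.
    by rewrite !mulmxA; apply: le_trans (h _) _; exact: ek.
- by rewrite /= c0.
- by rewrite /= c0.
- by rewrite /= c0 JK mulKmx.
- exact: EE.
- by split => [a w w' z|a w z z']; rewrite mulmxDl -scalemxAl; case: QL => Q1 Q2; rewrite ?Q1 ?Q2.
- move=> e' e'0; have e1 : 0 < e' / k / k by rewrite !divr_gt0.
  have nz := JQ _ e1; rewrite -c0 in nz.
  have H : \forall y \near (0 : 'rV[R]_d), forall w : 'rV[R]_d,
      enorm (w *m J (c y) - w *m J (c 0) - Q w (c y - c 0)) <=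
      e' / k / k * enorm w * enorm (c y - c 0) by exact: (cc 0 _ nz).
  apply: filterS H => y /= h w.
  have := h (w *m K'); rewrite cB subr0 => h1.
  have -> : w *m (K' *m J (c y)) - w *m E - Q (w *m K') (y *m K') =
      w *m K' *m J (c y) - w *m K' *m J (c 0) - Q (w *m K') (y *m K').
    have -> : w *m K' *m J (c 0) = w *m E.
      by rewrite c0 JK mulmxA -[w *m K' *m K]mulmxA mulVmx// mulmx1.
    by rewrite mulmxA.
  apply: le_trans h1 _.
  rewrite -mulrA; apply: (@le_trans _ _ (e' / k / k * ((k * enorm w) * (k * enorm y)))).
    by rewrite ler_pM2l//; apply: ler_pM; rewrite ?enorm_ge0.
  rewrite le_eqVlt; apply/orP; left; apply/eqP; field.
  by rewrite gt_eqF.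
- by rewrite Hm; apply: eq_bigr => i _; rewrite rE.
Qed.

End adapted_chart.

(** * Profiles *)

(** The only regularity of the profiles and of their derivatives that the limits
    depend on. *)
Record lipschitz_profile (R : realType) (f : R -> R) (K : R) : Prop := LipschitzProfile {
  profile_bound : forall t : R, 0 <= t -> `|f t| <= K;
  profile_lipschitz : forall s t : R, 0 <= s -> 0 <= t -> `|f s - f t| <= K * `|s - t|;
  profile_support : forall t : R, 1 <= t -> f t = 0 }.

Section lipschitz_profiles.
Context (R : realType) (f : R -> R) (K : R).
Hypothesis fP : lipschitz_profile f K.

Lemma profile_bound_ge0 : 0 <= K.
Proof. exact: le_trans (normr_ge0 _) (profile_bound fP (lexx 0)). Qed.

Let near_profile (t e : R) : 0 <= t -> 0 < e ->
  \forall s \near t, 0 <= s -> `|f t - f s| <= e.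
Proof.
move=> t0 e0; have K1 : 0 < K + 1 by rewrite ltr_wpDl// profile_bound_ge0.
have e1 : 0 < e / (K + 1) by rewrite divr_gt0.
apply: filterS (nbhsx_ballx t _ e1) => s; rewrite -ball_normE /= => ts s0.
apply: le_trans (profile_lipschitz fP t0 s0) _.
apply: (@le_trans _ _ ((K + 1) * `|t - s|)); first by rewrite ler_wpM2r// lerDl.
by rewrite mulrC -ler_pdivlMr// ltW.
Qed.

Lemma profile_continuous t : 0 < t -> {for t, continuous f}.
Proof.
move=> t0; apply: (proj2 (@cvgrPdist_le R R R (nbhs t) _ f (f t))) => e e0.
have tP : \forall s \near t, 0 < s by exact: lt_nbhsr.
by apply: filterS2 tP (near_profile (ltW t0) e0) => s s0; apply; exact: ltW.
Qed.

Lemma profile_cvg0 : f t @[t --> 0^'+] --> f 0.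
Proof.
apply/cvgrPdist_le => e e0; rewrite near_withinE.
by apply: filterS (near_profile (lexx 0) e0) => s h s0; apply: h; exact: ltW.
Qed.

End lipschitz_profiles.

Section smooth_profiles.
Context (R : realType).

Section derivatives.
Variables (rho : R -> R) (g : nat -> R -> R).
Hypotheses (g0 : forall t : R, 0 <= t -> g 0%N t = rho t)
  (gd : forall (k : nat) (t : R), 0 <= t ->
      (s - t)^-1 * (g k s - g k t) @[s --> within [set s | 0 <= s] t^'] --> g k.+1 t)
  (rho1 : forall t, 1 < t -> rho t = 0).

Let g_near (k : nat) (t e : R) : 0 <= t -> 0 < e -> \forall s \near t, 0 <= s ->
  `|g k s - g k t - (s - t) * g k.+1 t| <= e * `|s - t|.
Proof.
move=> t0 e0; have /cvgrPdist_le/(_ _ e0) := @gd k t t0.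
rewrite near_withinE near_withinE; apply: filterS => s h s0.
have [->|st] := eqVneq s t; first by rewrite !subrr mul0r subr0 !normr0 mulr0.
have := h st s0; have st0 : s - t != 0 by rewrite subr_eq0.
rewrite distrC => h1; rewrite -ler_pdivrMr ?normr_gt0// mulrC -normrV ?unitfE// -normrM.
by rewrite mulrBr mulrA mulVf ?mul1r.
Qed.

Let g_derive k (t : R) : 0 < t -> is_derive t 1 (g k) (g k.+1 t).
Proof.
move=> t0; apply/is_derive_nearP => e e0.
have tP : \forall s \near t, 0 < s by exact: lt_nbhsr.
by apply: filterS2 tP (@g_near k t e (ltW t0) e0) => s s0; apply; exact: ltW.
Qed.

Let g_continuous k (t : R) : 0 < t -> {for t, continuous (g k)}.
Proof.
move=> /(@g_derive k) gk; apply: differentiable_continuous; apply/derivable1_diffP.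
exact: ex_derive.
Qed.

Let g_cvg0 k : g k s @[s --> 0^'+] --> g k 0.
Proof.
apply/cvgrPdist_le => e e0; rewrite near_withinE.
pose b := `|g k.+1 0| + 1; have b0 : 0 < b by rewrite ltr_wpDl.
have e1 : 0 < e / b by rewrite divr_gt0.
apply: filterS2 (nbhsx_ballx (0 : R) _ e1) (@g_near k 0 1 (lexx 0) (@ltr01 R)) => s.
rewrite -ball_normE /= sub0r normrN => se h s0; rewrite distrC.
rewrite -(subrK ((s - 0) * g k.+1 0) (g k s - g k 0)).
apply: le_trans (ler_normD _ _) _; apply: le_trans (lerD (h (ltW s0)) (lexx _)) _.
rewrite subr0 mul1r normrM -[X in X + _]mulr1 -mulrDr addrC -/b.
by rewrite -ler_pdivlMr// ltW.
Qed.

Let g_within k (a b : R) : 0 <= a -> a < b -> {within `[a, b], continuous (g k)}.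
Proof.
move=> a0 ab; apply/continuous_within_itvP => //; split.
- by move=> t; rewrite in_itv/= => /andP[ta _]; apply: g_continuous; exact: le_lt_trans ta.
- move: a0; rewrite le_eqVlt => /predU1P[<-|a0]; first exact: g_cvg0.
  by apply: cvg_at_right_filter; exact: g_continuous.
- by apply: cvg_at_left_filter; apply: g_continuous; exact: le_lt_trans ab.
Qed.

Let g_support k (t : R) : 1 < t -> g k t = 0.
Proof.
elim: k t => [|k IH] t t1; first by rewrite g0 ?rho1// ltW// (lt_trans ltr01).
have t0 : 0 < t by exact: lt_trans t1.
have h : is_derive t 1 (g k) 0.
  apply/is_derive_nearP => e e0; have tP : \forall s \near t, 1 < s by exact: lt_nbhsr.
  apply: filterS tP => s s1; rewrite (IH _ s1) (IH _ t1) scaler0 !subr0 normr0.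
  by rewrite mulr_ge0// ltW.
by rewrite -(@derive_val _ _ _ _ _ _ _ (@g_derive k t t0)) (@derive_val _ _ _ _ _ _ _ h).
Qed.

Let g_support1 k (t : R) : 1 <= t -> g k t = 0.
Proof.
rewrite le_eqVlt => /predU1P[<-|]; last exact: g_support.
have c1 : g k s @[s --> 1^'+] --> g k 1.
  by apply: cvg_at_right_filter; exact: g_continuous.
apply/esym; apply: (@cvg_unique _ _ _ _ _ _ _ c1) => //.
apply/cvgrPdist_le => e e0; rewrite near_withinE.
by apply: nearW => s s1; rewrite g_support// subr0 normr0 ltW.
Qed.

Let g_bound k : exists2 K : R, 0 <= K & forall t : R, 0 <= t -> `|g k t| <= K.
Proof.
have cn : {within `[0, 1], continuous (fun t => `|g k t|)}.
  have := @g_within k 0 1 (lexx 0) (@ltr01 R).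
  by move=> h t; apply: cvg_norm; exact: h.
have [c _ cP] := EVT_max (@ler01 R) cn.
exists `|g k c| => // t t0; have [t1|t1] := leP t 1.
  by apply: cP; rewrite in_itv/= t0.
by rewrite g_support// normr0.
Qed.

Lemma derivative_lipschitz_profile k : exists K, lipschitz_profile (g k) K.
Proof.
have [K0 K00 gK0] := g_bound k; have [K1 K10 gK1] := g_bound k.+1.
exists (K0 + K1); split.
- by move=> t t0; apply: le_trans (gK0 _ t0) _; rewrite lerDl.
- have H (s t : R) : 0 <= s -> s < t -> `|g k s - g k t| <= (K0 + K1) * `|s - t|.
    move=> s0 st; have dg (x : R) : x \in `]s, t[ -> is_derive x 1 (g k) (g k.+1 x).
      by rewrite in_itv/= => /andP[sx _]; apply: g_derive; exact: le_lt_trans sx.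
    have [c + gc] := MVT_segment (ltW st) dg (@g_within k _ _ s0 st).
    rewrite in_itv/= => /andP[sc _].
    rewrite distrC gc normrM [`|s - t|]distrC ler_wpM2r//.
    by apply: le_trans (gK1 _ (le_trans s0 sc)) _; rewrite lerDr.
  move=> s t s0 t0; have [st|ts|->] := ltrgtP s t.
  + by apply: le_trans (H s t s0 st) _; rewrite distrC gtr0_norm ?subr_gt0.
  + by rewrite distrC; apply: le_trans (H t s t0 ts) _; rewrite distrC gtr0_norm ?subr_gt0.
  + by rewrite subrr normr0 mulr0.
- exact: g_support1.
Qed.

Lemma derive1_profile t : 0 < t -> derive1 rho t = g 1%N t.
Proof.
move=> t0; rewrite derive1E; apply: derive_val; apply/is_derive_nearP => e e0.
have tP : \forall s \near t, 0 < s by exact: lt_nbhsr.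
apply: filterS2 tP (@g_near 0 t e (ltW t0) e0) => s s0 /(_ (ltW s0)).
by rewrite (g0 (ltW s0)) (g0 (ltW t0)).
Qed.

Lemma integration_by_parts_profile d : (0 < d)%N ->
  \int[@lebesgue_measure R]_(t in `[0, 1]) (g 1%N t * t ^+ d) =
  - d%:R * \int[@lebesgue_measure R]_(t in `[0, 1]) (rho t * t ^+ d.-1).
Proof.
move=> d0.
pose F (t : R) := g 0%N t * t ^+ d.
pose f (t : R) := g 1%N t * t ^+ d + d%:R * (g 0%N t * t ^+ d.-1).
have cXn (k : nat) : {within `[0, 1], continuous (fun t : R => t ^+ k)}.
  by apply: continuous_in_subspaceT => t _; exact: exprn_continuous.
have c1 : {within `[0, 1], continuous (fun t => g 1%N t * t ^+ d)}.
  by move=> t; apply: cvgM; [exact: g_within|exact: cXn].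
have c0 : {within `[0, 1], continuous (fun t => g 0%N t * t ^+ d.-1)}.
  by move=> t; apply: cvgM; [exact: g_within|exact: cXn].
have cF : {within `[0, 1], continuous F}.
  by move=> t; apply: cvgM; [exact: g_within|exact: cXn].
have cf : {within `[0, 1], continuous f}.
  by move=> t; apply: cvgD; [exact: c1|apply: cvgM; [exact: cvg_cst|exact: c0]].
have dF (t : R) : 0 < t -> is_derive t 1 F (f t).
  move=> t0; have -> : F = g 0%N * (id ^+ d : R -> R).
    by apply/funext => s; rewrite /F /= exprfctE.
  apply: is_derive_eq (is_deriveM (@g_derive 0 t t0) (is_deriveX d (is_derive_id t 1))) _.
  by rewrite /f /GRing.scale/= exprfctE; ring.
have dF' : derivable_oo_LRcontinuous F 0 1.
  have [_ cF0 cF1] := proj1 (continuous_within_itvP F (@ltr01 R)) cF.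
  by split => // t; rewrite in_itv/= => /andP[t0 _]; have := dF _ t0; case.
have F' : {in `]0, 1[, derive1 F =1 f}.
  move=> t; rewrite in_itv/= => /andP[t0 _]; rewrite derive1E.
  exact: (@derive_val _ _ _ _ _ _ _ (dF _ t0)).
have := @continuous_FTC2 R f F 0 1 ltr01 cf dF' F'.
rewrite /F g_support1// mul0r expr0n gtn_eqF// mulr0 subee// => FTC.
have i1 := continuous_compact_integrable (@segment_compact R 0 1) c1.
have i0 := continuous_compact_integrable (@segment_compact R 0 1) c0.
have : \int[@lebesgue_measure R]_(t in `[0, 1]) f t = 0 by rewrite /Rintegral FTC.
rewrite RintegralD//; last first.
  apply: (continuous_compact_integrable (@segment_compact R 0 1)).
  by move=> t; apply: cvgM; [exact: cvg_cst|exact: c0].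
rewrite RintegralZl// => /eqP; rewrite addr_eq0 => /eqP ->; rewrite mulNr.
congr (- (_ * _)); apply: eq_Rintegral => t; rewrite inE/= in_itv/= => /andP[t0 _].
by rewrite g0.
Qed.

End derivatives.

(** [eta] is the one-sided derivative, which is Lipschitz up to the origin, whereas
    [derive1 rho] may take any value there. *)
Lemma profile_lipschitz_derivative (rho : R -> R) : profile rho ->
  exists K eta, [/\ lipschitz_profile rho K, lipschitz_profile eta K,
    forall t : R, 0 < t -> derive1 rho t = eta t &
    forall d, (0 < d)%N ->
      \int[@lebesgue_measure R]_(t in `[0, 1]) (eta t * t ^+ d) =
      - d%:R * \int[@lebesgue_measure R]_(t in `[0, 1]) (rho t * t ^+ d.-1)].
Proof.
move=> [[g [g0 gd]] _ rho1].
have [K0 gK0] := derivative_lipschitz_profile g0 gd rho1 0.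
have [K1 gK1] := derivative_lipschitz_profile g0 gd rho1 1.
have K00 := profile_bound_ge0 gK0; have K10 := profile_bound_ge0 gK1.
exists (K0 + K1), (g 1%N); split.
- split.
  + move=> t t0; rewrite -g0//; apply: le_trans (profile_bound gK0 t0) _.
    by rewrite lerDl.
  + move=> s t s0 t0; rewrite -!g0//; apply: le_trans (profile_lipschitz gK0 s0 t0) _.
    by rewrite ler_wpM2r// lerDl.
  + by move=> t t1; rewrite -g0 ?(profile_support gK0)// (le_trans ler01).
- split.
  + by move=> t t0; apply: le_trans (profile_bound gK1 t0) _; rewrite lerDr.
  + move=> s t s0 t0; apply: le_trans (profile_lipschitz gK1 s0 t0) _.
    by rewrite ler_wpM2r// lerDr.
  + exact: (profile_support gK1).
- exact: derive1_profile gd.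
- exact: integration_by_parts_profile rho1.
Qed.

End smooth_profiles.

(** * Mass of a graph *)

(** [M] is, in the ball of radius [delta], the graph of [G] over its tangent space
    at the origin. The area bound is the squared estimate that comes from the
    tangency: a linear error would be of the order of the curvature. *)
Record graph_sheet (R : realType) n d (M : set 'rV[R]_n) (G : 'rV[R]_d -> 'rV[R]_n)
    (E : 'M[R]_(d, n)) (r C delta : R) : Prop := GraphSheet {
  sheet_frame : E *m E^T = 1%:M;
  sheet_radius : 0 < r;
  sheet_cst : 0 < C;
  sheet_height : 0 < delta;
  sheet_mass : forall x, enorm x <= r -> M (G x);
  sheet_coord : forall x, enorm x <= r -> G x *m E^T = x;
  sheet0 : G 0 = 0;
  sheet_area : forall s x x', s <= r -> enorm x <= s -> enorm x' <= s ->
    enorm (G x - G x') <= (1 + C * s ^+ 2) * enorm (x - x');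
  sheet_cover : forall y, M y -> enorm y <= delta ->
    enorm (y *m E^T) <= r /\ G (y *m E^T) = y }.

Section graph_mass.
Context (R : realType) (n d : nat).
Variables (M : set 'rV[R]_n) (G : 'rV[R]_d -> 'rV[R]_n) (E : 'M[R]_(d, n)) (r C delta : R).
Hypothesis gs : graph_sheet M G E r C delta.

Let EE := sheet_frame gs.
Let r_gt0 := sheet_radius gs.
Let C_gt0 := sheet_cst gs.
Let delta_gt0 := sheet_height gs.
Let G_mass := sheet_mass gs.
Let G_coord := sheet_coord gs.
Let G0 := sheet0 gs.
Let G_area := sheet_area gs.
Let G_cover := sheet_cover gs.

Let N : set 'rV[R]_n := [set y | enorm y < delta].

Let oN : open N.
Proof.
by apply: (@open_comp _ _ (@enorm R n) [set t | t < delta]) => [y _|];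
  [exact: continuous_enorm|exact: open_lt].
Qed.

(** Projection of the mass onto the tangent space; the restriction to a small ball
    leaves only the sheet of [M] that is the graph. *)
Definition graph_mass : {measure set (borel R d) -> \bar R} :=
  image_mass (d := d) M oN (@continuous_mulmxr R n d E^T).

Definition graph_radius : R :=
  Num.min (Num.min r (delta / 4)) (Num.min 1 (C + 1)^-1).

Lemma graph_radius_gt0 : 0 < graph_radius.
Proof. by rewrite !lt_min r_gt0 ltr01 divr_gt0// invr_gt0 ltr_wpDl// ltW. Qed.

Lemma graph_radiusP s : 0 <= s -> s <= graph_radius ->
  [/\ s <= r, s <= delta / 4 & C * s ^+ 2 <= 1].
Proof.
move=> s0; rewrite !le_min => /andP[/andP[-> ->] /andP[s1 sC]]; split => //.
have C1 : 0 < C + 1 by rewrite ltr_wpDl// ltW.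
have : s * (C + 1) <= 1 by rewrite -ler_pdivlMr// div1r.
have := C_gt0; nra.
Qed.

Lemma graph_enorm x : enorm x <= r ->
  enorm x <= enorm (G x) /\ enorm (G x) <= (1 + C * enorm x ^+ 2) * enorm x.
Proof.
move=> xr; split.
  by rewrite -{1}(G_coord xr); exact: enorm_coordinates.
have := G_area xr (lexx _) (_ : enorm (0 : 'rV[R]_d) <= enorm x).
by rewrite G0 !subr0; apply; rewrite enorm0 enorm_ge0.
Qed.

Let graph_near x : enorm x <= graph_radius -> N (G x).
Proof.
move=> xr; have [x1 x2 x3] := graph_radiusP (enorm_ge0 x) xr.
rewrite /N/=; apply: le_lt_trans (graph_enorm x1).2 _.
have := enorm_ge0 x; have := delta_gt0; nra.
Qed.

(** The projection is 1-Lipschitz and its inverse [G] is almost so. *)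
Lemma graph_mass_haus s : 0 < s -> s <= graph_radius ->
  forall A : set (borel R d), measurable A -> A `<=` @edisc R d s ->
  (haus R d A <= graph_mass A /\
   graph_mass A <= (1 + (2 ^+ d - 1) * C * s ^+ 2)%:E * haus R d A)%E.
Proof.
move=> s0 sr A mA As; have [s1 s2 s3] := graph_radiusP (ltW s0) sr.
have Ar x : A x -> enorm (x : 'rV[R]_d) <= r by move=> /As /le_trans; apply.
have GA : M `&` N `&` (fun y : 'rV[R]_n => y *m E^T) @^-1` A = G @` A.
  apply/seteqP; split => [y [[My Ny] Ay]|_ [x Ax <-]].
    by exists (y *m E^T) => //; have [_] := G_cover My (ltW Ny).
  split; last by rewrite /preimage /mkset (G_coord (Ar _ Ax)).
  split; first exact/G_mass/Ar.
  by apply: graph_near; apply: le_trans (As _ Ax) _.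
rewrite /graph_mass image_massE GA hausE; split.
  rewrite -[X in (X <= _)%E](_ : hausdorff d ((fun y : 'rV[R]_n => y *m E^T) @` (G @` A)) = _).
    rewrite -[leRHS]mul1e -[1%E]/(1%:E) -(expr1n R d).
    apply: hausdorff_lipschitz => // _ _ [x Ax <-] [x' Ax' <-].
    by rewrite mul1r -mulmxBl; exact: enorm_coordinates.
  congr hausdorff; apply/seteqP; split => [_ [_ [x Ax <-] <-]|x Ax].
    by rewrite (G_coord (Ar _ Ax)).
  by exists (G x); [exists x|exact: (G_coord (Ar _ Ax))].
have Cs : 0 <= C * s ^+ 2 by rewrite mulr_ge0 ?exprn_ge0// ltW.
apply: (@le_trans _ _ (((1 + C * s ^+ 2) ^+ d)%:E * hausdorff d (A : set 'rV[R]_d))%E).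
  apply: hausdorff_lipschitz; first by rewrite ltr_pwDl.
  by move=> x x' Ax Ax'; apply: (G_area s1); [exact: As Ax|exact: As Ax'].
apply: lee_wpmul2r; first exact: hausdorff_ge0.
by rewrite lee_fin -mulrA; exact: expr1D_le.
Qed.

Let complement_mass0 : (mass d M : {measure set (caratheodory_type (mass d M)) -> \bar R}).-negligible (~` M).
Proof.
have m0 : mass d M (~` M) = 0%E by rewrite /mass setICl hausdorff0.
exists (~` M); split => //.
apply: le_caratheodory_measurable => X; rewrite /= {1}/mass -setIA setICl setI0.
by rewrite hausdorff0 add0e; apply: le_mass; exact: subIsetl.
Qed.

(** Since [F] vanishes off a small ball, both integrands agree on [M]. Its complement
    is a null set, all of whose subsets are measurable. *)
Lemma mass_integral_graph (F : 'rV[R]_n -> R) (K e : R) : (0 < d)%N ->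
  0 < ball_volume R d -> 0 < e -> e <= graph_radius ->
  (forall y, e < enorm y -> F y = 0) ->
  measurable_fun (@edisc R d e : set (borel R d)) (F \o G : borel R d -> R) ->
  (forall x, edisc e x -> `|F (G x)| <= K) ->
  mass_integral d M F = \int[graph_mass]_(x in @edisc R d e) F (G x).
Proof.
move=> d0 w0 e0 er F0 mF FK; have [e1 e2 e3] := graph_radiusP (ltW e0) er.
have mD := @edisc_measurable R d e.
have nuD : (graph_mass (@edisc R d e) < +oo)%E.
  apply: le_lt_trans (graph_mass_haus e0 er mD _).2 _ => //.
  by rewrite (haus_edisc d0 (ltW e0)) -EFinM ltry.
rewrite (image_mass_Rintegral mD nuD mF FK) /mass_integral.
set D := (_ `&` N); pose T := caratheodory_type (mass d M).
pose p (y : T) : borel R d := (y : 'rV[R]_n) *m E^T.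
have mp : measurable_fun setT p.
  apply: continuous_to_borel => U oU; apply: open_mass_measurable.
  by have /continuousP := @continuous_mulmxr R n d E^T; exact.
have mpD : measurable (p @^-1` @edisc R d e) by rewrite -[X in measurable X]setTI; exact: mp.
have mDN : measurable (D : set T) by apply: measurableI => //; exact: open_mass_measurable.
have mFD : measurable_fun (D : set T) (fun y : T => F (G (p y))).
  apply: (measurable_comp mD _ mF); first by move=> _ [y [Dy _] <-].
  exact: measurable_funTS.
pose F1 : T -> \bar R := (fun y : T => (F (G (p y)))%:E) \_ (D : set T).
have mF1 : measurable_fun (setT : set T) F1.
  by apply/(measurable_restrictT _ mDN); exact/measurable_EFinP.
pose m : {measure set T -> \bar R} := mass d M.
have F1F : ae_eq m setT F1 (EFin \o F : T -> \bar R).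
  apply: negligibleS complement_mass0 => y /= + My; apply => _.
  rewrite /F1 patchE; case: ifPn => [|/negP yD].
    by rewrite inE => -[_ Ny]; have [_ ->] := G_cover My (ltW Ny).
  rewrite F0// ltNge; apply/negP => ye; apply: yD; rewrite inE; split.
    exact: le_trans (enorm_coordinates EE _) ye.
  by rewrite /N/=; apply: le_lt_trans ye _; apply: le_lt_trans e2 _; have := delta_gt0; lra.
have mcomplete : measure_is_complete m by exact: measure_is_complete_caratheodory.
have mF2 : measurable_fun (setT : set T) (EFin \o F : T -> \bar R).
  exact: (ae_measurable_fun mcomplete F1F mF1).
have FE := @ae_eq_integral _ T R m setT _ _ measurableT mF1 mF2 F1F.
rewrite /Rintegral [in RHS]integral_mkcond; congr fine.
by move: FE; rewrite /F1 => ->.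
Qed.

Lemma near_ball_lt (x : 'rV[R]_d) : enorm x < r -> \forall y \near x, enorm y < r.
Proof.
by move=> xr; apply: (@continuous_enorm R d x [set t | t < r]); exact: lt_nbhsl.
Qed.

Lemma near_graph (x : 'rV[R]_d) (e : R) : enorm x < r -> 0 < e ->
  \forall y \near x, enorm (G x - G y) <= e.
Proof.
move=> xr e0; have k0 : 0 < 1 + C * r ^+ 2.
  by rewrite ltr_pwDl// mulr_ge0// ?exprn_ge0// ltW.
apply: filterS2 (near_ball_lt xr) (near_enorm x (divr_gt0 e0 k0)) => y yr.
rewrite ler_pdivlMr// mulrC; apply: le_trans.
by apply: (G_area (lexx r)); exact: ltW.
Qed.

End graph_mass.

(** * Integrals over shrinking balls *)

Section sheet_integrals.
Context (R : realType) (n d : nat).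
Hypotheses (d_gt0 : (0 < d)%N) (w_gt0 : 0 < ball_volume R d).
Variables (M : set 'rV[R]_n) (G : 'rV[R]_d -> 'rV[R]_n) (E : 'M[R]_(d, n)) (r C delta : R).
Hypothesis gs : graph_sheet M G E r C delta.

Let nu := graph_mass M E delta.
Let r0 := graph_radius r C delta / 2.
Let r0_gt0 : 0 < r0. Proof. by rewrite divr_gt0// (graph_radius_gt0 gs). Qed.
Let C_ge0 : 0 <= C. Proof. exact: ltW (sheet_cst gs). Qed.
Let C'_ge0 : 0 <= (2 ^+ d - 1) * C.
Proof. by rewrite mulr_ge0// subr_ge0 exprn_ege1// ler1n. Qed.

Let r0P s : 0 <= s -> s <= r0 -> [/\ s <= graph_radius r C delta, s < r & s <= r].
Proof.
move=> s0 sr; have h := graph_radius_gt0 gs.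
have h1 : s < graph_radius r C delta.
  by apply: le_lt_trans sr _; rewrite ltr_pdivrMr// ltr_pMr// ltr1n.
have [h2 _ _] := graph_radiusP gs (ltW h) (lexx _).
by split; [exact: ltW|exact: lt_le_trans h2|exact: le_trans (ltW h1) h2].
Qed.

Let nu_haus s : 0 < s -> s <= r0 ->
  forall A : set (borel R d), measurable A -> A `<=` @edisc R d s ->
  (haus R d A <= nu A /\ nu A <= (1 + (2 ^+ d - 1) * C * s ^+ 2)%:E * haus R d A)%E.
Proof. by move=> s0 /(r0P (ltW s0))[sr _ _]; exact: (graph_mass_haus gs). Qed.

Let nu_fin (e : R) : 0 < e -> e <= r0 -> (nu (@edisc R d e) < +oo)%E.
Proof.
move=> e0 er; apply: le_lt_trans (nu_haus e0 er (@edisc_measurable R d e) _).2 _ => //.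
by rewrite (haus_edisc d_gt0 (ltW e0)) -EFinM ltry.
Qed.

Let G_continuous x : enorm x < r -> {for x, continuous G}.
Proof.
move=> xr; apply: (proj2 (@cvgrPdist_le R _ 'rV[R]_d (nbhs x) _ G (G x))) => e e0.
by apply: filterS (near_graph gs xr e0) => y; exact: le_trans (norm_le_enorm _).
Qed.

Let eG_continuous x : enorm x < r -> {for x, continuous (fun y => enorm (G y))}.
Proof. by move=> xr; apply: continuous_comp; [exact: G_continuous|exact: continuous_enorm]. Qed.

Let eG_sub x : enorm x <= r -> 0 <= enorm (G x) - enorm x <= C * enorm x ^+ 3.
Proof.
move=> /(graph_enorm gs)[h1 h2]; rewrite subr_ge0 h1 /= lerBlDl; apply: le_trans h2 _.
by rewrite le_eqVlt; apply/orP; left; apply/eqP; ring.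
Qed.

Let edisc_open (e : R) (x : 'rV[R]_d) : e <= r0 -> edisc e x -> enorm x < r.
Proof.
by move=> er xe; have [_ + _] := r0P (enorm_ge0 x) (le_trans xe er).
Qed.

Let Gpos x : enorm x < r -> x != 0 -> 0 < enorm (G x).
Proof.
by move=> xr x0; apply: lt_le_trans (graph_enorm gs (ltW xr)).1; rewrite enorm_gt0.
Qed.

Let oU : open [set x : 'rV[R]_d | enorm x < r].
Proof.
by apply: (@open_comp _ _ (@enorm R d) [set t | t < r]) => [y _|];
  [exact: continuous_enorm|exact: open_lt].
Qed.

Let profile_G_continuous (f : R -> R) (K e : R) x : lipschitz_profile f K -> 0 < e ->
  enorm x < r -> x != 0 -> {for x, continuous (fun x => f (enorm (G x) / e))}.
Proof.
move=> fP e0 xr x0; apply: (@continuous_comp _ _ _ (fun x => enorm (G x) / e) f).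
  exact: cvgM (eG_continuous xr) (cvg_cst _).
by apply: (profile_continuous fP); rewrite divr_gt0// Gpos.
Qed.

Lemma sheet_mass_cvg (xi : R -> R) (K : R) : lipschitz_profile xi K ->
  e ^- d * mass_integral d M (fun y => xi (enorm y / e)) @[e --> 0^'+] -->
  disc_mass R d * d%:R * \int[@lebesgue_measure R]_(t in `[0, 1]) (xi t * t ^+ d.-1).
Proof.
move=> xiP; have K0 := profile_bound_ge0 xiP.
have fK (t : R) : 0 <= t <= 1 -> `|xi t| <= K by move=> /andP[t0 _]; exact: (profile_bound xiP).
rewrite -(Rintegral_radial d_gt0 (profile_continuous xiP) (profile_cvg0 xiP) fK).
pose h (e : R) (x : borel R d) : R := e * xi (enorm (G x) / e).
pose k1 (x : borel R d) : R := 0; pose k2 (x : borel R d) : R := xi (enorm (x : 'rV[R]_d)).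
have mk2 : measurable_fun (@edisc R d 1 : set (borel R d)) k2.
  apply: (measurable_off0 openT (@edisc_measurable R d 1)) => // x _ x0; apply: continuous_comp; first exact: continuous_enorm.
  by apply: (profile_continuous xiP); rewrite enorm_gt0.
have mf e : 0 < e -> e <= r0 ->
    measurable_fun (@edisc R d e : set (borel R d)) (fun x : borel R d => xi (enorm (G x) / e)).
  move=> e0 er; apply: (measurable_off0 oU (@edisc_measurable R d e)).
    by move=> x; exact: edisc_open.
  by move=> x xr x0; exact: (profile_G_continuous xiP).
have H := @rescaled_Rintegral_cvg R d d_gt0 nu r0 _ r0_gt0 C'_ge0 nu_haus h k1 k2 K.
have {}H : e ^- d.+1 * \int[nu]_(x in @edisc R d e) h e x @[e --> 0^'+] -->
    \int[haus R d]_(x in @edisc R d 1) k2 x.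
  apply: H => //.
  - by rewrite /k1; exact: measurable_cst.
  - by move=> x _; rewrite normr0.
  - by move=> x x1; apply: (profile_bound xiP); exact: enorm_ge0.
  - by rewrite /k1 Rintegral_cst ?mul0r//; exact: edisc_measurable.
  - by move=> e e0 er; apply: measurable_funM => //; exact: mf.
  - move=> eta eta0; near=> e => x xe.
    have e0 : 0 < e by near: e; exact: nbhs_right_gt.
    have er : e <= r0 by near: e; exact: nbhs_right_le.
    have e1 : e <= 1 by near: e; exact: nbhs_right_le.
    have ee : e <= eta / (K * C + 1).
      by near: e; apply: nbhs_right_le; rewrite divr_gt0// ltr_wpDl// mulr_ge0.
    have xr := edisc_open er xe.
    rewrite add0r -mulrBr normrM (gtr0_norm e0) mulrC ler_pM2r//.
    rewrite /k2 enormZ [`|e^-1|]gtr0_norm ?invr_gt0// [e^-1 * _]mulrC.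
    apply: le_trans (profile_lipschitz xiP _ _) _; [by rewrite divr_ge0 ?enorm_ge0// ltW..|].
    have /andP[a1 a2] := eG_sub (ltW xr).
    rewrite -mulrBl normrM [`|e^-1|]gtr0_norm ?invr_gt0// ger0_norm//.
    rewrite [leLHS](_ : _ = K * (enorm (G x) - enorm x) / e); last by ring.
    rewrite ler_pdivrMr//; apply: (@le_trans _ _ (K * (C * e ^+ 3))).
      apply: ler_wpM2l => //; apply: le_trans a2 _; apply: ler_wpM2l => //.
      by rewrite lerXn2r ?nnegrE ?enorm_ge0// ltW.
    rewrite (_ : K * _ = K * C * e * e * e); last by ring.
    rewrite ler_wpM2r ?(ltW e0)//; apply: (@le_trans _ _ (K * C * e)).
      by rewrite ler_piMr// !mulr_ge0// ltW.
    have kc : 0 <= K * C by rewrite mulr_ge0.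
    by move: ee; rewrite ler_pdivlMr ?ltr_wpDl//; have := ltW e0; nra.
apply: cvg_trans H; apply: near_eq_cvg; near=> e.
have e0 : 0 < e by near: e; exact: nbhs_right_gt.
have er : e <= r0 by near: e; exact: nbhs_right_le.
have [er1 _ _] := r0P (ltW e0) er.
rewrite (@mass_integral_graph _ _ _ _ _ _ _ _ _ gs _ K e)//.
- rewrite RintegralZl//; last first.
    apply: (bounded_integrable (@edisc_measurable R d e) (nu_fin e0 er) (mf e e0 er) (K := K)).
    by move=> x _; apply: (profile_bound xiP); rewrite divr_ge0 ?enorm_ge0// ltW.
    exact: edisc_measurable.
  by rewrite exprS invfM mulrACA mulVf ?mul1r// gt_eqF.
- move=> y ye; apply: (profile_support xiP); rewrite ler_pdivlMr// mul1r; exact: ltW.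
- exact: mf.
- by move=> x _; apply: (profile_bound xiP); rewrite divr_ge0 ?enorm_ge0// ltW.
Unshelve. all: by end_near. Qed.

(** The integrand is compared with its second order expansion in the tangent
    space. Its linear part would give a divergent term, but is odd. *)
Lemma sheet_integral_cvg (eta : R -> R) (K L : R) (u1 u2 w : 'rV[R]_d -> R)
    (F : R -> 'rV[R]_n -> R) : lipschitz_profile eta K -> 0 <= L ->
  continuous u1 -> (forall k x, u1 (k *: x) = k * u1 x) ->
  (forall x, `|u1 x| <= L * enorm x) ->
  continuous u2 -> (forall k x, u2 (k *: x) = k ^+ 2 * u2 x) ->
  (forall x, `|u2 x| <= L * enorm x ^+ 2) ->
  (forall x, enorm x < r -> {for x, continuous w}) ->
  (forall e, 0 < e -> \forall x \near (0 : 'rV[R]_d),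
    `|w x - (u1 x + u2 x)| <= e * enorm x ^+ 2) ->
  (forall e y, 0 < e -> e < enorm y -> F e y = 0) ->
  (forall e x, 0 < e -> enorm x <= r ->
    F e (G x) = eta (enorm (G x) / e) / enorm (G x) * w x) ->
  e ^- d.+1 * mass_integral d M (F e) @[e --> 0^'+] -->
  \int[haus R d]_(x in @edisc R d 1)
    (eta (enorm (x : 'rV[R]_d)) / enorm (x : 'rV[R]_d) * u2 x).
Proof.
move=> etaP L0 cu1 u1Z u1L cu2 u2Z u2L cw wu F0 FG.
have K0 := profile_bound_ge0 etaP.
have cf := profile_continuous etaP; have cf0 := profile_cvg0 etaP.
have fK (t : R) : 0 <= t <= 1 -> `|eta t| <= K by move=> /andP[t0 _]; exact: (profile_bound etaP).
have u2L1 x : edisc 1 x -> `|u2 x| <= L * enorm x.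
  move=> x1; apply: le_trans (u2L x) _; apply: ler_wpM2l => //.
  by rewrite expr2 ler_piMr// enorm_ge0.
pose h (e : R) (x : borel R d) : R := eta (enorm (G x) / e) / enorm (G x) * w x.
pose k (u : 'rV[R]_d -> R) (x : borel R d) : R :=
  eta (enorm (x : 'rV[R]_d)) / enorm (x : 'rV[R]_d) * u x.
pose q x := u1 x + u2 x.
have qL2 x : enorm x <= 1 -> `|q x| <= 2 * L * enorm x.
  move=> x1; apply: le_trans (ler_normD _ _) _.
  rewrite -mulrA mulr_natl mulr2n; apply: lerD; [exact: u1L|exact: u2L1].
have mh e : 0 < e -> e <= r0 -> measurable_fun (@edisc R d e : set (borel R d)) (h e).
  move=> e0 er; apply: (measurable_off0 oU (@edisc_measurable R d e)).
    by move=> x; exact: edisc_open.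
  move=> x xr x0.
  have hV : (enorm (G y))^-1 @[y --> x] --> (enorm (G x))^-1.
    apply: (@cvgV R _ (nbhs x) _ (fun y => enorm (G y)) (enorm (G x))).
      by rewrite gt_eqF// Gpos.
    exact: eG_continuous.
  exact: cvgM (cvgM (profile_G_continuous etaP e0 xr x0) hV) (cw x xr).
have hk a : 0 < a -> \forall e \near 0^'+, forall x : 'rV[R]_d, edisc e x ->
    `|h e x - (k u1 (e^-1 *: x) + e * k u2 (e^-1 *: x))| <= a * e.
  move=> a0; have a1 : 0 < a / 2 / (K + 1) by rewrite !divr_gt0// ltr_wpDl.
  have [b b0 bP] := near_edisc (wu _ a1).
  near=> e => x xe.
  have e0 : 0 < e by near: e; exact: nbhs_right_gt.
  have er : e <= r0 by near: e; exact: nbhs_right_le.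
  have e1 : e <= 1 by near: e; exact: nbhs_right_le.
  have eb : e <= b by near: e; exact: nbhs_right_le.
  have ee : e <= a / 2 / (4 * (K * C * L) + 1).
    by near: e; apply: nbhs_right_le; rewrite !divr_gt0// ltr_wpDl// !mulr_ge0.
  have xr := edisc_open er xe.
  have [->|x0] := eqVneq x 0.
    rewrite /h /k (sheet0 gs) scaler0 !enorm0 !invr0 !mulr0 !mul0r mulr0 addr0 subr0.
    by rewrite normr0 mulr_ge0// ltW.
  set s := enorm x; set S := enorm (G x).
  have s0 : 0 < s by rewrite enorm_gt0.
  have S0 : 0 < S by exact: Gpos.
  have /andP[sS SC] := eG_sub (ltW xr); rewrite -/s -/S in sS SC.
  have se : s <= e by [].
  have -> : k u1 (e^-1 *: x) + e * k u2 (e^-1 *: x) = eta (s / e) / s * q x.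
    rewrite /k u1Z u2Z enormZ [`|e^-1|]gtr0_norm ?invr_gt0// -/s [e^-1 * s]mulrC.
    by rewrite /q; field; rewrite !gt_eqF.
  have -> : h e x - eta (s / e) / s * q x = eta (S / e) / S * (w x - q x) +
      ((eta (S / e) - eta (s / e)) / S - eta (s / e) * (S - s) / (s * S)) * q x.
    by rewrite /h -/S; field; rewrite !gt_eqF.
  have e1S : `|eta (S / e)| <= K by apply: (profile_bound etaP); rewrite divr_ge0// ltW.
  have e1s : `|eta (s / e)| <= K by apply: (profile_bound etaP); rewrite divr_ge0// ltW.
  have wq : `|w x - q x| <= a / 2 / (K + 1) * s ^+ 2 by apply: bP; exact: le_trans xe eb.
  have qL := qL2 _ (le_trans se e1); rewrite -/s in qL.
  have T1 : `|eta (S / e) / S * (w x - q x)| <= a / 2 * e.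
    rewrite !normrM (gtr0_norm (_ : 0 < S^-1)) ?invr_gt0//.
    apply: (@le_trans _ _ (K * s^-1 * (a / 2 / (K + 1) * s ^+ 2))).
      apply: ler_pM => //; first by rewrite mulr_ge0// ltW// invr_gt0.
      apply: ler_pM => //; first by rewrite ltW// invr_gt0.
      by rewrite lef_pV2 ?posrE// -subr_ge0.
    have K1 : 0 < K + 1 by rewrite ltr_wpDl.
    rewrite [leLHS](_ : _ = a / 2 * (K / (K + 1)) * s); last by field; rewrite !gt_eqF.
    apply: ler_pM => //; [by rewrite mulr_ge0 ?divr_ge0// ltW|exact: ltW|].
    by rewrite ler_piMr ?divr_ge0 ?(ltW a0)// ler_pdivrMr// mul1r lerDl.
  have SC' : (S - s) / S <= C * s ^+ 2.
    rewrite ler_pdivrMr//; apply: le_trans SC _.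
    rewrite exprSr mulrA; apply: ler_wpM2l; first by rewrite mulr_ge0// exprn_ge0// ltW.
    by rewrite -subr_ge0.
  have sS' : 0 <= (S - s) / S by rewrite divr_ge0// ltW.
  have T2 : `|(eta (S / e) - eta (s / e)) / S| <= K * C * s.
    rewrite normrM (gtr0_norm (_ : 0 < S^-1)) ?invr_gt0//.
    have := profile_lipschitz etaP (_ : 0 <= S / e) (_ : 0 <= s / e).
    rewrite !divr_ge0 ?(ltW S0) ?(ltW s0) ?(ltW e0)// => /(_ isT isT).
    rewrite -mulrBl normrM (ger0_norm sS) (gtr0_norm (_ : 0 < e^-1)) ?invr_gt0// => h1.
    apply: (@le_trans _ _ (K * ((S - s) / e) / S)).
      by rewrite ler_wpM2r// invr_ge0 ltW.
    rewrite [leLHS](_ : _ = K * ((S - s) / S) / e); last by ring.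
    rewrite ler_pdivrMr// -!mulrA; apply: ler_wpM2l => //; apply: le_trans SC' _.
    by rewrite expr2 mulrA mulrA; apply: ler_wpM2l => //; rewrite mulr_ge0// ltW.
  have T3 : `|eta (s / e) * (S - s) / (s * S)| <= K * C * s.
    rewrite (_ : _ / _ = eta (s / e) * ((S - s) / S / s)); last by field; rewrite !gt_eqF.
    rewrite normrM -[leRHS]mulrA; apply: ler_pM => //.
    rewrite ger0_norm ?divr_ge0// ?(ltW s0) ?(ltW S0)// ler_pdivrMr//; apply: le_trans SC' _.
    by rewrite expr2 mulrA.
  rewrite [leRHS](_ : _ = a / 2 * e + a / 2 * e); last by field.
  apply: le_trans (ler_normD _ _) _; apply: lerD => //.
  rewrite normrM; apply: (@le_trans _ _ ((K * C * s + K * C * s) * (2 * L * s))).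
    apply: ler_pM => //; apply: le_trans (ler_normB _ _) _; exact: lerD.
  have kcl : 0 <= K * C * L by rewrite !mulr_ge0.
  rewrite [leLHS](_ : _ = 4 * (K * C * L) * s * s); last by ring.
  apply: ler_pM => //; [by rewrite !mulr_ge0// ltW|exact: ltW|].
  apply: (@le_trans _ _ (4 * (K * C * L) * e)); first by rewrite ler_wpM2l// mulr_ge0.
  move: ee; rewrite ler_pdivlMr ?ltr_wpDl ?mulr_ge0// mulrDr mulr1 [e * _]mulrC.
  by apply: le_trans; rewrite lerDl ltW.
have H := @rescaled_Rintegral_cvg R d d_gt0 nu r0 _ r0_gt0 C'_ge0 nu_haus h (k u1) (k u2) (K * L).
have {}H : e ^- d.+1 * \int[nu]_(x in @edisc R d e) h e x @[e --> 0^'+] -->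
    \int[haus R d]_(x in @edisc R d 1) k u2 x.
  apply: H => //.
  - exact: (kernel_measurable cf (@edisc_measurable R d 1) cu1).
  - exact: (kernel_measurable cf (@edisc_measurable R d 1) cu2).
  - by move=> x x1; apply: (kernel_bound fK L0 _ x1) => y _; exact: u1L.
  - by move=> x x1; apply: (kernel_bound fK L0 _ x1).
  - apply: (kernel_odd_moment d_gt0 cf fK L0 cu1 (fun x _ => u1L x)) => x.
    by rewrite -scaleN1r u1Z mulN1r.
apply: cvg_trans H; apply: near_eq_cvg.
have [b b0 bP] := near_edisc (wu 1 ltr01).
near=> e.
have e0 : 0 < e by near: e; exact: nbhs_right_gt.
have er : e <= r0 by near: e; exact: nbhs_right_le.
have e1 : e <= 1 by near: e; exact: nbhs_right_le.
have eb : e <= b by near: e; exact: nbhs_right_le.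
have [er1 _ _] := r0P (ltW e0) er.
have FGe x : edisc e x -> F e (G x) = h e x.
  by move=> xe; apply: FG => //; apply: ltW; exact: edisc_open er xe.
rewrite (@mass_integral_graph _ _ _ _ _ _ _ _ _ gs _ (K * (2 * L + 1)) e)//.
- by congr (_ * _); apply: eq_Rintegral => x; rewrite inE => xe; rewrite FGe.
- by move=> y; exact: F0.
- apply: eq_measurable_fun (mh e e0 er) => x; rewrite inE => xe.
  by rewrite /= FGe.
- move=> x xe; rewrite FGe//.
  have [->|x0] := eqVneq x 0.
    rewrite /h (sheet0 gs) enorm0 invr0 mulr0 mul0r normr0 mulr_ge0// addr_ge0//.
    exact: mulr_ge0.
  have xr := edisc_open er xe; have s0 : 0 < enorm x by rewrite enorm_gt0.
  have S0 := Gpos xr x0.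
  rewrite /h -mulrA normrM; apply: ler_pM => //.
    by apply: (profile_bound etaP); rewrite divr_ge0// ltW.
  rewrite normrM (gtr0_norm (_ : 0 < (enorm (G x))^-1)) ?invr_gt0// ler_pdivrMl//.
  rewrite mulrC; apply: (@le_trans _ _ ((2 * L + 1) * enorm x)); last first.
    apply: ler_wpM2l; first by rewrite addr_ge0// mulr_ge0.
    exact: (graph_enorm gs (ltW xr)).1.
  rewrite -(subrK (q x) (w x)) mulrDl mul1r addrC; apply: le_trans (ler_normD _ _) _.
  apply: lerD; first by apply: qL2; exact: le_trans xe e1.
  apply: le_trans (bP _ (le_trans xe eb)) _; rewrite mul1r expr2.
  by apply: ler_piMl; [exact: ltW|exact: le_trans xe e1].
Unshelve. all: by end_near. Qed.

End sheet_integrals.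

(** * The limit of the approximate mean curvature *)

Section continuity_at.
Context (R : realType) (n d : nat).

Definition econtinuous (x : 'rV[R]_d) (F : 'rV[R]_d -> 'rV[R]_n) : Prop :=
  forall e, 0 < e -> \forall y \near x, enorm (F x - F y) <= e.

Lemma econtinuous_coord x F (i : 'I_n) : econtinuous x F -> {for x, continuous (fun y => F y 0 i)}.
Proof.
move=> cF; apply: (proj2 (@cvgrPdist_le R R 'rV[R]_d (nbhs x) _ (fun y => F y 0 i) (F x 0 i))).
move=> e /cF; apply: filterS => y; apply: le_trans.
by rewrite (_ : F x 0 i - F y 0 i = (F x - F y) 0 i) ?coord_enorm// !mxE.
Qed.

Lemma econtinuous_lipschitz x F (P : 'rV[R]_n -> 'rV[R]_n) (L : R) : 0 < L ->
  (forall u v, enorm (P u - P v) <= L * enorm (u - v)) ->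
  econtinuous x F -> econtinuous x (fun y => P (F y)).
Proof.
move=> L0 PL cF e e0; apply: filterS (cF _ (divr_gt0 e0 L0)) => y.
by rewrite ler_pdivlMr// mulrC; apply: le_trans.
Qed.

Lemma econtinuousB x F G : econtinuous x F -> econtinuous x G -> econtinuous x (fun y => F y - G y).
Proof.
move=> cF cG e e0; have e1 : 0 < e / 2 by rewrite divr_gt0.
apply: filterS2 (cF _ e1) (cG _ e1) => y h1 h2.
rewrite (_ : _ - _ = (F x - F y) - (G x - G y)); last first.
  by rewrite !opprB addrACA [- G x + _]addrC addrACA.
by apply: le_trans (enormB _ _) _; rewrite [e]splitr lerD.
Qed.

Lemma econtinuousZ x F (k : R) : econtinuous x F -> econtinuous x (fun y => k *: F y).
Proof.
apply: (@econtinuous_lipschitz x F _ (`|k| + 1)); first by rewrite ltr_wpDl.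
by move=> u v; rewrite -scalerBr enormZ ler_wpM2r ?enorm_ge0// lerDl.
Qed.

End continuity_at.

Section limit.
Context (R : realType) (n d : nat).
Variables (M U : set 'rV[R]_n) (V : set 'rV[R]_d) (phi : 'rV[R]_d -> 'rV[R]_n)
  (J : 'rV[R]_d -> 'M[R]_(d, n)) (psi : 'rV[R]_n -> 'rV[R]_d)
  (E : 'M[R]_(d, n)) (Q : 'rV[R]_d -> 'rV[R]_d -> 'rV[R]_n).
Hypotheses (ch : chart M U V phi J psi) (V0 : V 0) (phi0 : phi 0 = 0)
  (J0 : J 0 = E) (EE : E *m E^T = 1%:M) (QL : bilinear_map Q).
Hypothesis JQ : forall e, 0 < e -> \forall y \near (0 : 'rV[R]_d), forall w : 'rV[R]_d,
  enorm (w *m J y - w *m E - Q w y) <= e * enorm w * enorm y.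
Variables (r C delta : R) (g : 'rV[R]_d -> 'rV[R]_d).
Hypotheses (r_gt0 : 0 < r) (C_gt0 : 0 < C) (delta_gt0 : 0 < delta)
  (gr : graph_chart M V phi J E r C delta g).

Let T := proj (row_space E).
Let TP : has_proj (row_space E).
Proof. exact/row_space_has_proj/orthonormal_free. Qed.

Let S x := proj (row_space (J (g x))).
Let SP x : enorm x <= r -> has_proj (row_space (J (g x))).
Proof. by move=> /(graph_in gr) /(chart_free ch) /row_space_has_proj. Qed.

Let G x := phi (g x).

Lemma graph_chart_sheet : graph_sheet M G E r C delta.
Proof.
split => //.
- move=> x /(graph_in gr) Vx; have : (phi @` V) (G x) by exists (g x).
  by rewrite (chart_image ch) => -[].
- exact: (graph_coord gr).
- have h0 : enorm (0 : 'rV[R]_d) <= r by rewrite enorm0 ltW.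
  have := graph_id gr h0; rewrite subr0 enorm0 expr0n mulr0 => h.
  rewrite /G (_ : g 0 = 0)//; apply: enorm0_eq0; apply/eqP.
  by rewrite eq_le enorm_ge0 h.
- exact: (graph_area gr).
- exact: (graph_cover gr).
Qed.
Let gs := graph_chart_sheet.

Lemma econtinuous_graph x : enorm x < r -> econtinuous x G.
Proof. by move=> xr e e0; exact: (near_graph gs xr e0). Qed.

Lemma econtinuous_tangent (x : 'rV[R]_d) (F : 'rV[R]_d -> 'rV[R]_n) :
  econtinuous x F -> econtinuous x (fun y => T (F y)).
Proof.
by apply: (econtinuous_lipschitz ltr01) => u v; rewrite -(projB TP) mul1r (enorm_proj TP).
Qed.

Lemma econtinuous_plane (x : 'rV[R]_d) (F : 'rV[R]_d -> 'rV[R]_n) :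
  enorm x < r -> econtinuous x F -> econtinuous x (fun y => S y (F y)).
Proof.
move=> xr cF e e0; have e1 : 0 < e / 2 by rewrite divr_gt0.
have k0 : 0 < enorm (F x) + 1 by rewrite ltr_wpDl// enorm_ge0.
have := graph_plane_continuous ch EE gr (ltW xr) (divr_gt0 e1 k0).
apply: filterS3 (near_ball_lt xr) (cF _ e1) => y yr h1 /(_ (ltW yr) (F x)) h2.
have h3 := enorm_proj (SP (ltW yr)) (F x - F y); rewrite (projB (SP (ltW yr))) in h3.
apply: le_trans (enorm_distD (S y (F x)) _ _) _; rewrite [e]splitr; apply: lerD.
  rewrite enormBC; apply: le_trans h2 _; rewrite mulrAC ler_pdivrMr//.
  by rewrite ler_wpM2l ?(ltW e1)// lerDl.
exact: le_trans h3 h1.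
Qed.

Let b (j l : 'I_d) := perp T (Q (delta_mx 0 j) (delta_mx 0 l)).
Let B := normal_form E Q.

Let perp_sum (I : Type) (s : seq I) (F : I -> 'rV[R]_n) :
  perp T (\sum_(i <- s) F i) = \sum_(i <- s) perp T (F i).
Proof.
elim: s => [|i s IH]; rewrite ?(big_nil, big_cons) ?(perpD TP) ?IH//.
exact: (perp_in TP (has_proj0 TP)).
Qed.

Lemma normal_formE x i : B x 0 i = \sum_j \sum_l x 0 j * x 0 l * b j l 0 i.
Proof.
rewrite /B /normal_form (bilinearE QL) perp_sum summxE; apply: eq_bigr => j _.
by rewrite perp_sum summxE; apply: eq_bigr => l _; rewrite (perpZ TP) mxE.
Qed.

Let continuous_sumR (I : Type) (s : seq I) (F : I -> 'rV[R]_d -> R) :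
  (forall i, continuous (F i)) -> continuous (fun x => \sum_(i <- s) F i x).
Proof.
move=> cF x; elim: s => [|i s IH].
  rewrite (_ : (fun _ => _) = fun=> 0); first exact: cst_continuous.
  by apply/funext => y; rewrite big_nil.
rewrite (_ : (fun _ => _) = fun y => F i y + \sum_(j <- s) F j y).
  exact: cvgD (cF i x) IH.
by apply/funext => y; rewrite big_cons.
Qed.

Section profiles.
Hypotheses (d_gt0 : (0 < d)%N) (w_gt0 : 0 < ball_volume R d).
Variables (rho xi eta : R -> R) (Kx K : R).
Let Irho := \int[@lebesgue_measure R]_(t in `[0, 1]) (rho t * t ^+ d.-1).
Let Ixi := \int[@lebesgue_measure R]_(t in `[0, 1]) (xi t * t ^+ d.-1).
Hypotheses (xiP : lipschitz_profile xi Kx) (etaP : lipschitz_profile eta K)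
  (rho_eta : forall t, 0 < t -> derive1 rho t = eta t)
  (Ieta : \int[@lebesgue_measure R]_(t in `[0, 1]) (eta t * t ^+ d) = - d%:R * Irho)
  (Irho0 : Irho != 0) (Ixi0 : Ixi != 0).

(** The term in [alpha] is odd and disappears. The trace of [B] is multiplied by the
    same constants as in the ratio of [profile_cst d xi] and [profile_cst d rho]. *)
Lemma approx_mean_curvature_graph (Pi : 'rV[R]_n -> 'rV[R]_n -> 'rV[R]_n)
    (W : 'rV[R]_d -> 'rV[R]_n) (alpha beta : R) :
  (forall x k, enorm x <= r -> Pi (G x) (k *: G x) = k *: W x) ->
  (forall x, enorm x < r -> econtinuous x W) ->
  small2 (fun x => W x - (alpha *: (x *m E) + beta *: B x)) ->
  approx_mean_curvature d rho xi Pi M eps @[eps --> 0^'+] --> beta *: \sum_i b i i.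
Proof.
move=> PiW cW sW; have [L0 L00 LQ] := bilinear_bound QL.
pose c := disc_mass R d.
have c0 : c != 0 by rewrite gt_eqF// disc_mass_gt0.
have nd0 : d%:R != 0 :> R by rewrite pnatr_eq0 -lt0n.
have w0 : ball_volume R d != 0 by rewrite gt_eqF.
suff coord i : (approx_mean_curvature d rho xi Pi M eps) 0 i @[eps --> 0^'+] -->
    (beta *: \sum_i b i i) 0 i.
  apply/cvg_ballP => a a0.
  have : \forall eps \near 0^'+, forall i : 'I_n,
      ball ((beta *: \sum_i b i i) 0 i) a ((approx_mean_curvature d rho xi Pi M eps) 0 i).
    by apply: filter_forall => i; move/cvg_ballP: (coord i); exact.
  by apply: filterS => eps h; split => // i0 i; rewrite ord1.
pose F e (y : 'rV[R]_n) :=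
  (derive1 rho (enorm y / e) *: Pi y ((enorm y)^-1 *: y)) 0 i.
pose u1 (x : 'rV[R]_d) : R := alpha * (x *m E) 0 i.
pose u2 x : R := beta * B x 0 i.
pose L := `|alpha| + `|beta| * L0.
have [L1 L2] : `|alpha| <= L /\ `|beta| * L0 <= L.
  by rewrite lerDl lerDr mulr_ge0.
have num : e ^- d.+1 * mass_integral d M (F e) @[e --> 0^'+] -->
    c * (- d%:R * Irho) * \sum_j beta * b j j 0 i.
  have cf := profile_continuous etaP; have cf0 := profile_cvg0 etaP.
  have fK (t : R) : 0 <= t <= 1 -> `|eta t| <= K.
    by move=> /andP[t0 _]; exact: (profile_bound etaP).
  rewrite -Ieta -(kernel_second_moment d_gt0 cf cf0 fK (fun j l => beta * b j l 0 i)).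
  have u2E (x : 'rV[R]_d) : \sum_j \sum_l x 0 j * x 0 l * (beta * b j l 0 i) = u2 x.
    rewrite /u2 normal_formE mulr_sumr; apply: eq_bigr => j _.
    by rewrite mulr_sumr; apply: eq_bigr => l _; rewrite mulrCA.
  under eq_Rintegral do rewrite u2E.
  apply: (@sheet_integral_cvg _ _ _ d_gt0 w_gt0 _ _ _ _ _ _ gs eta K L u1 u2 (fun x => W x 0 i)).
  - exact: etaP.
  - by rewrite addr_ge0// mulr_ge0.
  - apply: (@elipschitz_continuous R d R u1 (`|alpha| + 1)) => [|x y].
      by rewrite ltr_wpDl.
    rewrite /u1 -mulrBr normrM (_ : _ - _ = ((x - y) *m E) 0 i); last first.
      by rewrite mulmxBl !mxE.
    apply: ler_pM => //; first by rewrite lerDl.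
    by apply: le_trans (coord_enorm _ _) _; rewrite (enorm_isometry _ EE).
  - by move=> k x; rewrite /u1 -scalemxAl mxE mulrCA.
  - move=> x; rewrite /u1 normrM; apply: ler_pM => //.
    by apply: le_trans (coord_enorm _ _) _; rewrite (enorm_isometry _ EE).
  - rewrite (_ : u2 = fun x => \sum_j \sum_l x 0 j * x 0 l * (beta * b j l 0 i)); last first.
      by apply/funext => x; rewrite u2E.
    apply: continuous_sumR => j; apply: continuous_sumR => l x.
    exact: cvgM (cvgM (@coord_continuous R _ _ 0 j x) (@coord_continuous R _ _ 0 l x)) (cvg_cst _).
  - move=> k x; rewrite /u2 /B /normal_form (bilinearZl QL) (bilinearZr QL) scalerA.
    by rewrite (perpZ TP) mxE expr2 mulrCA.
  - move=> x; rewrite /u2 normrM; apply: (@le_trans _ _ (`|beta| * (L0 * enorm x ^+ 2))).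
      apply: ler_wpM2l => //; apply: le_trans (coord_enorm _ _) _.
      by apply: le_trans (enorm_perp TP _) _; rewrite expr2 mulrA; exact: LQ.
    by rewrite mulrA ler_wpM2r// exprn_ge0// enorm_ge0.
  - by move=> x xr; apply: econtinuous_coord; exact: cW.
  - move=> e e0; apply: filterS (sW e e0) => x; apply: le_trans.
    rewrite (_ : _ - _ = (W x - (alpha *: (x *m E) + beta *: B x)) 0 i).
      exact: coord_enorm.
    by rewrite /u1 /u2; move: (x *m E) (B x) => v1 v2; rewrite !mxE.
  - move=> e y e0 ye; rewrite /F rho_eta; last by rewrite divr_gt0// (lt_trans e0).
    by rewrite (profile_support etaP) ?scale0r ?mxE// ler_pdivlMr// mul1r ltW.
  - move=> e x e0 xr; rewrite /F PiW// !mxE.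
    have [->|x0] := eqVneq x 0; first by rewrite (sheet0 gs) enorm0 invr0 !(mul0r, mulr0).
    have S0 : 0 < enorm (G x).
      by apply: lt_le_trans (graph_enorm gs xr).1; rewrite enorm_gt0.
    by rewrite rho_eta ?divr_gt0// mulrA.
have den := sheet_mass_cvg d_gt0 w_gt0 gs xiP.
have den0 : c * d%:R * Ixi != 0 by rewrite !mulf_neq0.
pose X e := e ^- d * mass_integral d M (fun y : 'rV[R]_n => xi (enorm y / e)).
pose Y e := e ^- d.+1 * mass_integral d M (F e).
have cv : (X e)^-1 * Y e @[e --> 0^'+] -->
    (c * d%:R * Ixi)^-1 * (c * (- d%:R * Irho) * \sum_j beta * b j j 0 i).
  exact: (@cvgM R R 0^'+ _ (fun e => (X e)^-1) Y _ _ (cvgV den0 den) num).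
have := @cvgM R R 0^'+ _ (fun=> - (profile_cst d xi / profile_cst d rho)) _ _ _ (cvg_cst _) cv.
have -> : (beta *: \sum_i b i i) 0 i =
    - (profile_cst d xi / profile_cst d rho) *
    ((c * d%:R * Ixi)^-1 * (c * (- d%:R * Irho) * \sum_j beta * b j j 0 i)).
  rewrite mxE summxE -mulr_sumr /profile_cst -/Ixi -/Irho.
  by field; rewrite c0 nd0 w0 Irho0 Ixi0.
rewrite (_ : (fun eps => _ 0 i) =
    (fun=> - (profile_cst d xi / profile_cst d rho)) \* (fun e => (X e)^-1 * Y e)).
  by apply.
by apply/funext => e; rewrite /approx_mean_curvature !mxE.
Qed.


Let tproj0 : tproj M 0 = T.
Proof. by rewrite /tproj -phi0 (chart_tangent_space ch V0) J0. Qed.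

Let tprojG x : enorm x <= r -> tproj M (G x) = S x.
Proof. by move=> /(graph_in gr) Vx; rewrite /tproj (chart_tangent_space ch Vx). Qed.

Let TG x : enorm x <= r -> T (G x) = x *m E.
Proof. by move=> xr; rewrite /T (proj_orthonormal _ EE) (sheet_coord gs xr). Qed.

Let near_r : \forall x \near (0 : 'rV[R]_d), enorm x <= r.
Proof.
by have := near_enorm (0 : 'rV[R]_d) r_gt0; apply: filterS => x; rewrite sub0r enormN.
Qed.

Let height : small2 (fun x => perp T (G x) - 2^-1 *: B x).
Proof. exact: (graph_height ch V0 phi0 EE QL JQ r_gt0 C_gt0 gr). Qed.

Let position : small2 (fun x => perp (S x) (G x) + 2^-1 *: B x).
Proof. exact: (graph_position ch V0 phi0 EE QL JQ r_gt0 C_gt0 gr). Qed.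

Let height_perp : small2 (fun x => perp (S x) (perp T (G x)) - 2^-1 *: B x).
Proof. exact: (graph_height_perp ch V0 phi0 EE QL JQ r_gt0 C_gt0 gr). Qed.

Let perp_plane_T x : enorm x <= r ->
  perp (S x) (T (G x)) = perp (S x) (G x) - perp (S x) (perp T (G x)).
Proof. by move=> xr; rewrite -(perpB (SP xr)) /perp subKr. Qed.

Let tangent_position : small2 (fun x => T (perp (S x) (G x))).
Proof.
apply: (@small2_le _ _ _ _ _ 1 ler01 _ position); apply: filterS near_r => x xr.
have TB : T (B x) = 0.
  apply: (proj_unique TP); first exact: (has_proj0 TP).
  by move=> w Ew; rewrite subr0; exact: (perp_orthogonal TP).
rewrite mul1r (_ : T _ = T (perp (S x) (G x) + 2^-1 *: B x)); first exact: (enorm_proj TP).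
rewrite [RHS](projD TP) [proj _ (2^-1 *: _)](projZ TP).
by rewrite [proj _ (B x)]TB scaler0 addr0.
Qed.

Let cS x F : enorm x < r -> econtinuous x F -> econtinuous x (fun y => perp (S y) (F y)).
Proof. by move=> xr cF; apply: econtinuousB => //; exact: econtinuous_plane. Qed.

Let cT (x : 'rV[R]_d) (F : 'rV[R]_d -> 'rV[R]_n) :
  econtinuous x F -> econtinuous x (fun y => perp T (F y)).
Proof. by move=> cF; apply: econtinuousB => //; exact: econtinuous_tangent. Qed.

Let TZ k u : T (k *: u) = k *: T u. Proof. exact: projZ. Qed.

Let TB u v : T (u - v) = T u - T v. Proof. exact: projB. Qed.

Let SZ x k u : enorm x <= r -> S x (k *: u) = k *: S x u.
Proof. by move=> xr; exact: projZ (SP xr) _ _. Qed.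

(** In each case [Pi (G x) (G x)] is split with [T^perp] or [S^perp] into [T (G x)],
    which is [x *m E], and terms that the three expansions above turn into multiples
    of [2^-1 *: B x] or into [o(|x|^2)]. *)
Lemma approx_mean_curvature_limits
    (T' := tproj M 0) (S' := fun y => tproj M y) :
  (forall Pi : 'rV[R]_n -> 'rV[R]_n -> 'rV[R]_n,
    [\/ Pi = (fun y u => 2 *: perp (S' y) (perp T' u)),
        Pi = (fun y u => S' y (T' u))
      | Pi = (fun y u => - perp (S' y) (T' u))] ->
    approx_mean_curvature d rho xi Pi M eps @[eps --> 0^'+] --> \sum_i b i i) /\
  (forall Pi : 'rV[R]_n -> 'rV[R]_n -> 'rV[R]_n,
    [\/ Pi = (fun y u => T' u), Pi = (fun y u => T' (S' y u)),
        Pi = (fun y u => S' y (perp T' u))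
      | Pi = (fun y u => T' (perp (S' y) u))] ->
    approx_mean_curvature d rho xi Pi M eps @[eps --> 0^'+] --> (0 : 'rV[R]_n)).
Proof.
rewrite /T' /S' tproj0; split => Pi.
  rewrite -[\sum_i b i i]scale1r; case=> ->.
  - apply: (@approx_mean_curvature_graph _
      (fun x => 2 *: perp (S x) (perp T (G x))) 0 1) => [x k xr|x xr|].
    + rewrite tprojG// (perpZ TP) (perpZ (SP xr)) -/(S x) -/T.
      by move: (perp (S x) _) => v; apply/rowP => i; rewrite !mxE; ring.
    + by apply: econtinuousZ; apply: cS => //; apply: cT; exact: econtinuous_graph.
    + apply: small2_ext (small2Z 2 height_perp); apply: filterS near_r => x _.
      rewrite scale0r add0r scale1r.
      move: (perp (S x) (perp T (G x))) (B x) => v1 v2.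
      by apply/rowP => i; rewrite !mxE; field.
  - apply: (@approx_mean_curvature_graph _ (fun x => S x (T (G x))) 1 1) => [x k xr|x xr|].
    + by rewrite tprojG// TZ (SZ _ _ xr).
    + by apply: econtinuous_plane => //; apply: econtinuous_tangent; exact: econtinuous_graph.
    + apply: small2_ext (small2B height_perp position); apply: filterS near_r => x xr.
      rewrite (_ : S x (T (G x)) = T (G x) - perp (S x) (T (G x))); last first.
        by rewrite /perp subKr.
      rewrite (perp_plane_T xr) (TG xr) !scale1r.
      move: (perp (S x) (perp T (G x))) (perp (S x) (G x)) (x *m E) (B x) => v1 v2 v3 v4.
      by apply/rowP => i; rewrite !mxE; field.
  - apply: (@approx_mean_curvature_graph _ (fun x => - perp (S x) (T (G x))) 0 1) => [x k xr|x xr|].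
    + by rewrite tprojG// TZ (perpZ (SP xr)) scalerN.
    + under eq_fun do rewrite -scaleN1r.
      by apply: econtinuousZ; apply: cS => //; apply: econtinuous_tangent; exact: econtinuous_graph.
    + apply: small2_ext (small2B height_perp position); apply: filterS near_r => x xr.
      rewrite (perp_plane_T xr) scale0r add0r scale1r.
      move: (perp (S x) (perp T (G x))) (perp (S x) (G x)) (B x) => v1 v2 v3.
      by apply/rowP => i; rewrite !mxE; field.
rewrite -(scale0r (\sum_i b i i)); case=> ->.
- apply: (@approx_mean_curvature_graph _ (fun x => T (G x)) 1 0) => [x k xr|x xr|].
  + by rewrite TZ.
  + by apply: econtinuous_tangent; exact: econtinuous_graph.
  + apply: small2_ext (small2Z 0 position); apply: filterS near_r => x xr.
    by rewrite (TG xr) scale1r !scale0r addr0 subrr.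
- apply: (@approx_mean_curvature_graph _ (fun x => T (S x (G x))) 1 0) => [x k xr|x xr|].
  + by rewrite tprojG// (SZ _ _ xr) TZ.
  + by apply: econtinuous_tangent; apply: econtinuous_plane => //; exact: econtinuous_graph.
  + apply: small2_ext (small2N tangent_position); apply: filterS near_r => x xr.
    rewrite (_ : S x (G x) = G x - perp (S x) (G x)); last by rewrite /perp subKr.
    by rewrite TB (TG xr) scale1r scale0r addr0 addrAC subrr add0r.
- apply: (@approx_mean_curvature_graph _ (fun x => S x (perp T (G x))) 0 0) => [x k xr|x xr|].
  + by rewrite tprojG// (perpZ TP) (SZ _ _ xr).
  + by apply: econtinuous_plane => //; apply: cT; exact: econtinuous_graph.
  + apply: small2_ext (small2B height height_perp); apply: filterS near_r => x xr.
    rewrite (_ : S x (perp T (G x)) = perp T (G x) - perp (S x) (perp T (G x))); last first.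
      by rewrite [perp (S x) _]/perp subKr.
    move: (perp (S x) (perp T (G x))) (perp T (G x)) (B x) => v1 v2 v3.
    by apply/rowP => i; rewrite !mxE; ring.
- apply: (@approx_mean_curvature_graph _ (fun x => T (perp (S x) (G x))) 0 0) => [x k xr|x xr|].
  + by rewrite tprojG// (perpZ (SP xr)) TZ.
  + by apply: econtinuous_tangent; apply: cS => //; exact: econtinuous_graph.
  + apply: small2_ext tangent_position; apply: filterS near_r => x xr.
    by rewrite !scale0r addr0 subr0.
Qed.

End profiles.
End limit.

Theorem proposition2p2 (R : realType) (n d : nat) (rho xi : R -> R)
    (M : set 'rV[R]_n)
    (hrho : profile rho) (hxi : profile xi)
    (hCrho : profile_cst d rho <> 0) (hCxi : profile_cst d xi <> 0)
    (hM : C2_submanifold d M) (h0 : M 0) :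
  let T : 'rV[R]_n -> 'rV[R]_n := tproj M 0 in
  let S : 'rV[R]_n -> 'rV[R]_n -> 'rV[R]_n := fun y => tproj M y in
  (forall Pi : 'rV[R]_n -> 'rV[R]_n -> 'rV[R]_n,
    [\/ Pi = (fun y u => 2 *: perp (S y) (perp T u)),
        Pi = (fun y u => S y (T u))
      | Pi = (fun y u => - perp (S y) (T u))] ->
    approx_mean_curvature d rho xi Pi M eps @[eps --> 0^'+]
      --> mean_curvature d M 0) /\
  (forall Pi : 'rV[R]_n -> 'rV[R]_n -> 'rV[R]_n,
    [\/ Pi = (fun y u => T u),
        Pi = (fun y u => T (S y u)),
        Pi = (fun y u => S y (perp T u))
      | Pi = (fun y u => T (perp (S y) u))] ->
    approx_mean_curvature d rho xi Pi M eps @[eps --> 0^'+] --> (0 : 'rV[R]_n)).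
Proof.
move=> T S; have := hCrho; have := hCxi; rewrite /profile_cst => /eqP + /eqP.
rewrite !mulf_eq0 !negb_or => /andP[_ Ixi0] /andP[/andP[nd0 w0] Irho0].
have d_gt0 : (0 < d)%N by move: nd0; rewrite pnatr_eq0 -lt0n.
have w_gt0 : 0 < ball_volume R d by rewrite lt_def w0 ball_volume_ge0.
have [K [eta [_ etaP rho_eta Ieta]]] := profile_lipschitz_derivative hrho.
have [Kx [_ [xiP _ _ _]]] := profile_lipschitz_derivative hxi.
have [U [V [phi [J [psi [E [Q [[ch V0 phi0 J0 EE] [QL JQ HE]]]]]]]]] :=
  normal_chart_exists hM h0.
have [r [C [delta [g [r_gt0 C_gt0 delta_gt0 gr]]]]] :=
  normal_graph ch V0 phi0 EE QL JQ.
have -> : mean_curvature d M 0 =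
    \sum_i perp (proj (row_space E)) (Q (delta_mx 0 i) (delta_mx 0 i)).
  rewrite HE; apply: eq_bigr => i _; rewrite !rowE.
  exact: (graph_second_form ch V0 phi0 J0 EE QL JQ C_gt0 gr delta_gt0).
exact: (approx_mean_curvature_limits ch V0 phi0 J0 EE QL JQ r_gt0 C_gt0 delta_gt0 gr
  d_gt0 w_gt0 xiP etaP rho_eta (Ieta d d_gt0) Irho0 Ixi0).
Qed.
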